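(* Let $\mathcal G$ be a connected metric graph, $N\ge1$, and let $u\in H^1(\mathbb R^N\times\mathcal G)$ be a nonnegative function, with $y$-decreasing rearrangement $u^{*y}:\mathbb R^N\times\mathcal G^*\to\mathbb R$. Then $u^{*y}\in H^1(\mathbb R^N\times\mathcal G^* )$, and: - $\|u^{*y}\|_{L^p(\mathbb R^N\times\mathcal G^* )}^p=\|u\|_{L^p(\mathbb R^N\times\mathcal G)}^p$ for every $p\ge1$; - $\|\partial_yu^{*y}\|_{L^2(\mathbb R^N\times\mathcal G^* )}^2\le\|\partial_yu\|_{L^2(\mathbb R^N\times\mathcal G)}^2$; - $\|\nabla_xu^{*y}\|_{L^2(\mathbb R^N\times\mathcal G^* )}^2\le\|\nabla_xu\|_{L^2(\mathbb R^N\times\mathcal G)}^2$.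
   Context: A metric graph $\mathcal G$ is given by (at most countable) sets of edges and vertices; each edge $e$ has a length $\ell_e\in(0,+\infty]$ and is identified with $[0,\ell_e]$ (endpoints glued at vertices, self-loops allowed) or with $[0,+\infty)$ (with $0$ glued at a vertex). $l(\mathcal G)=\sum_e\ell_e\in(0,\infty]$. $H^1(\mathcal G)$ is the set of $w=\{w_e\}$ with $w_e\in H^1(e)$, $\sum_e\|w_e\|_{H^1(e)}^2<\infty$, $w$ continuous at every vertex. $H^1(\mathbb R^N\times\mathcal G)$ is the set of real-valued $u=\{u_e\}$ with $u_e\in H^1(\mathbb R^N\times e)$ for every edge, $\sum_e\|u_e\|_{H^1(\mathbb R^N\times e)}^2<\infty$, and equal traces on $\mathbb R^N\times\{v\}$ from any two edges meeting at the vertex $v$; equivalently, $u(\cdot,y)\in H^1(\mathbb R^N)$ for a.e. $y$, $u(x,\cdot)\in H^1(\mathcal G)$ for a.e. $x$, with $\int_{\mathcal G}\|u(\cdot,y)\|_{H^1(\mathbb R^N)}^2dy+\int_{\mathbb R^N}\|u(x,\cdot)\|_{H^1(\mathcal G)}^2dx<\infty$. Set $\mathcal G^*=[0,l(\mathcal G)]$ if $l(\mathcal G)<\infty$, $\mathcal G^*=[0,+\infty)$ otherwise (regarded as a metric graph). For nonnegative $f\in H^1(\mathcal G)$ put $\rho_f(t)=|\{y\in\mathcal G:f(y)>t\}|$ and define the decreasing rearrangement $f^*(y)=\inf\{t\ge0:\rho_f(t)\le y\}$, $y\in\mathcal G^*$. For nonnegative $u\in H^1(\mathbb R^N\times\mathcal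 G)$, $u^{*y}(x,y)=(u(x,\cdot))^*(y)$ for $y\in\mathcal G^*$ and a.e. $x$ (those with $u(x,\cdot)\in H^1(\mathcal G)$). *)

(* Defs.v *)
From HB Require Import structures.
From Stdlib Require Import Relation_Operators.
From mathcomp Require Import all_boot all_order all_algebra.
From mathcomp Require Import all_classical all_reals all_analysis.

Set Implicit Arguments.
Unset Strict Implicit.
Unset Printing Implicit Defensive.

Import Order.TTheory GRing.Theory Num.Theory numFieldNormedType.Exports.

Local Open Scope classical_set_scope.
Local Open Scope ring_scope.

(* ['rV[R]_N] gets the product sigma-algebra, generated by the coordinates;
   it is also the Borel sigma-algebra of the topology of ['rV[R]_N]. *)
Section rV_measurable.
Context (R : realType) (N : nat).

Definition rV_display : measure_display. Proof. by constructor. Qed.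

Definition rV_coord (i : 'I_N) (x : 'rV[R]_N) : R := x ord0 i.

Definition rV_measurable : set (set 'rV[R]_N) := g_sigma_preimage rV_coord.

Let rV_measurable0 : rV_measurable set0.
Proof. exact: sigma_algebra0. Qed.

Let rV_measurableC A : rV_measurable A -> rV_measurable (~` A).
Proof. exact: sigma_algebraC. Qed.

Let rV_measurable_bigcup (F : (set 'rV[R]_N)^nat) :
  (forall i, rV_measurable (F i)) -> rV_measurable (\bigcup_i (F i)).
Proof. exact: sigma_algebra_bigcup. Qed.

HB.instance Definition _ := @isMeasurable.Build rV_display 'rV[R]_N
  rV_measurable rV_measurable0 rV_measurableC rV_measurable_bigcup.

Lemma measurable_rV_coord (i : 'I_N) : measurable_fun setT (rV_coord i).
Proof.
move=> _ Y mY; rewrite setTI; apply: sub_sigma_algebra.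
rewrite -bigcup_seq /=; exists i => /=; first by rewrite mem_index_enum.
by exists Y => //; rewrite setTI.
Qed.

Lemma measurable_fun_rV d (T : measurableType d) (f : T -> 'rV[R]_N) :
  (forall i, measurable_fun setT (rV_coord i \o f)) -> measurable_fun setT f.
Proof.
move=> mf; apply: (@measurability _ _ _ _ _ _ (\big[setU/set0]_(i < N)
  preimage_set_system setT (@rV_coord i) measurable)) => //.
move=> _ [B + <-]; rewrite -bigcup_seq /= => -[i _ [A mA <-]].
rewrite !setTI -comp_preimage -[X in measurable X]setTI.
exact: (mf i).
Qed.

End rV_measurable.

Section lebesgue_rV.
Context (R : realType).

(* (x, y) in R^n * R as a point of R^(n+1), y being the last coordinate. *)
Definition rV_rcons n (p : 'rV[R]_n * R) : 'rV[R]_n.+1 :=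
  \row_(i < n.+1) (if unlift ord_max i is Some j then p.1 ord0 j else p.2).

Definition rV_rsplit n (z : 'rV[R]_n.+1) : 'rV[R]_n * R :=
  (\row_(i < n) z ord0 (lift ord_max i), z ord0 ord_max).

Definition rV_step n (mu : set 'rV[R]_n -> \bar R) :=
  pushforward (mu \x lebesgue_measure)%E (@rV_rcons n).

Fixpoint lebesgue_rV (n : nat) : set 'rV[R]_n -> \bar R :=
  match n with
  | 0 => dirac (0 : 'rV[R]_0)
  | n'.+1 => rV_step (@lebesgue_rV n')
  end.
Arguments lebesgue_rV : clear implicits.

Lemma rV_rconsK n : cancel (@rV_rcons n) (@rV_rsplit n).
Proof.
move=> [x y]; rewrite /rV_rsplit; congr (_, _).
  by apply/rowP => i; rewrite !mxE liftK.
by rewrite mxE unlift_none.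
Qed.

Lemma rV_rsplitK n : cancel (@rV_rsplit n) (@rV_rcons n).
Proof.
move=> z; apply/rowP => i; rewrite mxE /=.
by case: unliftP => [j ->|->]; rewrite ?mxE.
Qed.

Lemma measurable_rV_rcons n : measurable_fun setT (@rV_rcons n).
Proof.
apply: measurable_fun_rV => i; rewrite /comp /rV_coord.
case: (unliftP ord_max i) => [j ->|->].
  under eq_fun do rewrite mxE liftK.
  exact: (measurableT_comp (measurable_rV_coord j) measurable_fst).
under eq_fun do rewrite mxE unlift_none.
exact: measurable_snd.
Qed.

Lemma measurable_rV_rsplit n : measurable_fun setT (@rV_rsplit n).
Proof.
apply: measurable_fun_pair; last exact: measurable_rV_coord.
apply: measurable_fun_rV => i; rewrite /comp /rV_coord.
under eq_fun do rewrite mxE.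
exact: measurable_rV_coord.
Qed.

Section rV_step_measure.
Context n (mu : {sigma_finite_measure set 'rV[R]_n -> \bar R}).

Let rV_step0 : rV_step mu set0 = 0%E.
Proof. by rewrite /rV_step /pushforward preimage_set0 measure0. Qed.

Let rV_step_ge0 A : (0 <= rV_step mu A)%E.
Proof. exact: (measure_ge0 (mu \x lebesgue_measure)%E). Qed.

Let rV_step_sigma_additive : semi_sigma_additive (rV_step mu).
Proof.
exact: (@measure_semi_sigma_additive _ _ _
  (measure_function_pushforward__canonical__measure_function_Measure
     (mu \x lebesgue_measure)%E (@measurable_rV_rcons n))).
Qed.

HB.instance Definition _ := isMeasure.Build _ _ _ (rV_step mu)
  rV_step0 rV_step_ge0 rV_step_sigma_additive.

Let rV_step_sigma_finite : sigma_finite setT (rV_step mu).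
Proof.
have /sigma_finiteP[F [TF ndF Foo]] := sigma_finiteT mu.
have /sigma_finiteP[G [TG ndG Goo]] := sigma_finiteT (@lebesgue_measure R).
exists (fun k => @rV_rsplit n @^-1` (F k `*` G k)).
  rewrite -preimage_bigcup (_ : \bigcup_k (F k `*` G k) = setT) //.
  apply/seteqP; split=> // -[x y] _.
  have [k _ Fkx] : (\bigcup_i F i) x by rewrite -TF.
  have [l _ Gly] : (\bigcup_i G i) y by rewrite -TG.
  exists (maxn k l) => //; split => /=.
    by move: x Fkx; exact/subsetPset/ndF/leq_maxl.
  by move: y Gly; exact/subsetPset/ndG/leq_maxr.
move=> k; have [mF Fk] := Foo k; have [mG Gk] := Goo k; split.
  rewrite -[X in measurable X]setTI; apply: measurable_rV_rsplit => //.
  exact: measurableX.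
rewrite /rV_step /pushforward -comp_preimage (_ : _ \o _ = id); last first.
  by apply/funext => p /=; rewrite rV_rconsK.
by rewrite preimage_id product_measure1E// lte_mul_pinfty// ge0_fin_numE.
Qed.

HB.instance Definition _ := Measure_isSigmaFinite.Build _ _ _ (rV_step mu)
  rV_step_sigma_finite.

End rV_step_measure.

Lemma lebesgue_rV_sigma_finite_measure n :
  exists mu : {sigma_finite_measure set 'rV[R]_n -> \bar R},
    lebesgue_rV n = mu :> (set 'rV[R]_n -> \bar R).
Proof.
elim: n => [|n [mu muE]] /=.
  by exists [the {sigma_finite_measure set _ -> \bar R} of dirac (0 : 'rV[R]_0)].
exists [the {sigma_finite_measure set _ -> \bar R} of rV_step mu].
by rewrite muE.
Qed.

Section lebesgue_rV_measure.
Variable n : nat.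

Let lebesgue_rV0 : lebesgue_rV n set0 = 0%E.
Proof. by have [mu ->] := lebesgue_rV_sigma_finite_measure n. Qed.

Let lebesgue_rV_ge0 A : (0 <= lebesgue_rV n A)%E.
Proof. by have [mu ->] := lebesgue_rV_sigma_finite_measure n. Qed.

Let lebesgue_rV_sigma_additive : semi_sigma_additive (lebesgue_rV n).
Proof.
have [mu ->] := lebesgue_rV_sigma_finite_measure n.
exact: measure_semi_sigma_additive.
Qed.

HB.instance Definition _ := isMeasure.Build _ _ _ (lebesgue_rV n)
  lebesgue_rV0 lebesgue_rV_ge0 lebesgue_rV_sigma_additive.

Let lebesgue_rV_sigma_finite : sigma_finite setT (lebesgue_rV n).
Proof.
have [mu ->] := lebesgue_rV_sigma_finite_measure n; exact: sigma_finiteT.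
Qed.

HB.instance Definition _ := Measure_isSigmaFinite.Build _ _ _ (lebesgue_rV n)
  lebesgue_rV_sigma_finite.

End lebesgue_rV_measure.

End lebesgue_rV.

Arguments lebesgue_rV {R} n.

Section smooth.
Context {R : realType} {V : normedModType R}.

(* [f] is of class C^k: every iterated directional derivative of order at most
   [k] exists and is continuous. *)
Fixpoint Cn (k : nat) (f : V -> R) : Prop :=
  continuous f /\
  if k is k'.+1 then
    forall v : V, (forall z, derivable f z v) /\ Cn k' (fun z => 'D_v f z)
  else True.

Definition smooth (f : V -> R) : Prop := forall k, Cn k f.

Definition test_function (Omega : set V) (phi : V -> R) : Prop :=
  smooth phi /\
  exists K : set V,
    [/\ compact K, K `<=` Omega & forall z, ~ K z -> phi z = 0].

End smooth.

Section square_integrable.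
Context d (T : measurableType d) (R : realType).
Variable mu : {measure set T -> \bar R}.

Definition L2_on (D : set T) (f : T -> R) : Prop :=
  measurable_fun D f /\ (\int[mu]_(z in D) (f z ^+ 2)%:E < +oo)%E.

End square_integrable.

Section sobolev.
Context {R : realType} {N : nat}.
Implicit Types (Omega : set ('rV[R]_N * R)) (f g : 'rV[R]_N * R -> R).

Definition lebesgue_prod :
    {measure set ('rV[R]_N * measurableTypeR R) -> \bar R} :=
  (lebesgue_rV N \x lebesgue_measure)%E.

Definition is_weak_derivative Omega (v : 'rV[R]_N * R) f g : Prop :=
  L2_on lebesgue_prod Omega g /\
  forall phi, test_function Omega phi ->
    \int[lebesgue_prod]_(z in Omega) (f z * 'D_v phi z) =
    - \int[lebesgue_prod]_(z in Omega) (g z * phi z).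

(* Weak derivatives are unique up to a null set; [weak_derivative] is one of
   them whenever there is one in L^2. *)
Definition weak_derivative Omega (v : 'rV[R]_N * R) f : 'rV[R]_N * R -> R :=
  xget (fun=> 0) [set g | is_weak_derivative Omega v f g].

Definition x_dir (i : 'I_N) : 'rV[R]_N * R := (delta_mx ord0 i, 0).
Definition y_dir : 'rV[R]_N * R := (0, 1).

Definition d_x Omega (i : 'I_N) f := weak_derivative Omega (x_dir i) f.
Definition d_y Omega f := weak_derivative Omega y_dir f.

Definition normsq_grad_x Omega f (z : 'rV[R]_N * R) : R :=
  \sum_(i < N) d_x Omega i f z ^+ 2.

Definition H1_on Omega f : Prop :=
  [/\ L2_on lebesgue_prod Omega f,
      forall i, exists g, is_weak_derivative Omega (x_dir i) f g
    & exists g, is_weak_derivative Omega y_dir f g].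

Definition H1_normsq Omega f : \bar R :=
  (\int[lebesgue_prod]_(z in Omega)
     (f z ^+ 2 + normsq_grad_x Omega f z + d_y Omega f z ^+ 2)%:E)%E.

End sobolev.

(* An edge [e] is a copy of [0, elen e] if [elen e] is finite, of [0, +oo[
   otherwise; the point [0] of [e] is glued at [origin e] and, when [elen e] is
   finite, the point [elen e] is glued at [terminus e]. *)
Record metric_graph (R : realType) := MetricGraph {
  vertex : countType;
  edge : countType;
  elen : edge -> \bar R;
  origin : edge -> vertex;
  terminus : edge -> option vertex;
  elen_gt0 : forall e, (0 < elen e)%E;
  terminus_None : forall e, (terminus e == None) = (elen e == +oo%E);
  edge_nonempty : [set: edge] !=set0 }.

Section metric_graph_theory.
Context {R : realType} (G : metric_graph R).

Definition adjacent (v w : vertex G) : Prop :=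
  exists e : edge G, origin e = v /\ terminus e = Some w.

Definition graph_connected : Prop :=
  forall v w : vertex G, clos_refl_sym_trans (vertex G) adjacent v w.

Definition total_length : \bar R := \esum_(e in [set: edge G]) elen e.

Lemma total_length_gt0 : (0 < total_length)%E.
Proof.
have [e _] := edge_nonempty G; apply: lt_le_trans (elen_gt0 e) _.
apply: esum_ge; exists [set e]; first by split => //; exact: finite_set1.
by rewrite fsbig_set1.
Qed.

(* Edge ends: [false] is the end at the origin, [true] the end at the terminus. *)
Definition edge_end (e : edge G) (b : bool) : option (vertex G) :=
  if b then terminus e else Some (origin e).

(* The point of [e] at distance [s] from the end [b]. *)
Definition edge_point (e : edge G) (b : bool) (s : R) : R :=
  if b then fine (elen e) - s else s.

End metric_graph_theory.

(* The interval [0, l] (or [0, +oo[ if l = +oo) as a metric graph with a single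
   edge: the vertex [false] is the point 0, the vertex [true], present only if
   l < +oo, is the point l. *)
Section interval_graph.
Context (R : realType) (l : \bar R) (l_gt0 : (0 < l)%E).

Definition interval_vertex := {b : bool | b ==> (l != +oo%E)}.

Let interval_elen_gt0 (e : unit) : (0 < l)%E. Proof. exact: l_gt0. Qed.

Let interval_terminus_None (e : unit) :
  ((insub true : option interval_vertex) == None) = (l == +oo%E).
Proof.
case: insubP => [v|] /=; first by move=> /negbTE l_fin _; rewrite [RHS]l_fin.
by move=> /negPn l_inf; rewrite [RHS]l_inf.
Qed.

Let interval_edge_nonempty : [set: unit] !=set0. Proof. by exists tt. Qed.

Definition interval_graph : metric_graph R :=
  @MetricGraph R interval_vertex unit (fun=> l) (fun=> Sub false isT)
    (fun=> insub true) interval_elen_gt0 interval_terminus_None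
    interval_edge_nonempty.

End interval_graph.

Definition star_graph (R : realType) (G : metric_graph R) : metric_graph R :=
  interval_graph (total_length_gt0 G).

(* A function on R^N * G is a family of functions indexed by the edges; only
   the values of the component [u e] on [cylinder e] are meaningful. The
   endpoints of the edges, which form a null set, are left out. *)
Section graph_functions.
Context {R : realType} (G : metric_graph R) (N : nat).

Definition edge_interior (e : edge G) : set R :=
  [set y | 0 < y /\ (y%:E < elen e)%E].

Definition cylinder (e : edge G) : set ('rV[R]_N * R) :=
  [set: 'rV[R]_N] `*` edge_interior e.

Implicit Types (u : edge G -> 'rV[R]_N * R -> R).

(* [T] is the trace of [w], defined on the cylinder of [e], on the face
   R^N * {y = end b of e}: w(., y) tends to T in L^2(R^N), in mean, as y tends
   to that end. *)
Definition is_trace (e : edge G) (b : bool) (w : 'rV[R]_N * R -> R)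
    (T : 'rV[R]_N -> R) : Prop :=
  (fun h : R => h^-1%:E *
     \int[lebesgue_prod]_(z in [set: 'rV[R]_N] `*` [set s : R | 0 < s < h]%R)
       ((w (z.1, edge_point e b z.2) - T z.1) ^+ 2)%:E)%E @ 0^'+ --> 0%E.

Definition H1_graph u : Prop :=
  [/\ forall e, H1_on (cylinder e) (u e),
      (\esum_(e in [set: edge G]) H1_normsq (cylinder e) (u e) < +oo)%E
    & forall v : vertex G, exists2 T : 'rV[R]_N -> R,
        L2_on (lebesgue_rV N) setT T
      & forall e b, edge_end e b = Some v -> is_trace e b (u e) T].

Definition nonneg_ae u : Prop :=
  forall e, {ae lebesgue_prod, forall z, cylinder e z -> 0 <= u e z}.

Definition Lp_normp (p : R) u : \bar R :=
  \esum_(e in [set: edge G])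
    (\int[lebesgue_prod]_(z in cylinder e) (`|u e z| `^ p)%:E)%E.

Definition d_y_normsq u : \bar R :=
  \esum_(e in [set: edge G])
    (\int[lebesgue_prod]_(z in cylinder e) (d_y (cylinder e) (u e) z ^+ 2)%:E)%E.

Definition grad_x_normsq u : \bar R :=
  \esum_(e in [set: edge G])
    (\int[lebesgue_prod]_(z in cylinder e)
       (normsq_grad_x (cylinder e) (u e) z)%:E)%E.

End graph_functions.

Section rearrangement.
Context {R : realType} (G : metric_graph R).

Definition distribution_fun (f : edge G -> R -> R) (t : R) : \bar R :=
  \esum_(e in [set: edge G])
    lebesgue_measure (edge_interior e `&` [set y | t < f e y]).

(* The infimum of the empty set is 0 by convention, but for f in L^2(G) the set
   below is nonempty as soon as y > 0. *)
Definition rearrangement (f : edge G -> R -> R) (y : R) : R :=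
  inf [set t : R | 0 <= t /\ (distribution_fun f t <= y%:E)%E].

Definition y_rearrangement (N : nat) (u : edge G -> 'rV[R]_N * R -> R) :
    edge (star_graph G) -> 'rV[R]_N * R -> R :=
  fun _ z => rearrangement (fun e y => u e (z.1, y)) z.2.

End rearrangement.

(* Main.v *)
(** Each slice [u(x, .)] is equimeasurable with [u^{*y}(x, .)], and the layer
cake formula gives the identity of the L^p norms. For a function of L^2,
having a weak derivative in L^2 with [||d_v f||^2 <= C] is equivalent to
[||f(. + h v) - f||^2 <= C h^2] for all [h > 0] (one direction is the Riesz
representation theorem on the test functions), and these bounds pass to the
rearrangement. In the directions of R^N this holds because the rearrangement
is a contraction of L^2. In the direction y, almost every slice [f] is
absolutely continuous on the edges and continuous at the vertices; as the
graph is connected, [f] takes all the values between [f*(b)] and [f*(a)],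
and since [f*(b) < f < f*(a)] only on a set of measure at most [b - a],
Cauchy-Schwarz yields
[(f*(a) - f*(b))^2 <= (b - a) int_{f*(b) < f < f*(a)} |f'|^2],
which is then integrated along [b = a + h]. The same inequality bounds the
oscillation of [u^{*y}(x, .)] at the ends of [0, l], hence gives its traces. *)

Require Import Defs.
From HB Require Import structures.
From mathcomp Require Import all_boot all_order all_algebra.
From mathcomp Require Import all_classical all_reals all_analysis measurable_realfun.
From mathcomp Require Import ring lra.

Set Implicit Arguments.
Unset Strict Implicit.
Unset Printing Implicit Defensive.

Import Order.TTheory GRing.Theory Num.Theory numFieldNormedType.Exports.

Local Open Scope classical_set_scope.
Local Open Scope ring_scope.

(** * The Hilbert space L^2 and the Riesz representation *)

(** Three obstacles shape the proof. Weak derivatives are known only up to null sets, and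
    [weak_derivative] picks an arbitrary one, whereas rearranging acts on values: increments involve
    no derivative, so they are what is carried through the rearrangement, and du Bois-Reymond's
    lemma makes the norm independent of the choice. A graph comes without a measure: its edges are
    numbered, and a function on it becomes a function on [nat * R] with counting times Lebesgue
    measure, so that rearrangements can be studied on an abstract sigma-finite space. Traces are
    given only as limits in mean: subtracting from u the primitive of the slices of its y-derivative
    leaves a function invariant under translations in y, and a doubling argument on thin slabs
    identifies it with the trace at the origin. This provides the absolutely continuous slices, and
    the trace at the other end then gives their continuity at the termini. *)

Lemma cvg_of_scaled_increments (R : realType) (u : R^nat) (C : R) :
  (forall n, 4 ^+ n * (u n.+1 - u n) ^+ 2 <= C) -> cvgn u.
Proof.
move=> uC.
have C0 : 0 <= C by apply: le_trans (uC 0%N); rewrite mulr_ge0 ?sqr_ge0 ?expr0.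
suff : cvgn (series (telescope u)).
  rewrite telescopeK => cu.
  have -> : u = fun n => (u n - u 0%N) + u 0%N by apply/funext => n; rewrite subrK.
  by apply: is_cvgD => //; exact: is_cvg_cst.
(* The hypothesis bounds the increments by [Num.sqrt C * 2^-n], so their series is dominated by a
   geometric one. *)
apply: normed_cvg.
apply: (@series_le_cvg _ _ (geometric (Num.sqrt C) 2^-1)) => [n|n|n|].
- exact: normr_ge0.
- by rewrite /= mulr_ge0 ?sqrtr_ge0// exprn_ge0.
- rewrite /telescope /=; rewrite -sqrtr_sqr.
  have -> : 2^-1 ^+ n = Num.sqrt (4^-1 ^+ n) :> R.
    rewrite (_ : 4^-1 = 2^-1 ^+ 2) -?exprM; last first.
      by rewrite exprVn -natrX.
    by rewrite mulnC exprM sqrtr_sqr ger0_norm// exprn_ge0.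
  rewrite -sqrtrM// ler_wsqrtr// exprVn ler_pdivlMr ?exprn_gt0// mulrC.
  exact: uC.
- by apply: is_cvg_geometric_series; rewrite gtr0_norm ?invr_gt0// invf_lt1// ltr1n.
Qed.

Lemma limn_einf_le_cst (R : realType) (u : (\bar R)^nat) (C : \bar R) :
  (forall n, (u n <= C)%E) -> (limn_einf u <= C)%E.
Proof.
move=> uC; rewrite limn_einf_lim; apply: lime_le; first exact: is_cvg_einfs.
apply: nearW => n; apply: le_trans (uC n); apply: ereal_inf_lbound => /=.
by exists n => /=.
Qed.

Lemma limn_einf_ge0 (R : realType) (u : (\bar R)^nat) :
  (forall n, (0 <= u n)%E) -> (0 <= limn_einf u)%E.
Proof.
move=> u0; rewrite limn_einf_lim; apply: lime_ge; first exact: is_cvg_einfs.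
by apply: nearW => n; apply: le_ereal_inf_tmp => _ [m _ <-].
Qed.

Section L2_space.
Context d (T : measurableType d) (R : realType).
Variable mu : {measure set T -> \bar R}.
Implicit Types f g : T -> R.

Definition inner f g : R := \int[mu]_z (f z * g z).
Notation L2 f := (L2_on mu setT f).

Lemma L2_mul_integrable f g : L2 f -> L2 g ->
  mu.-integrable setT (fun z => (f z * g z)%:E).
Proof.
move=> [mf If] [mg Ig].
apply: (@le_integrable _ _ _ _ _ measurableT _
    (fun z => (f z ^+ 2)%:E + (g z ^+ 2)%:E)%E).
- by apply/measurable_EFinP; exact: measurable_funM.
- move=> z _ /=; rewrite lee_fin (ger0_norm (x := _ + _)); last by rewrite addr_ge0 ?sqr_ge0.
  by rewrite ler_norml; apply/andP; split; nra.
- apply: integrableD => //; apply/integrableP; split.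
  + by apply/measurable_EFinP; exact: measurable_funX.
  + by under eq_integral do rewrite gee0_abs ?lee_fin ?sqr_ge0//.
  + by apply/measurable_EFinP; exact: measurable_funX.
  + by under eq_integral do rewrite gee0_abs ?lee_fin ?sqr_ge0//.
Qed.

Lemma L2_sqE f : L2 f -> (\int[mu]_z (f z ^+ 2)%:E)%E = (inner f f)%:E.
Proof.
move=> f2; rewrite /inner /Rintegral fineK; last first.
  exact: integrable_fin_num (L2_mul_integrable f2 f2).
by apply: eq_integral => z _; rewrite expr2.
Qed.

Lemma L2_lin c f g : L2 f -> L2 g -> L2 (fun z => c * f z + g z).
Proof.
move=> f2 g2; have [mf _] := f2; have [mg _] := g2; split.
  by apply: measurable_funD => //; exact: measurable_funM.
have h : (forall z, ((c * f z + g z) ^+ 2)%:E = (c ^+ 2)%:E * (f z * f z)%:E +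
    ((2 * c)%:E * (f z * g z)%:E + (g z * g z)%:E))%E.
  by move=> z; rewrite -!EFinM -!EFinD; congr EFin; ring.
under eq_integral do rewrite h.
apply: integrable_lty => //; apply: integrableD => //.
  by apply: integrableZl => //; exact: L2_mul_integrable.
apply: integrableD => //; last exact: L2_mul_integrable.
by apply: integrableZl => //; exact: L2_mul_integrable.
Qed.

Lemma L2_0 : L2 (fun=> 0).
Proof.
split; first exact: measurable_cst.
by rewrite (eq_integral (cst 0%E)) ?integral0 ?ltry// => z _; rewrite expr0n.
Qed.

Lemma L2D f g : L2 f -> L2 g -> L2 (fun z => f z + g z).
Proof.
move=> f2 g2; have := L2_lin 1 f2 g2.
by under eq_fun do rewrite mul1r.
Qed.

Lemma L2Z c f : L2 f -> L2 (fun z => c * f z).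
Proof.
move=> f2; have := L2_lin c f2 L2_0.
by under eq_fun do rewrite addr0.
Qed.

Lemma L2B f g : L2 f -> L2 g -> L2 (fun z => f z - g z).
Proof.
move=> f2 g2; have := L2_lin (-1) g2 f2.
by under eq_fun do rewrite mulN1r addrC.
Qed.

Lemma innerC f g : inner f g = inner g f.
Proof. by apply: eq_Rintegral => z _; rewrite mulrC. Qed.

Lemma inner_ge0 f : 0 <= inner f f.
Proof. by apply: Rintegral_ge0 => z _; rewrite -expr2 sqr_ge0. Qed.

Lemma inner_lin c f g k : L2 f -> L2 g -> L2 k ->
  inner k (fun z => c * f z + g z) = c * inner k f + inner k g.
Proof.
move=> f2 g2 k2; rewrite /inner.
have h z : k z * (c * f z + g z) = c * (k z * f z) + k z * g z by ring.
under eq_Rintegral do rewrite h.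
have ikf := L2_mul_integrable k2 f2.
rewrite RintegralD ?RintegralZl//; last exact: L2_mul_integrable.
by have := integrableZl measurableT c ikf.
Qed.

Lemma innerZ c k f : L2 k -> L2 f -> inner k (fun z => c * f z) = c * inner k f.
Proof.
move=> k2 f2; rewrite /inner; under eq_Rintegral do rewrite mulrCA.
by rewrite RintegralZl//; exact: L2_mul_integrable.
Qed.

Lemma inner_sqr_lin c f g : L2 f -> L2 g ->
  inner (fun z => c * f z + g z) (fun z => c * f z + g z) =
  c ^+ 2 * inner f f + 2 * c * inner f g + inner g g.
Proof.
move=> f2 g2; have fg2 := L2_lin c f2 g2.
rewrite inner_lin// (innerC _ f) (innerC _ g) !inner_lin// (innerC g f); ring.
Qed.

(** The polynomial c -> ||c f + g||^2 is nonnegative; it is evaluated at its minimum. If f has norm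
    0 it is affine in c, and unless [inner f g] vanishes a suitable c gives it the value -1. *)
Lemma inner_cauchy_schwarz f g : L2 f -> L2 g ->
  inner f g ^+ 2 <= inner f f * inner g g.
Proof.
move=> f2 g2.
have pos c : 0 <= c ^+ 2 * inner f f + 2 * c * inner f g + inner g g.
  by rewrite -inner_sqr_lin// inner_ge0.
have f0 := inner_ge0 f; have g0 := inner_ge0 g.
have [ff0|ff0] := eqVneq (inner f f) 0.
  have [->|fg0] := eqVneq (inner f g) 0; first by rewrite expr0n mulr_ge0.
  have := pos (- (inner g g + 1) / (2 * inner f g)).
  rewrite ff0 mulr0 add0r.
  have -> : 2 * (- (inner g g + 1) / (2 * inner f g)) * inner f g = - (inner g g + 1).
    by field.
  by move=> h; exfalso; move: h; lra.
have fp : 0 < inner f f by rewrite lt_neqAle eq_sym ff0.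
have := pos (- inner f g / inner f f).
have -> : (- inner f g / inner f f) ^+ 2 * inner f f +
   2 * (- inner f g / inner f f) * inner f g + inner g g =
   (inner f f * inner g g - inner f g ^+ 2) / inner f f by field.
by rewrite pmulr_lge0 ?invr_gt0// subr_ge0.
Qed.

(** The upper limit, made real by [fine], is defined and measurable everywhere, even where the
    sequence diverges; it serves as representative of almost everywhere limits. *)
Lemma limn_esup_fin_measurable (f_ : (T -> R)^nat) :
  (forall n, measurable_fun setT (f_ n)) ->
  measurable_fun setT (fun z => fine (limn_esup (fun n => (f_ n z)%:E))).
Proof.
move=> mf; apply: (measurableT_comp (fine_measurable _)) => //.
by apply: measurable_fun_limn_esup => n; exact/measurable_EFinP.
Qed.

Lemma fine_limn_esup_cvg (u : R^nat) : cvgn u ->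
  u @ \oo --> fine (limn_esup (EFin \o u)).
Proof.
move=> cu; have : EFin \o u @ \oo --> (limn u)%:E by apply: cvg_EFin => //; exact: nearW.
by move/cvg_limn_einf_sup => [_ ->]; exact: cu.
Qed.

(* Riesz-Fischer without Chebyshev: the series of [4^n (f_(n+1) - f_n)^2] converges
   almost everywhere, so the increments decay like [2^-n]. *)
Lemma L2_complete (f_ : (T -> R)^nat) : (forall n, L2 (f_ n)) ->
  (forall n m, (n <= m)%N ->
    inner (fun z => f_ m z - f_ n z) (fun z => f_ m z - f_ n z) <= (8 ^+ n)^-1) ->
  exists f, L2 f /\
    forall n, inner (fun z => f z - f_ n z) (fun z => f z - f_ n z) <= (8 ^+ n)^-1.
Proof.
move=> f2 fC; have mf n := (f2 n).1.
pose f z := fine (limn_esup (fun n => (f_ n z)%:E)).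
have mlim : measurable_fun setT f by exact: limn_esup_fin_measurable.
(* Against the Cauchy rate 8^-n, the factor 4^n leaves integrals bounded by 2^-n, whose sum is
   finite. *)
pose a n z := 4 ^+ n * (f_ n.+1 z - f_ n z) ^+ 2.
have ma n : measurable_fun setT (EFin \o a n).
  apply/measurable_EFinP; apply: measurable_funM => //.
  by apply: measurable_funX; exact: measurable_funB.
have a0 n z : (0 <= (a n z)%:E)%E by rewrite lee_fin mulr_ge0 ?sqr_ge0 ?exprn_ge0.
have Ia n : (\int[mu]_z (a n z)%:E <= ((2 ^+ n)^-1)%:E)%E.
  under eq_integral do rewrite /a EFinM.
  rewrite ge0_integralZl//; last 2 first.
  - by apply/measurable_EFinP/measurable_funX; exact: measurable_funB.
  - by move=> z _; rewrite lee_fin sqr_ge0.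
  rewrite L2_sqE; last exact: L2B.
  rewrite -EFinM lee_fin (le_trans (ler_wpM2l _ (fC _ _ (leqnSn n))))//.
  rewrite (_ : 8 = 4 * 2 :> R) -?natrM// natrM.
  by rewrite exprMn invfM mulrA divff ?mul1r// expf_neq0.
have Isum : (\int[mu]_z (\sum_(n <oo) (a n z)%:E) < +oo)%E.
  rewrite integral_nneseries//.
  apply: (@le_lt_trans _ _ (\sum_(n <oo) ((2 ^+ n)^-1)%:E)%E).
    apply: lee_nneseries => [n _|n _]; last exact: Ia.
    by move=> _; apply: integral_ge0 => z _; exact: a0.
  apply: (@le_lt_trans _ _ (2%:E : \bar R)); last exact: ltry.
  apply: lime_le.
    by apply: is_cvg_nneseries => n _ _; rewrite lee_fin invr_ge0 exprn_ge0.
  apply: nearW => n; rewrite sumEFin lee_fin.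
  rewrite (_ : \sum_(0 <= i < n) _ = series (geometric 1 2^-1) n); last first.
    by apply: eq_bigr => i _ /=; rewrite mul1r exprVn.
  apply: le_trans (geometric_le_lim n ler01 _ _) _; rewrite ?invr_gt0//.
    by rewrite gtr0_norm ?invr_gt0// invf_lt1// ltr1n.
  by rewrite mul1r (_ : 1 - 2^-1 = 2^-1 :> R) ?invrK//; lra.
have cvg_ae : {ae mu, forall z, f_ ^~ z @ \oo --> f z}.
  have : {ae mu, forall z, setT z -> (\sum_(n <oo) (a n z)%:E)%E \is a fin_num}.
    apply: (@integrable_ae _ _ _ mu setT measurableT); apply/integrableP; split.
      by apply: ge0_emeasurable_sum => n *; [exact: a0|exact: ma].
    under eq_integral do rewrite gee0_abs ?nneseries_ge0//; exact: Isum.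
  apply: filterS => z /(_ I) finz; apply: fine_limn_esup_cvg.
  apply: (@cvg_of_scaled_increments _ _ (fine (\sum_(n <oo) (a n z)%:E))) => n.
  rewrite -lee_fin fineK// -/(a n z).
  apply: le_trans (nneseries_lim_ge n.+1 _) => //.
  by rewrite big_nat_recr//= leeDr// sume_ge0.
(* Fatou's lemma in the second index carries the Cauchy bound to the limit with the same
   constant. *)
have bound n : (\int[mu]_z ((f z - f_ n z) ^+ 2)%:E <= ((8 ^+ n)^-1)%:E)%E.
  pose b m z := (((f_ (m + n)%N z - f_ n z) ^+ 2)%:E)%E.
  have mb m : measurable_fun setT (b m).
    by apply/measurable_EFinP/measurable_funX; exact: measurable_funB.
  have b0 m z : setT z -> (0 <= b m z)%E by move=> _; rewrite lee_fin sqr_ge0.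
  apply: (@le_trans _ _ (\int[mu]_z limn_einf (b ^~ z))%E).
    apply: ae_ge0_le_integral => //.
    - by move=> z _; rewrite lee_fin sqr_ge0.
    - by apply/measurable_EFinP/measurable_funX; exact: measurable_funB.
    - move=> z _; apply: limn_einf_ge0 => m; exact: b0.
    - have -> : (fun z => limn_einf (b ^~ z)) =
          (fun z => - limn_esup (fun m => - b m z))%E.
        by apply/funext => z; rewrite -limn_einfN; congr limn_einf; apply/funext => m; rewrite /comp oppeK.
      apply: measurableT_comp => //; apply: measurable_fun_limn_esup => m.
      exact: measurableT_comp.
    - apply: filterS cvg_ae => z fz _.
      have : b ^~ z @ \oo --> ((f z - f_ n z) ^+ 2)%:E.
        apply: cvg_EFin; first exact: nearW.
        have fzn : f_ (m + n)%N z @[m --> \oo] --> f z by rewrite (cvg_shiftn n (fun m => f_ m z)).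
        have fzB : f_ (m + n)%N z - f_ n z @[m --> \oo] --> f z - f_ n z.
          by apply: cvgB => //; exact: cvg_cst.
        exact: (cvgM fzB fzB).
      by move/cvg_limn_einf_sup => [-> _].
  apply: (le_trans (fatou _ _ mb b0)) => //.
  apply: limn_einf_le_cst => m.
  by rewrite /b L2_sqE ?lee_fin ?fC ?leq_addl//; exact: L2B.
have fn2 n : L2 (fun z => f z - f_ n z).
  by split; [exact: measurable_funB|apply: le_lt_trans (bound n) _; exact: ltry].
exists f; split; last by move=> n; rewrite -lee_fin -L2_sqE.
have -> : f = fun z => (f z - f_ 0%N z) + f_ 0%N z by apply/funext => z; rewrite subrK.
exact: L2D.
Qed.

Lemma inner_parallelogram f g : L2 f -> L2 g ->
  inner (fun z => f z - g z) (fun z => f z - g z) =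
  2 * inner f f + 2 * inner g g -
  4 * inner (fun z => 2^-1 * f z + 2^-1 * g z) (fun z => 2^-1 * f z + 2^-1 * g z).
Proof.
move=> f2 g2.
have -> : (fun z => f z - g z) = (fun z => (-1) * g z + f z).
  by apply/funext => z; rewrite mulN1r addrC.
have hg : L2 (fun z => 2^-1 * g z) by exact: L2Z.
have -> : inner (fun z => 2^-1 * f z + 2^-1 * g z) (fun z => 2^-1 * f z + 2^-1 * g z) =
  2^-1 ^+ 2 * (inner f f + 2 * inner f g + inner g g).
  by rewrite inner_sqr_lin// (innerZ _ f2 g2) (innerZ _ hg g2) (innerC (fun z => _ * g z)) (innerZ _ g2 g2); ring.
by rewrite inner_sqr_lin// (innerC g f); field.
Qed.

(* Riesz representation on a subspace: a minimising sequence of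
   [inner f f / 2 - L f] is Cauchy by the parallelogram identity, and its limit
   represents [L] by the Euler equation. *)
Lemma riesz_representation (S : set (T -> R)) (L : (T -> R) -> R) (C : R) :
  0 <= C -> S !=set0 -> (forall f, S f -> L2 f) ->
  (forall c f g, S f -> S g -> S (fun z => c * f z + g z)) ->
  (forall c f g, S f -> S g -> L (fun z => c * f z + g z) = c * L f + L g) ->
  (forall f, S f -> L f ^+ 2 <= C * inner f f) ->
  exists g, [/\ L2 g, forall f, S f -> L f = inner g f & inner g g <= C].
Proof.
move=> C0 [s0 Ss0] S2 Slin Llin LC.
pose J f := 2^-1 * inner f f - L f.
have LC2 f : S f -> `|L f| <= 2^-1 * (C + inner f f).
  move=> Sf; have := LC _ Sf; have := inner_ge0 f => f0 h.
  have LC2' : L f ^+ 2 <= (2^-1 * (C + inner f f)) ^+ 2.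
    apply: le_trans h _; have := sqr_ge0 (C - inner f f).
    by rewrite !expr2; lra.
  rewrite ler_norml; have : 0 <= 2^-1 * (C + inner f f) by rewrite mulr_ge0 ?addr_ge0.
  move: LC2'; rewrite !expr2 => ? ?; apply/andP; split; nra.
pose E := J @` S.
have infE : has_inf E.
  split; first by exists (J s0), s0.
  exists (- (2^-1 * C)) => _ [f Sf <-].
  have := LC2 _ Sf; rewrite ler_norml => /andP[_]; rewrite /J; lra.
pose m := inf E.
have mJ f : S f -> m <= J f by move=> Sf; apply: (inf_lbound infE.2); exists f.
(* The parallelogram identity reads ||f - g||^2 = 4 J f + 4 J g - 8 J ((f + g) / 2), so an excess of
   8^-n / 8 over the infimum gives exactly the rate 8^-n that [L2_complete] asks for. *)
have [phi phiP] : exists phi : nat -> T -> R,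
    forall n, S (phi n) /\ J (phi n) <= m + (8 ^+ n)^-1 / 8.
  suff /choice[phi phiP] : forall n, exists f, S f /\ J f <= m + (8 ^+ n)^-1 / 8.
    by exists phi.
  move=> n; have e0 : 0 < (8 ^+ n)^-1 / 8 :> R by rewrite divr_gt0 ?invr_gt0 ?exprn_gt0.
  by have [_ [f Sf <-] Jf] := inf_adherent e0 infE; exists f; split => //; exact: ltW.
have Sphi n := (phiP n).1; have phi2 n := S2 _ (Sphi n).
have decr n k : (n <= k)%N -> (8 ^+ k)^-1 <= (8 ^+ n)^-1 :> R.
  by move=> nk; rewrite lef_pV2 ?posrE ?exprn_gt0// ler_eXn2l// ltr1n.
have phiC n k : (n <= k)%N -> inner (fun z => phi k z - phi n z)
    (fun z => phi k z - phi n z) <= (8 ^+ n)^-1.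
  move=> nk; rewrite inner_parallelogram//.
  (* [S] is only assumed stable under [c * f + g], so half of [phi n] is written as
     [(2^-1 - 1) * phi n + phi n]. *)
  have S_avg : S (fun z => 2^-1 * phi k z + 2^-1 * phi n z).
    have := Slin 2^-1 _ _ (Sphi k) (Slin (2^-1 - 1) _ _ (Sphi n) (Sphi n)).
    by under eq_fun do rewrite mulrBl mul1r subrK.
  have L_avg : L (fun z => 2^-1 * phi k z + 2^-1 * phi n z) =
      2^-1 * L (phi k) + 2^-1 * L (phi n).
    have := Llin 2^-1 _ _ (Sphi k) (Slin (2^-1 - 1) _ _ (Sphi n) (Sphi n)).
    rewrite (Llin (2^-1 - 1))//.
    under eq_fun do rewrite mulrBl mul1r subrK.
    by move=> ->; congr (_ + _); rewrite mulrBl mul1r subrK.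
  have := mJ _ S_avg; have := (phiP n).2; have := (phiP k).2; have := decr _ _ nk.
  by rewrite /J L_avg; lra.
have [g [g2 gphi]] := L2_complete phi2 phiC.
exists g.
have small (x K : R) : (forall n, 0 <= x + K * (2 ^+ n)^-1) -> 0 <= x.
  move=> xn; rewrite leNgt; apply/negP => x0.
  have h2 : `|2^-1 : R| < 1 by rewrite gtr0_norm ?invr_gt0// invf_lt1// ltr1n.
  have /cvgrPdist_lt/(_ (- x)) := cvg_geometric K h2; rewrite oppr_gt0.
  move=> /(_ x0)[n _ /(_ n (leqnn n))]; rewrite /= sub0r normrN exprVn ltr_norml => /andP[_].
  by have := xn n; lra.
have near_bound (x b : R) n : 0 <= b -> x ^+ 2 <= (8 ^+ n)^-1 * b ->
    `|x| <= (2 ^+ n)^-1 * (b + 1).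
  move=> b0 xb; rewrite -ler_sqr ?nnegrE ?mulr_ge0 ?invr_ge0 ?exprn_ge0 ?addr_ge0//.
  rewrite real_normK ?num_real//; apply: le_trans xb _; rewrite exprMn exprVn -exprM mulnC exprM.
  apply: ler_pM; rewrite ?invr_ge0 ?exprn_ge0//.
    by rewrite lef_pV2 ?posrE ?exprn_gt0// lerXn2r ?nnegrE// -natrX ler_nat.
  by rewrite expr2; nra.
have small8 n : (8 ^+ n)^-1 <= (2 ^+ n)^-1 :> R.
  by rewrite lef_pV2 ?posrE ?exprn_gt0// lerXn2r ?nnegrE// ler_nat.
have euler f : S f -> L f = inner g f.
  move=> Sf; have f2 := S2 _ Sf; set a := inner f f; have a0 : 0 <= a := inner_ge0 f.
  set D := inner g f - L f.
  (* Compare [J] at [phi n + t f] with its infimum; replacing [phi n] by its limit [g] costs a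
     multiple of 2^-n, which [small] removes. *)
  have tD t : 0 <= t * D + 2^-1 * t ^+ 2 * a.
    apply: (small _ (`|t| * (a + 1) + 1)) => n.
    have := mJ _ (Slin t _ _ Sf (Sphi n)).
    rewrite /J Llin// inner_sqr_lin// -/a; have := (phiP n).2; rewrite /J.
    have := inner_cauchy_schwarz (L2B g2 (phi2 n)) f2; rewrite -/a => cs.
    have {}cs : inner (fun z => g z - phi n z) f ^+ 2 <= (8 ^+ n)^-1 * a.
      by apply: le_trans cs _; rewrite ler_wpM2r.
    have := near_bound _ _ _ a0 cs.
    have -> : inner (fun z => g z - phi n z) f = inner g f - inner f (phi n).
      have -> : (fun z => g z - phi n z) = (fun z => (-1) * phi n z + g z).
        by apply/funext => z; rewrite mulN1r addrC.
      by rewrite innerC inner_lin// mulN1r addrC (innerC f g).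
    set e := inner g f - _ => he.
    have h : - (t * e) <= `|t| * ((2 ^+ n)^-1 * (a + 1)).
      rewrite -mulrN (le_trans (ler_norm _))// normrM normrN ler_wpM2l//.
    have -> : inner f (phi n) = inner g f - e by rewrite /e; ring.
    have := small8 n; have : 0 <= (2 ^+ n)^-1 :> R by rewrite invr_ge0 exprn_ge0.
    have : 0 <= (8 ^+ n)^-1 :> R by rewrite invr_ge0 exprn_ge0.
    move: h; rewrite /D; set u := (2 ^+ n)^-1; set v := (8 ^+ n)^-1; lra.
  suff : D = 0 by move/eqP; rewrite subr_eq0 => /eqP.
  have a1 : 0 < a + 1 by lra.
  (* The minimum would be at [- D / a]; the denominator [a + 1] avoids a separate case when f has
     norm 0. *)
  have := tD (- D / (a + 1)).
  have -> : - D / (a + 1) * D + 2^-1 * (- D / (a + 1)) ^+ 2 * a =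
     - (D ^+ 2 * ((a + 2) / (2 * (a + 1) ^+ 2))).
    by field; rewrite gt_eqF.
  rewrite oppr_ge0 pmulr_lle0 ?divr_gt0 ?mulr_gt0 ?exprn_gt0//; last by lra.
  by rewrite le_eqVlt ltNge sqr_ge0 orbF sqrf_eq0 => /eqP.
split=> //; set p := inner g g; have p0 : 0 <= p := inner_ge0 g.
(* [g] need not belong to [S], so the bound on [L] is applied to [phi n]; in the limit it becomes
   p^2 <= C p. *)
suff : 0 <= C * p - p ^+ 2.
  have [->|pn0] := eqVneq p 0; first by rewrite C0.
  by rewrite expr2 -mulrBl pmulr_lge0 ?subr_ge0// lt_neqAle eq_sym pn0.
apply: (small _ (C * (2 * (p + 1) + 1) + 2 * p * (p + 1))) => n.
have := LC _ (Sphi n); rewrite (euler _ (Sphi n)).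
have psi2 := L2B g2 (phi2 n).
have cs : inner (fun z => g z - phi n z) g ^+ 2 <= (8 ^+ n)^-1 * p.
  by apply: le_trans (inner_cauchy_schwarz psi2 g2) _; rewrite ler_wpM2r.
have := near_bound _ _ _ p0 cs.
set psi := fun z => g z - phi n z.
have -> : phi n = (fun z => (-1) * psi z + g z).
  by apply/funext => z; rewrite /psi mulN1r opprB subrK.
rewrite inner_sqr_lin// inner_lin// (innerC g psi) -/p.
set e := inner psi g => he.
have := gphi n; rewrite -/psi; set r := inner psi psi => hr.
have r0 : 0 <= r := inner_ge0 psi.
have := small8 n; have : 0 <= (2 ^+ n)^-1 :> R by rewrite invr_ge0 exprn_ge0.
move: hr he; set u := (2 ^+ n)^-1; set v := (8 ^+ n)^-1.
rewrite ler_norml => hr /andP[he1 he2] u0 vu h.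
have e1 : p * e <= p * (u * (p + 1)) by exact: ler_wpM2l.
have e2 : C * (- e) <= C * (u * (p + 1)) by apply: ler_wpM2l => //; lra.
have e3 : C * r <= C * u by apply: ler_wpM2l => //; lra.
have := sqr_ge0 e; move: h; rewrite !expr2; lra.
Qed.

End L2_space.

(** * Lebesgue measure on boxes and its translations *)

Section space_measure.
Context {R : realType} {N : nat}.
Local Notation V := ('rV[R]_N * R)%type.
Local Notation mV := ('rV[R]_N * measurableTypeR R)%type.
Implicit Types (z v : V).

(** [None] stands for the coordinate y, so that boxes and test functions treat all the coordinates
    alike. *)
Definition coor (o : option 'I_N) (z : V) : R :=
  if o is Some i then z.1 ord0 i else z.2.

Definition obox (a b : option 'I_N -> R) : set V :=
  [set z | forall o, a o < coor o z < b o].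

Lemma measurable_coor o : measurable_fun setT (coor o : mV -> R).
Proof.
case: o => [i|]; last exact: measurable_snd.
exact: (measurableT_comp (measurable_rV_coord i) measurable_fst).
Qed.

Lemma oboxE a b : obox a b = \bigcap_(o in [set: option 'I_N])
  (coor o @^-1` `]a o, b o[%classic).
Proof.
apply/seteqP; split => [z h o _ /=|z h o]; first by rewrite in_itv /= h.
by have := h o I; rewrite /= in_itv.
Qed.

Lemma measurable_obox a b : measurable (obox a b : set mV).
Proof.
rewrite oboxE; apply: fin_bigcap_measurable => // o _.
by rewrite -[X in measurable X]setTI; exact: measurable_coor.
Qed.

Lemma obox_setI : setI_closed [set A | exists a b, A = obox a b].
Proof.
move=> _ _ [a [b ->]] [c [d ->]].
exists (fun o => Num.max (a o) (c o)), (fun o => Num.min (b o) (d o)).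
apply/seteqP; split => [z [h1 h2] o|z h].
  by rewrite gt_max lt_min; have /andP[-> ->] := h1 o; have /andP[-> ->] := h2 o.
split => o; have := h o; rewrite gt_max lt_min => /andP[/andP[? ?] /andP[? ?]];
 by apply/andP.
Qed.

(** Boxes are stable under intersection, as Dynkin's lemma requires. They generate because a
    half-space bounded by one coordinate is the union of the boxes whose other bounds are -n and
    n. *)
Lemma measurable_obox_generated :
  @measurable _ mV = <<s [set A | exists a b, A = obox a b] >>.
Proof.
set G := [set A | _]; apply/seteqP; split; last first.
  apply: smallest_sub; first exact: sigma_algebra_measurable.
  by move=> _ [a [b ->]]; exact: measurable_obox.
have mco o : measurable_fun [set: g_sigma_algebraType G] (coor o).
  apply: (measurability _ (RGenOInfty.measurableE R)) => _ [_ [x ->] <-].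
  rewrite setTI.
  rewrite (_ : _ @^-1` _ = \bigcup_n obox (fun p => if p == o then x else - n%:R)
    (fun=> n%:R)).
    by apply: bigcupT_measurable => n; apply: sub_sigma_algebra; do 2 eexists.
  apply/seteqP; split => [z /=|z [n _ /(_ o)]]; last first.
    by rewrite eqxx /= in_itv /= andbT => /andP[].
  rewrite in_itv /= andbT => xz.
  pose M := \sum_(p : option 'I_N) `|coor p z|.
  have [n nM] : exists n : nat, M < n%:R.
    by exists (Num.bound M); rewrite archi_boundP// sumr_ge0.
  exists n => // p.
  have pM : `|coor p z| < n%:R.
    by apply: le_lt_trans nM; rewrite /M (bigD1 p)//= lerDl sumr_ge0.
  move: pM; rewrite ltr_norml => /andP[h1 h2]; rewrite h2 andbT.
  by case: eqP => // ->.
move=> A mA.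
have : measurable_fun [set: g_sigma_algebraType G] (id : _ -> mV).
  rewrite (_ : id = fun z : V => (z.1, z.2)); last by apply/funext => -[].
  apply: measurable_fun_pair; last exact: (mco None).
  by apply: measurable_fun_rV => i; exact: (mco (Some i)).
by move=> /(_ measurableT _ mA); rewrite setTI.
Qed.

(** The space carries a product sigma-algebra generated by coordinates. An open set belongs to it as
    the countable union of the cubes with rational centre and half-side 1/(k+1) that it contains. *)
Lemma open_measurable_space (U : set V) : open U -> measurable (U : set mV).
Proof.
move=> oU.
pose B (p : 'rV[rat]_N * rat * nat) : set V :=
  obox (fun o => if o is Some i then ratr (p.1.1 ord0 i) - (p.2.+1%:R)^-1
                 else ratr p.1.2 - (p.2.+1%:R)^-1)
       (fun o => if o is Some i then ratr (p.1.1 ord0 i) + (p.2.+1%:R)^-1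
                 else ratr p.1.2 + (p.2.+1%:R)^-1).
rewrite (_ : U = \bigcup_(p : 'rV[rat]_N * rat * nat)
  (if `[< B p `<=` U >] then B p else set0)).
  apply: countable_bigcupT_measurable => // p.
  by case: ifP => // _; exact: measurable_obox.
apply/seteqP; split => [z Uz|z [p _]]; last by case: asboolP => // BU; exact: BU.
have /nbhs_ballP[e /= e0 eU] : nbhs z U by exact: open_nbhs_nbhs.
have [k ke] : exists k : nat, k.+1%:R^-1 < e / 2.
  have e20 : 0 < e / 2 by rewrite divr_gt0.
  exists (Num.bound (e / 2)^-1); rewrite invf_plt ?posrE//.
  rewrite (lt_le_trans (archi_boundP _))// ?ler_nat// invr_ge0 ltW//.
have rat_near (x : R) : exists q : rat, `|x - ratr q| < k.+1%:R^-1.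
  have : x - k.+1%:R^-1 < x + k.+1%:R^-1.
    by rewrite ltrBlDr -addrA ltrDl addr_gt0// invr_gt0.
  move=> /rat_in_itvoo[q]; rewrite in_itv /= => /andP[h1 h2].
  by exists q; rewrite distrC ltr_distl h1 h2.
have /choice[q qP] := fun i => rat_near (z.1 ord0 i).
have [s sP] := rat_near z.2.
exists ((\row_i q i, s), k) => //.
have Bz : B ((\row_i q i, s), k) z.
  by move=> [i|] /=; rewrite ?mxE -ltr_distl.
rewrite asboolT// => y By; apply: eU; split => /=.
  split => // i j; rewrite !ord1 /ball /=.
  have := By (Some j); rewrite /= mxE -ltr_distl distrC => h.
  rewrite -(subrKA (ratr (q j))) (le_lt_trans (ler_normD _ _))//.
  by rewrite (lt_trans (ltrD (qP j) h))// [ltRHS]splitr ltrD.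
have := By None; rewrite /= -ltr_distl distrC => h; rewrite /ball /=.
rewrite -(subrKA (ratr s)) (le_lt_trans (ler_normD _ _))//.
by rewrite (lt_trans (ltrD sP h))// [ltRHS]splitr ltrD.
Qed.

Lemma continuous_measurable_space (f : V -> R) : continuous f ->
  measurable_fun setT (f : mV -> R).
Proof.
move=> /continuousP cf; apply: (measurability _ (RGenOpens.measurableE R)).
move=> _ [_ [a [b ->]] <-]; rewrite setTI; apply: open_measurable_space.
by apply: cf; exact: interval_open.
Qed.

Lemma lebesgue_itv_finite (r : R) : (lebesgue_measure (`[(- r)%R, r]%classic : set R) < +oo)%E.
Proof. by rewrite lebesgue_measure_itv /=; case: ifP => _; rewrite ltry. Qed.

Lemma lebesgue_rV_cube_finite (n : nat) (r : R) : (lebesgue_rV n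
  [set x : 'rV[R]_n | forall i, `|x ord0 i| <= r]%R < +oo)%E.
Proof.
elim: n => [|n IH].
  by apply: le_lt_trans (ltry 1%R); rewrite /= /dirac lee_fin indicE; case: (_ \in _).
have mC (m : nat) : measurable [set x : 'rV[R]_m | forall i, `|x ord0 i| <= r].
  rewrite (_ : [set x | _] = \bigcap_(i in [set: 'I_m]) (@rV_coord R m i @^-1` `[- r, r]%classic)).
    apply: fin_bigcap_measurable => // i _.
    by rewrite -[X in measurable X]setTI; exact: measurable_rV_coord.
  apply/seteqP; split => [x h i _ /=|x h i].
    by rewrite in_itv /= -ler_norml h.
  by have := h i I; rewrite /= in_itv /= -ler_norml.
have -> : lebesgue_rV n.+1 [set x : 'rV[R]_n.+1 | forall i, `|x ord0 i| <= r] =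
   (lebesgue_rV n \x lebesgue_measure)%E
     ([set x : 'rV[R]_n | forall i, `|x ord0 i| <= r] `*` `[- r, r]%classic).
  rewrite /= /rV_step /pushforward; congr (_ \x _)%E.
  apply/seteqP; split => [[x y] /= h|[x y] /= [h]].
    split => [i|]; first by have := h (lift ord_max i); rewrite mxE liftK.
    by have := h ord_max; rewrite mxE unlift_none in_itv /= -ler_norml.
  rewrite in_itv /= -ler_norml => yr i; rewrite mxE; by case: unlift.
rewrite product_measure1E//; last exact: mC.
rewrite lte_mul_pinfty// ?ge0_fin_numE//.
exact: lebesgue_itv_finite.
Qed.

Lemma lebesgue_prod_bounded_finite (r : R) (A : set mV) : measurable A ->
  A `<=` [set z | forall o, `|coor o z| <= r] -> (lebesgue_prod A < +oo)%E.
Proof.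
move=> mA Ar.
set C := [set x : 'rV[R]_N | forall i, `|x ord0 i| <= r].
have mC : measurable C.
  rewrite (_ : C = \bigcap_(i in [set: 'I_N]) (@rV_coord R N i @^-1` `[- r, r]%classic)).
    apply: fin_bigcap_measurable => // i _.
    by rewrite -[X in measurable X]setTI; exact: measurable_rV_coord.
  apply/seteqP; split => [x h i _ /=|x h i].
    by rewrite in_itv /= -ler_norml h.
  by have := h i I; rewrite /= in_itv /= -ler_norml.
apply: (@le_lt_trans _ _ (lebesgue_prod (C `*` `[- r, r]%classic))).
  apply: le_measure; rewrite ?inE//; first exact: measurableX.
  move=> z /Ar h; split => [i|] /=; first exact: (h (Some i)).
  by rewrite in_itv /= -ler_norml (h None).
have -> : lebesgue_prod (C `*` `[- r, r]%classic) =
    (lebesgue_rV N C * lebesgue_measure (`[(- r)%R, r]%classic : set R))%E.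
  exact: product_measure1E.
apply: lte_mul_pinfty; rewrite ?ge0_fin_numE//; first exact: lebesgue_rV_cube_finite.
exact: lebesgue_itv_finite.
Qed.

(* By Dynkin's lemma, [w] integrates to 0 over every measurable subset of [B]. *)
Lemma integral_obox_eq0 (B : set mV) (w : mV -> R) :
  measurable B -> lebesgue_prod.-integrable B (EFin \o w) ->
  (\int[lebesgue_prod]_(z in B) (w z)%:E = 0)%E ->
  (forall a b, \int[lebesgue_prod]_(z in B `&` obox a b) (w z)%:E = 0)%E ->
  {ae lebesgue_prod, forall z, B z -> w z = 0}.
Proof.
move=> mB iw w0 wbox.
pose H := [set A : set mV | measurable A /\
  (\int[lebesgue_prod]_(z in B `&` A) (w z)%:E = 0)%E].
have iBA A : measurable A -> lebesgue_prod.-integrable (B `&` A) (EFin \o w).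
  by move=> mA; apply: integrableS iw => //; exact: measurableI.
have dH : dynkin H.
  split.
  - by split => //; rewrite setIT.
  - move=> A [mA A0]; split; first exact: measurableC.
    move: w0; rewrite -{1}(setIT B) -(setUv A) setIUr integral_setU.
    + by rewrite A0 add0e.
    + exact: measurableI.
    + by apply: measurableI => //; exact: measurableC.
    + by rewrite -setIUr setUv setIT; exact: measurable_int iw.
    + by rewrite disj_set2E setIACA setICr setI0.
  - move=> F tF HF; split; first by apply: bigcupT_measurable => i; exact: (HF i).1.
    rewrite setI_bigcupr integral_bigcup.
    + by apply: eseries0 => i _ _; exact: (HF i).2.
    + by apply: trivIset_setIl.
    + by move=> k; apply: measurableI => //; exact: (HF k).1.
    + rewrite -setI_bigcupr; apply: iBA.
      by apply: bigcupT_measurable => i; exact: (HF i).1.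
have mH A : measurable A -> H A.
  rewrite measurable_obox_generated -setI_closed_g_dynkin_g_sigma_algebra.
    apply: smallest_sub => // _ [a [b ->]]; split; last exact: wbox.
    exact: measurable_obox.
  exact: obox_setI.
have : ae_eq lebesgue_prod B (EFin \o w) (cst 0%E).
  apply: integral_ae_eq => //.
  move=> E EB mE; rewrite integral0; have [_] := mH _ mE.
  by rewrite setIidr.
by apply: filterS => z /[swap] Bz /(_ Bz) [].
Qed.

End space_measure.

Section translation.
Context {R : realType}.

Lemma lebesgue_measure_shift (r : R) (A : set R) : measurable A ->
  lebesgue_measure ((fun x => x + r) @^-1` A) = lebesgue_measure A.
Proof.
move=> mA; apply/esym.
have mr : measurable_fun setT ((fun x : measurableTypeR R => x + r) : _ -> measurableTypeR R).
  by apply: measurable_funD => //; exact: measurable_cst.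
apply: (@lebesgue_measure_unique R (pushforward lebesgue_measure
  ((fun x : measurableTypeR R => x + r) : _ -> measurableTypeR R))) => // _ [[a b]] _ <-.
transitivity (lebesgue_measure `]a - r, b - r]%classic); last first.
  rewrite /pushforward; congr (lebesgue_measure _).
  by apply/seteqP; split => x /=; rewrite !in_itv /= ltrBlDr lerBrDr.
by rewrite !lebesgue_measure_itv /= !lte_fin ltrBlDr subrK -!EFinB; case: ifP => // _; congr EFin; ring.
Qed.

Lemma ge0_integral_shift (r : R) (F : R -> \bar R) : measurable_fun setT F ->
  (forall x, (0 <= F x)%E) ->
  (\int[lebesgue_measure]_x F (x + r)%R = \int[lebesgue_measure]_x F x)%E.
Proof.
move=> mF F0.
have mr : measurable_fun setT ((fun x : measurableTypeR R => x + r) : _ -> measurableTypeR R).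
  by apply: measurable_funD => //; exact: measurable_cst.
rewrite -[LHS](@ge0_integral_pushforward _ _ _ _ R _ mr lebesgue_measure setT F)//.
by apply: eq_measure_integral => A mA _; exact: lebesgue_measure_shift.
Qed.

Lemma ge0_integral_lebesgue_rVS n (F : 'rV[R]_n.+1 -> \bar R) :
  measurable_fun setT F -> (forall x, (0 <= F x)%E) ->
  (\int[lebesgue_rV n.+1]_x F x =
   \int[lebesgue_rV n]_x \int[lebesgue_measure]_y F (rV_rcons (x, y)))%E.
Proof.
move=> mF F0.
have mr : measurable_fun setT (@rV_rcons R n : 'rV[R]_n * measurableTypeR R -> _) := @measurable_rV_rcons R n.
have mFr : measurable_fun setT (F \o @rV_rcons R n) by exact: measurableT_comp.
have <- := @fubini_tonelli1 _ _ _ _ R (lebesgue_rV n) lebesgue_measure _ mFr (fun z => F0 _).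
rewrite -[RHS](@ge0_integral_pushforward _ _ _ _ R _ mr (@lebesgue_prod R n) setT F)//.
Qed.

Lemma measurable_rV_shift n (w : 'rV[R]_n) :
  measurable_fun setT (fun x : 'rV[R]_n => x + w).
Proof.
apply: measurable_fun_rV => i; rewrite /comp /rV_coord.
under eq_fun do rewrite mxE.
by apply: measurable_funD => //; exact: measurable_rV_coord.
Qed.

Lemma rV_rcons_shift n (x : 'rV[R]_n) y (w : 'rV[R]_n.+1) :
  rV_rcons (x, y) + w = rV_rcons (x + (rV_rsplit w).1, y + (rV_rsplit w).2).
Proof.
apply/rowP => i; rewrite !mxE /=; case: unliftP => [j ->|->] /=; by rewrite ?mxE.
Qed.

(** By induction on the dimension, following the definition of [lebesgue_rV]: the last coordinate is
    split off and translated on its own. *)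
Lemma ge0_integral_rV_shift n (w : 'rV[R]_n) (F : 'rV[R]_n -> \bar R) :
  measurable_fun setT F -> (forall x, (0 <= F x)%E) ->
  (\int[lebesgue_rV n]_x F (x + w)%R = \int[lebesgue_rV n]_x F x)%E.
Proof.
elim: n w F => [|n IH] w F mF F0.
  by apply: eq_integral => x _; congr F; apply/rowP => -[].
have mFr : measurable_fun setT (F \o @rV_rcons R n).
  by apply: measurableT_comp => //; exact: measurable_rV_rcons.
have mFw : measurable_fun setT (fun x : 'rV[R]_n.+1 => F (x + w)).
  by apply: (measurableT_comp mF); exact: measurable_rV_shift.
rewrite (ge0_integral_lebesgue_rVS mF F0) (ge0_integral_lebesgue_rVS mFw (fun=> F0 _)).
set G := fun x => (\int[lebesgue_measure]_y F (rV_rcons (x, y)))%E.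
rewrite -(IH (rV_rsplit w).1 G).
- apply: eq_integral => x _; rewrite /G.
  under eq_integral do rewrite rV_rcons_shift.
  apply: (ge0_integral_shift (rV_rsplit w).2
    (F := fun y => F (rV_rcons (x + (rV_rsplit w).1, y)))) => //.
  exact: (measurable_fun_pair2 (x + (rV_rsplit w).1) mFr).
- exact: (@measurable_fun_fubini_tonelli_F _ _ _ _ R lebesgue_measure _ mFr (fun z => F0 _)).
- by move=> x; exact: integral_ge0.
Qed.

Variable N : nat.
Local Notation mV := ('rV[R]_N * measurableTypeR R)%type.

Lemma measurable_shift (v : 'rV[R]_N * R) :
  measurable_fun setT ((fun z => z + v) : mV -> mV).
Proof.
apply: measurable_fun_pair.
  exact: (measurableT_comp (measurable_rV_shift v.1) measurable_fst).
by apply: measurable_funD => //; exact: measurable_cst.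
Qed.

Lemma ge0_integral_prod_shift (v : 'rV[R]_N * R) (F : mV -> \bar R) :
  measurable_fun setT F -> (forall x, (0 <= F x)%E) ->
  (\int[lebesgue_prod]_z F (z + v)%R = \int[lebesgue_prod]_z F z)%E.
Proof.
move=> mF F0.
have mFv : measurable_fun setT (fun z : mV => F (z + v)).
  by apply: (measurableT_comp mF); exact: measurable_shift.
rewrite /lebesgue_prod (fubini_tonelli1 _ mF F0) (fubini_tonelli1 _ mFv (fun=> F0 _)).
rewrite /fubini_F.
set G := fun x => (\int[lebesgue_measure]_y F (x, y))%E.
rewrite -(ge0_integral_rV_shift v.1 (F := G)).
- apply: eq_integral => x _; rewrite /G.
  rewrite -(ge0_integral_shift v.2)//.
  exact: (measurable_fun_pair2 _ mF).
- exact: (@measurable_fun_fubini_tonelli_F _ _ _ _ R lebesgue_measure _ mF F0).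
- by move=> x; exact: integral_ge0.
Qed.

Lemma lebesgue_prod_shift (v : 'rV[R]_N * R) (A : set mV) : measurable A ->
  lebesgue_prod ((fun z => z + v) @^-1` A) = lebesgue_prod A.
Proof.
move=> mA.
have mA' : measurable ((fun z => z + v) @^-1` A : set mV).
  by rewrite -[X in measurable X]setTI; exact: measurable_shift.
rewrite -[in RHS](setIT A) -integral_indic//.
rewrite -(ge0_integral_prod_shift v); last 2 first.
- by apply/measurable_EFinP; exact: measurable_indic.
- by move=> z; rewrite lee_fin.
by rewrite -[X in lebesgue_prod X]setIT -integral_indic.
Qed.

End translation.

(** * Test functions *)

Section smooth_functions.
Context {R : realType} {V : normedModType R}.
Implicit Types f g : V -> R.

Lemma CnS k f : Cn k.+1 f -> Cn k f.
Proof.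
elim: k f => [|k IH] f; first by case.
by move=> [cf df]; split => // v; have [dfv Cv] := df v; split => //; exact: IH.
Qed.

Lemma Cn_cst k (c : R) : Cn k (fun _ : V => c).
Proof.
elim: k c => [|k IH] c; first by split => //; exact: cst_continuous.
split; first exact: cst_continuous.
move=> v; split => [z|]; first exact: derivable_cst.
have -> : (fun z => 'D_v (fun=> c) z) = (fun _ : V => 0) by apply/funext => z; rewrite derive_cst.
exact: IH.
Qed.

Lemma CnD k f g : Cn k f -> Cn k g -> Cn k (fun z => f z + g z).
Proof.
elim: k f g => [|k IH] f g [cf df] [cg dg].
  by split => // z; apply: continuousD; [exact: cf|exact: cg].
split; first by move=> z; apply: continuousD; [exact: cf|exact: cg].
move=> v; have [dfv Cfv] := df v; have [dgv Cgv] := dg v.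
split => [z|]; first exact: derivableD.
have -> : (fun z => 'D_v (fun z => f z + g z) z) = (fun z => 'D_v f z + 'D_v g z).
  by apply/funext => z; rewrite deriveD.
exact: IH.
Qed.

Lemma CnM k f g : Cn k f -> Cn k g -> Cn k (fun z => f z * g z).
Proof.
elim: k f g => [|k IH] f g Cf Cg; have [cf df] := Cf; have [cg dg] := Cg.
  by split => // z; apply: continuousM; [exact: cf|exact: cg].
split; first by move=> z; apply: continuousM; [exact: cf|exact: cg].
move=> v; have [dfv Cfv] := df v; have [dgv Cgv] := dg v.
split => [z|]; first exact: derivableM.
have -> : (fun z => 'D_v (fun z => f z * g z) z) =
          (fun z => f z * 'D_v g z + g z * 'D_v f z).
  by apply/funext => z; rewrite deriveM.
by apply: CnD; apply: IH => //; exact: CnS.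
Qed.

Lemma Cn_prod (I : finType) k (F : I -> V -> R) : (forall i, Cn k (F i)) ->
  Cn k (fun z => \prod_i F i z).
Proof.
move=> CF; elim: (index_enum I) => [|i s IH].
  under eq_fun do rewrite big_nil; exact: Cn_cst.
by under eq_fun do rewrite big_cons; exact: CnM.
Qed.

Lemma derive_translate f (w v z : V) : 'D_v (fun y => f (y + w)) z = 'D_v f (z + w).
Proof.
rewrite /derive; set a := (X in lim (X @ _)) ; set b := (X in _ = lim (X @ _)).
by have -> : a = b by apply/funext => h; rewrite /a /b /= addrA.
Qed.

Lemma derivable_translate f (w v z : V) :
  derivable f (z + w) v -> derivable (fun y => f (y + w)) z v.
Proof.
rewrite /derivable; set a := (X in cvg (X @ _)) => ca.
set b := (X in cvg (X @ _)).
have -> // : b = a.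
by apply/funext => h; rewrite /a /b /= addrA.
Qed.

Lemma Cn_translate k f (w : V) : Cn k f -> Cn k (fun z => f (z + w)).
Proof.
have ct : continuous (fun z : V => z + w).
  by move=> z; apply: continuousD => //; exact: cst_continuous.
elim: k f => [|k IH] f [cf df].
  by split => // z; exact: (continuous_comp (ct z) (cf _)).
split; first by move=> z; exact: (continuous_comp (ct z) (cf _)).
move=> v; have [dfv Cfv] := df v; split => [z|]; first exact: derivable_translate.
have -> : (fun z => 'D_v (fun y => f (y + w)) z) = (fun z => ('D_v f) (z + w)).
  by apply/funext => z; rewrite derive_translate.
exact: (IH _ Cfv).
Qed.

Lemma test_function_lin (Omega : set V) (c : R) f g : test_function Omega f ->
  test_function Omega g -> test_function Omega (fun z => c * f z + g z).
Proof.
move=> [sf [K [cK KO fK]]] [sg [K' [cK' KO' gK']]]; split.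
  by move=> k; apply: CnD => //; apply: CnM => //; exact: Cn_cst.
exists (K `|` K'); split.
- exact: compactU.
- by move=> z [/KO|/KO'].
- by move=> z /not_orP[nK nK']; rewrite fK// gK'// mulr0 addr0.
Qed.

Lemma test_function0 (Omega : set V) : test_function Omega (fun=> 0).
Proof.
split; first by move=> k; exact: Cn_cst.
by exists set0; split => //; exact: compact0.
Qed.

(** Off the compact set [K], whose complement is open, f is locally 0, hence so are its directional
    derivatives: the same [K] serves for both. *)
Lemma test_function_derive (Omega : set V) f (v : V) : test_function Omega f ->
  [/\ continuous (fun z => 'D_v f z), forall z, derivable f z v &
      exists K, [/\ compact K, K `<=` Omega & forall z, ~ K z -> f z = 0 /\ 'D_v f z = 0]].
Proof.
move=> [sf [K [cK KO fK]]].
have [cf df] := sf 1%N; have [dfv Cfv] := df v; split => //.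
  exact: Cfv.1.
exists K; split => // z nKz; split; first exact: fK.
have clK : closed K by apply: compact_closed => //; exact: norm_hausdorff.
have : nbhs z (~` K) by apply: open_nbhs_nbhs; split => //; exact: closed_openC.
move=> nz; rewrite -(@derive_cst _ _ R 0 z v); apply: near_eq_derive.
by apply: filterS nz => y; exact: fK.
Qed.

Lemma test_function_translate (Omega O' : set V) f (w : V) :
  (forall z, O' z -> Omega (z - w)) -> test_function O' f ->
  test_function Omega (fun z => f (z + w)).
Proof.
move=> OO [sf [K [cK KO fK]]]; split; first by move=> k; exact: Cn_translate.
exists ((fun z => z - w) @` K); split.
- apply: continuous_compact => //; apply: continuous_subspaceT => z.
  by apply: continuousB => //; exact: cst_continuous.
- by move=> _ [z Kz <-]; apply: OO; exact: KO.
- move=> z nz; apply: fK => Kz; apply: nz; exists (z + w) => //.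
  by rewrite addrK.
Qed.

End smooth_functions.

Section smooth_step.
Context {R : realType}.

(* [flat 0] is the usual smooth function vanishing on the negative half line;
   the family is stable under differentiation. *)
Definition flat (k : nat) (t : R) : R :=
  if 0 < t then t^-1 ^+ k * expR (- t^-1) else 0.

(** With s = 1/t this says s^k e^-s <= (k+1)! / s, a consequence of e^s >= s^(k+1) / (k+1)!. Linear
    decay for every k is what makes all the derivatives at 0 vanish. *)
Lemma flat_bound k (t : R) : 0 < t -> `|flat k t| <= k.+1`!%:R * t.
Proof.
move=> t0; rewrite /flat t0; have s0 : 0 < t^-1 by rewrite invr_gt0.
rewrite ger0_norm; last by rewrite mulr_ge0 ?expR_ge0// exprn_ge0// ltW.
rewrite expRN -ler_pdivlMr ?invr_gt0 ?expR_gt0// invrK.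
have := @expR_ge1Dxn R t^-1 k (ltW s0).
move=> h; apply: (@le_trans _ _ (k.+1`!%:R * t * (t^-1 ^+ k.+1 / k.+1`!%:R))); last first.
  rewrite ler_wpM2l//; first by rewrite mulr_ge0 ?ltW.
  by apply: le_trans h; rewrite lerDr.
rewrite exprS le_eqVlt; apply/orP; left; apply/eqP.
have f0 : (k.+1`!)%:R != 0 :> R by rewrite pnatr_eq0 -lt0n fact_gt0.
have tn0 : t != 0 by rewrite gt_eqF.
by field; rewrite tn0 f0.
Qed.

Lemma is_derive_flat k (t : R) :
  is_derive t 1 (flat k) (- k%:R * flat k.+1 t + flat k.+2 t).
Proof.
have [t0|t0|t0] := ltgtP t 0.
- have -> : - k%:R * flat k.+1 t + flat k.+2 t = 0.
    by rewrite /flat ltNge (ltW t0) /= mulr0 addr0.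
  have nf : \forall y \near t, cst 0 y = flat k y.
    near=> y; rewrite /flat ltNge.
    suff -> : y <= 0 by [].
    by apply: ltW; near: y; exact: lt_nbhsl.
  have dc : is_derive (t : R) (1 : R) (cst 0 : R -> R) (0 : R) by exact: is_derive_cst.
  exact: near_eq_is_derive nf dc.
- apply: (@near_eq_is_derive _ R R ((fun s : R => s ^+ k * expR (- s)) \o (fun y : R => y^-1))).
    near=> y; rewrite /flat.
    suff -> : 0 < y by [].
    by near: y; exact: lt_nbhsr.
  rewrite /flat t0.
  have tn0 : t != 0 by rewrite gt_eqF.
  have dV : is_derive t 1 (fun y : R => y^-1) (- t ^- 2).
    apply: DeriveDef; first by apply: derivableV.
    by rewrite deriveV//= derive_id [LHS]mulr1.
  have dX : is_derive t^-1 1 (fun s : R => s ^+ k) (k%:R * t^-1 ^+ k.-1).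
    have := is_deriveX k (is_derive_id t^-1 1); rewrite [X in is_derive _ _ _ X]mulr1.
    by rewrite exprfctE.
  have dN : is_derive t^-1 1 (fun s : R => - s) (- 1).
    by apply: is_deriveN.
  have dE : is_derive t^-1 1 (fun s : R => expR (- s)) (expR (- t^-1) * - 1).
    exact: (is_derive1_comp (is_derive_expR _) dN).
  apply: is_derive_eq (is_derive1_comp (is_deriveM dX dE) dV) _.
  rewrite /GRing.scale /= mulrN1; set p := t^-1 ^+ k; set E := expR _.
  have -> : (k%:R : R) * t^-1 ^+ k.-1 = k%:R * p * t.
    rewrite /p; case: (k) => [|m]; first by rewrite !mul0r.
    by rewrite -mulrA exprSr -mulrA mulVf// mulr1.
  by rewrite exprS (exprS _ k.+1) (exprS _ k) -/p; field.
(* At 0 the difference quotient is 0 on the left and [flat k.+1 h] on the right, so [flat_bound]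
   squeezes it to 0. *)
- rewrite t0 /flat ltxx mulr0 addr0.
  have cvg0 : (fun h : R => (k.+2)`!%:R * `|h|) @ 0^' --> (0 : R).
    suff : (fun h : R => (k.+2)`!%:R * `|h|) @ 0^' --> ((k.+2)`!%:R * 0 : R) by rewrite mulr0.
    apply: cvgM; first exact: cvg_cst.
    apply: cvg_within_filter.
    by have := @norm_continuous R R 0; rewrite /continuous_at normr0.
  have : (fun h => h^-1 *: ((flat k \o shift 0) (h *: 1) - flat k 0)) @ 0^' --> (0 : R).
    apply: (@squeeze_cvgr _ _ _ _ (fun h => - ((k.+2)`!%:R * `|h|)) (fun h => (k.+2)`!%:R * `|h|)).
    + near=> h; rewrite /= addr0 [X in flat k X]mulr1 [X in _ - X]/flat ltxx subr0 -ler_norml.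
      rewrite /GRing.scale /= normrM.
      have [h0|h0] := leP h 0.
        by rewrite [flat k h]/flat ltNge h0 /= normr0 mulr0 mulr_ge0.
      apply: le_trans (_ : _ <= `|flat k.+1 h|) _.
        by rewrite /flat h0 -normrM mulrA -exprS.
      by apply: le_trans (flat_bound _ h0) _; rewrite gtr0_norm.
    + suff : (fun h : R => - ((k.+2)`!%:R * `|h|)) @ 0^' --> (- 0 : R) by rewrite oppr0.
      by apply: cvgN; exact: cvg0.
    + exact: cvg0.
  move=> h; apply: DeriveDef; first by apply/cvg_ex; exists 0.
  by apply/cvg_lim.
Unshelve. all: by end_near. Qed.

Lemma flat_continuous k : continuous (flat k).
Proof.
move=> t; apply: differentiable_continuous; apply/derivable1_diffP.
by have [] := is_derive_flat k t.
Qed.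

Lemma is_derive_dir (f : R -> R) (t c df : R) : is_derive t 1 f df ->
  is_derive t c f (c * df).
Proof.
move=> [/derivable1_diffP d1 <-]; apply: DeriveDef; first exact: diff_derivable.
by rewrite !deriveE// -{1}[c]mulr1 linearZ.
Qed.

Lemma flat0_ge0 t : 0 <= flat 0 t.
Proof. by rewrite /flat; case: ifP => // _; rewrite mul1r expR_ge0. Qed.

Lemma flat0_le1 t : flat 0 t <= 1.
Proof.
by rewrite /flat; case: ifP => // t0; rewrite mul1r -expR0 ler_expR oppr_le0 invr_ge0 ltW.
Qed.

Lemma flat0_cvg1 t : 0 < t -> flat 0 (n%:R * t) @[n --> \oo] --> (1 : R).
Proof.
move=> t0.
have : expR (- (t^-1 * n%:R^-1)) @[n --> \oo] --> (1 : R).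
  suff : expR (- (t^-1 * n%:R^-1)) @[n --> \oo] --> expR (- (t^-1 * 0)).
    by rewrite mulr0 oppr0 expR0.
  apply: continuous_cvg; first exact: continuous_expR.
  apply: cvgN; apply: cvgM; first exact: cvg_cst.
  rewrite -cvg_shiftS; exact: cvg_harmonic.
apply: cvg_trans; apply: near_eq_cvg; near=> n.
rewrite /flat mulr_gt0// ?mul1r ?invfM 1?mulrC// ltr0n.
by near: n; exists 1%N.
Unshelve. all: by end_near. Qed.

Variable N : nat.
Local Notation V := ('rV[R]_N * R)%type.

Lemma coor_continuous o : continuous (@coor R N o).
Proof.
case: o => [i|] z; last exact: cvg_snd.
apply: (@continuous_comp _ _ _ fst (fun x : 'rV[R]_N => x ord0 i)); first exact: cvg_fst.
exact: coord_continuous.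
Qed.

Lemma coor_line o (z v : V) h : coor o (h *: v + z) = h * coor o v + coor o z.
Proof. by case: o => [i|] //=; rewrite !mxE. Qed.

(** The index [k] stays free in the induction on the order of smoothness, because each derivative
    raises it. *)
Lemma Cn_flat_coor m k o (s r : R) :
  Cn m (fun z : V => flat k (s * coor o z + r)).
Proof.
have cf k' : continuous (fun z : V => flat k' (s * coor o z + r)).
  move=> z; apply: (@continuous_comp _ _ _ (fun z : V => s * coor o z + r) (flat k')).
    apply: continuousD; last exact: cst_continuous.
    apply: continuousM; first exact: cst_continuous.
    exact: coor_continuous.
  exact: flat_continuous.
elim: m k => [|m IH] k; first by split.
split => // v.
have d z : is_derive z v (fun z : V => flat k (s * coor o z + r))
   ((s * coor o v) * (- k%:R * flat k.+1 (s * coor o z + r) + flat k.+2 (s * coor o z + r))).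
  have [d1 d2] := is_derive_dir (s * coor o v) (is_derive_flat k (s * coor o z + r)).
  have E : (fun h => h^-1 *: (((fun z : V => flat k (s * coor o z + r)) \o shift z) (h *: v)
      - flat k (s * coor o z + r))) =
    (fun h => h^-1 *: ((flat k \o shift (s * coor o z + r)) (h *: (s * coor o v))
      - flat k (s * coor o z + r))).
    apply/funext => h /=; rewrite coor_line; congr (_ *: (flat _ _ - _)).
    by rewrite /GRing.scale /=; ring.
  apply: DeriveDef; first by rewrite /derivable E.
  by rewrite /derive E.
split => [z|]; first by have [] := d z.
have -> : (fun z => 'D_v (fun z : V => flat k (s * coor o z + r)) z) = fun z =>
  (s * coor o v) * (- k%:R * flat k.+1 (s * coor o z + r) + flat k.+2 (s * coor o z + r)).
  by apply/funext => z; have [] := d z.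
apply: CnM; first exact: Cn_cst.
by apply: CnD => //; apply: CnM => //; exact: Cn_cst.
Qed.

(** Vanishes off the open box and converges to 1 on it as n grows, with values in [0, 1]: it
    approximates the indicator of the box by test functions without any convolution. *)
Definition bump (a b : option 'I_N -> R) (n : nat) (z : V) : R :=
  \prod_(o : option 'I_N) (flat 0 (n%:R * (coor o z - a o)) * flat 0 (n%:R * (b o - coor o z))).

Definition cbox (a b : option 'I_N -> R) : set V :=
  [set z | forall o, a o <= coor o z <= b o].

Lemma compact_cbox a b : compact (cbox a b).
Proof.
pose K : set 'rV[R]_N := [set x | forall i, `[a (Some i), b (Some i)]%classic (x ord0 i)].
have -> : cbox a b = K `*` `[a None, b None]%classic.
  apply/seteqP; split => [z h|z [h1 h2] [i|]].
  - by split => [i|] /=; rewrite in_itv /=; exact: h.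
  - by have := h1 i; rewrite /= in_itv.
  - by move: h2; rewrite /= in_itv.
apply: compact_setX; last exact: segment_compact.
by apply: (@rV_compact R N (fun i => `[a (Some i), b (Some i)]%classic)) => i; exact: segment_compact.
Qed.

Lemma bump_ge0 a b n z : 0 <= bump a b n z.
Proof. by apply: prodr_ge0 => o _; rewrite mulr_ge0 ?flat0_ge0. Qed.

Lemma bump_le1 a b n z : bump a b n z <= 1.
Proof.
rewrite /bump; elim/big_rec: _ => // o x _ x1; rewrite -[leRHS](mulr1 1).
have f0 := flat0_ge0; have f1 := flat0_le1.
case: (leP 0 x) => x0; last first.
  apply: (@le_trans _ _ 0); last by rewrite mulr1.
  by rewrite mulr_ge0_le0 ?mulr_ge0// ltW.
by rewrite ler_pM ?mulr_ge0// mulr_ile1.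
Qed.

Lemma bump_eq0 a b n z : ~ obox a b z -> bump a b n z = 0.
Proof.
move=> /existsNP[p] /negP; rewrite negb_and -!leNgt => ho.
have flat_npos t : t <= 0 -> flat 0 t = 0 by move=> t0; rewrite /flat ltNge t0.
rewrite /bump (bigD1 p)//=; case/orP: ho => h.
  by rewrite (flat_npos (_ * (coor p z - _))) ?mul0r// mulr_ge0_le0 ?subr_le0.
by rewrite (flat_npos (_ * (b p - _))) ?mulr0 ?mul0r// mulr_ge0_le0 ?subr_le0.
Qed.

Let cvgM1 (u v : R^nat) : u @ \oo --> (1 : R) -> v @ \oo --> (1 : R) ->
  (fun n => u n * v n) @ \oo --> (1 : R).
Proof.
move=> u1 v1; suff : (fun n => u n * v n) @ \oo --> (1 * 1 : R) by rewrite mulr1.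
exact: cvgM.
Qed.

Lemma bump_cvg1 a b z : obox a b z -> bump a b n z @[n --> \oo] --> (1 : R).
Proof.
move=> abz; rewrite /bump.
elim: (index_enum _) => [|o s IH].
  by under eq_fun do rewrite big_nil; exact: cvg_cst.
under eq_fun do rewrite big_cons.
have /andP[h1 h2] := abz o.
have f1 : flat 0 (n%:R * (coor o z - a o)) @[n --> \oo] --> (1 : R).
  by apply: flat0_cvg1; rewrite subr_gt0.
have f2 : flat 0 (n%:R * (b o - coor o z)) @[n --> \oo] --> (1 : R).
  by apply: flat0_cvg1; rewrite subr_gt0.
exact: (cvgM1 (cvgM1 f1 f2) IH).
Qed.

Lemma test_function_bump (Omega : set V) a b n : cbox a b `<=` Omega ->
  test_function Omega (bump a b n).
Proof.
move=> abO; split.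
  move=> k; apply: Cn_prod => o; apply: CnM.
    under eq_fun do rewrite mulrBr; exact: Cn_flat_coor.
  have E z : n%:R * (b o - coor o z) = - n%:R * coor o z + n%:R * b o by ring.
  under eq_fun do rewrite E; exact: Cn_flat_coor.
exists (cbox a b); split => //; first exact: compact_cbox.
move=> z nz; apply: bump_eq0 => oz; apply: nz => o.
by have /andP[? ?] := oz o; apply/andP; split; exact: ltW.
Qed.

End smooth_step.

Section restriction.
Context d (T : measurableType d) (R : realType).
Variable mu : {measure set T -> \bar R}.
Implicit Types (D : set T) (f g : T -> R).

Lemma integral_sqr_patch D f :
  (\int[mu]_(z in D) (f z ^+ 2)%:E = \int[mu]_z ((f \_ D) z ^+ 2)%:E)%E.
Proof.
rewrite integral_mkcond; apply: eq_integral => z _; rewrite !patchE.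
by case: ifP => // _; rewrite expr0n.
Qed.

Lemma L2_patch D f : measurable D -> L2_on mu D f <-> L2_on mu setT (f \_ D).
Proof.
by move=> mD; rewrite /L2_on integral_sqr_patch; split => -[mf If]; split => //;
  exact/(measurable_restrictT _ mD).
Qed.

Lemma Rintegral_patch D f g :
  \int[mu]_(z in D) (f z * g z) = inner mu (f \_ D) g.
Proof.
rewrite Rintegral_mkcond /inner; apply: eq_Rintegral => z _; rewrite !patchE.
by case: ifP => // _; rewrite mul0r.
Qed.

Lemma L2_integrable_finite D f : measurable D -> (mu D < +oo)%E ->
  L2_on mu setT f -> mu.-integrable D (EFin \o f).
Proof.
move=> mD Doo f2.
have i2 : L2_on mu setT (\1_D : T -> R).
  split; first exact: measurable_indic.
  rewrite (_ : (fun z => _) = (fun z => (\1_D z : R)%:E)); last first.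
    by apply/funext => z; rewrite indicE; case: (_ \in _); rewrite ?expr1n ?expr0n.
  by rewrite integral_indic// setIT.
have := L2_mul_integrable f2 i2 => /(integrableS measurableT mD (@subsetT _ _)).
apply: eq_integrable => // z zD /=; by rewrite indicE zD mulr1.
Qed.

End restriction.

(** * Square integrability of test functions and du Bois-Reymond's lemma *)

Section test_functions.
Context {R : realType} {N : nat}.
Local Notation V := ('rV[R]_N * R)%type.
Local Notation mV := ('rV[R]_N * measurableTypeR R)%type.
Local Notation mu := (@lebesgue_prod R N).

Lemma coor_le_norm o (z : V) : `|coor o z| <= `|z|.
Proof.
rewrite prod_normE; case: o => [i|] /=; rewrite le_max.
  apply/orP; left; rewrite [X in _ <= X]mx_normrE.
  exact: (le_bigmax _ (fun ij => `|z.1 ij.1 ij.2|) (ord0, i)).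
by rewrite lexx orbT.
Qed.

Lemma compact_bounded_coor (K : set V) : compact K ->
  exists2 r, 0 < r & K `<=` [set z | forall o, `|coor o z| <= r].
Proof.
move=> /compact_bounded [M [_ hM]]; exists (`|M| + 1); first by rewrite ltr_pwDr.
move=> z Kz o; apply: le_trans (coor_le_norm o z) _; apply: hM => //.
by rewrite (le_lt_trans (ler_norm _))// ltrDl.
Qed.

Lemma continuous_bounded_off_compact (K : set V) (g : V -> R) : compact K ->
  continuous g -> (forall z, ~ K z -> g z = 0) ->
  exists2 M, 0 <= M & forall z, `|g z| <= M.
Proof.
move=> cK cg gK.
have : compact (g @` K) by apply: continuous_compact => //; exact: continuous_subspaceT.
move=> /compact_bounded [M [_ hM]]; exists (`|M| + 1) => // z.
have [Kz|/gK ->] := pselect (K z); last by rewrite normr0.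
apply: hM; last by exists z.
by rewrite (le_lt_trans (ler_norm _))// ltrDl.
Qed.

Lemma bounded_support_L2 (r M : R) (g : V -> R) : measurable_fun setT (g : mV -> R) ->
  (forall z, `|g z| <= M) -> (forall z, ~ (forall o, `|coor o z| <= r) -> g z = 0) ->
  L2_on mu setT g.
Proof.
move=> mg gM gr; split=> //.
set B := cbox (fun=> - r) (fun=> r) : set V.
have mB : measurable (B : set mV).
  have cB : closed B.
    apply: (compact_closed _ (@compact_cbox R N _ _)); exact: norm_hausdorff.
  rewrite -[B]setCK; apply: measurableC; apply: open_measurable_space.
  exact: closed_openC.
have BE z : B z <-> forall o, `|coor o z| <= r.
  by split => h o; [rewrite ler_norml; exact: h|rewrite -ler_norml; exact: h].
apply: (@le_lt_trans _ _ (\int[mu]_(z in B) (M ^+ 2)%:E)%E).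
  rewrite [leRHS]integral_mkcond; apply: ge0_le_integral => //.
  - by move=> z _; rewrite lee_fin sqr_ge0.
  - by apply/measurable_EFinP; exact: measurable_funX.
  - by apply/(measurable_restrictT _ mB); exact: measurable_cst.
  move=> z _; rewrite patchE; case: ifPn => [zB|].
    by rewrite lee_fin -[leLHS]real_normK ?num_real// lerXn2r ?nnegrE// (le_trans _ (gM z)).
  by rewrite notin_setE => /BE/gr ->; rewrite expr0n.
rewrite integral_cst//= lte_mul_pinfty ?lee_fin ?sqr_ge0//.
by apply: (@lebesgue_prod_bounded_finite _ _ r) => // z /BE.
Qed.

Lemma test_function_measurable (Omega : set V) phi : test_function Omega phi ->
  measurable_fun setT (phi : mV -> R).
Proof. by move=> [/(_ 0%N)[cphi _] _]; exact: continuous_measurable_space. Qed.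

Lemma test_function_L2 (Omega : set V) phi : test_function Omega phi ->
  L2_on mu setT phi.
Proof.
move=> tphi; have mphi := test_function_measurable tphi.
have [/(_ 0%N)[cphi _] [K [cK _ phiK]]] := tphi.
have [r _ Kr] := compact_bounded_coor cK.
have [M _ phiM] := continuous_bounded_off_compact cK cphi phiK.
apply: (@bounded_support_L2 r M) => // z nz; apply: phiK => /Kr; exact: nz.
Qed.

Lemma derive_test_function_bounds (Omega : set V) phi (v : V) : test_function Omega phi ->
  exists r M, [/\ 0 < r, 0 <= M, forall z, `|'D_v phi z| <= M &
    forall z, ~ (forall o, `|coor o z| <= r) -> phi z = 0 /\ 'D_v phi z = 0].
Proof.
move=> /(test_function_derive v)[cD _ [K [cK _ KP]]].
have [r r0 Kr] := compact_bounded_coor cK.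
have [M M0 DM] := continuous_bounded_off_compact cK cD (fun z nz => (KP z nz).2).
exists r, M; split => // z nz; apply: KP => /Kr; exact: nz.
Qed.

Lemma derive_test_function_measurable (Omega : set V) phi (v : V) :
  test_function Omega phi -> measurable_fun setT ((fun z => 'D_v phi z) : mV -> R).
Proof.
by move=> /(test_function_derive v)[cD _ _]; exact: continuous_measurable_space.
Qed.

Lemma derive_test_function_L2 (Omega : set V) phi (v : V) : test_function Omega phi ->
  L2_on mu setT (fun z => 'D_v phi z).
Proof.
move=> tphi; have mD := derive_test_function_measurable v tphi.
have [r [M [_ _ DM Dr]]] := derive_test_function_bounds v tphi.
by apply: (@bounded_support_L2 r M) => // z /Dr[].
Qed.

Lemma is_derive_line (phi : V -> R) (v z : V) (s : R) :
  (forall z, derivable phi z v) ->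
  is_derive s 1 (fun s => phi (s *: v + z)) ('D_v phi (s *: v + z)).
Proof.
move=> dphi; have := dphi (s *: v + z).
have E : (fun h => h^-1 *: (((fun s => phi (s *: v + z)) \o shift s) (h *: 1)
      - phi (s *: v + z))) =
    (fun h => h^-1 *: ((phi \o shift (s *: v + z)) (h *: v) - phi (s *: v + z))).
  by apply/funext => h /=; rewrite [h *: 1]mulr1 scalerDl addrA.
by move=> d; apply: DeriveDef; rewrite /derivable /derive E.
Qed.

(** Only the length matters: [cyl (elen e)] is convertible with [cylinder e], and lengths such as
    [l - h%:E], possibly negative, are also allowed. *)
Definition cyl (l : \bar R) : set V := [set: 'rV[R]_N] `*` [set y | 0 < y /\ (y%:E < l)%E].

Lemma cyl_open l : open (cyl l).
Proof.
have -> : cyl l = snd @^-1` [set y : R | 0 < y /\ (y%:E < l)%E].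
  by apply/seteqP; split => [z []|z].
apply: open_comp => [z _|]; first exact: cvg_snd.
case: l => [r| |].
- rewrite (_ : [set y | _] = `]0, r[%classic); first exact: interval_open.
  apply/seteqP; split => y /=; rewrite in_itv /= lte_fin; first by case=> -> ->.
  by move=> /andP[].
- rewrite (_ : [set y | _] = `]0, +oo[%classic); first exact: interval_open.
  apply/seteqP; split => y /=; rewrite in_itv /= ?ltry andbT; first by case.
  by move=> ->.
- rewrite (_ : [set y | _] = set0); first exact: open0.
  by apply/seteqP; split => y //= [_]; rewrite ltNge leNye.
Qed.

Lemma measurable_cyl l : measurable (cyl l : set mV).
Proof. by apply: open_measurable_space; exact: cyl_open. Qed.

(** The functions [bump a b n] are test functions as soon as the closed box lies in [Omega];
    dominated convergence, with bound |w|, replaces them by the indicator of the open box. *)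
Lemma integral_obox_orthogonal (Omega : set V) (w : V -> R) a b :
  L2_on mu setT w -> (forall phi, test_function Omega phi -> inner mu w phi = 0) ->
  cbox a b `<=` Omega -> (\int[mu]_(z in obox a b) (w z)%:E = 0)%E.
Proof.
move=> w2 wphi abO; have [mw _] := w2.
have mB : measurable (obox a b : set mV) := measurable_obox a b.
have tb n := test_function_bump n abO.
have iw : mu.-integrable (obox a b) (EFin \o w).
  apply: L2_integrable_finite => //.
  have [r _ Kr] := compact_bounded_coor (@compact_cbox R N a b).
  apply: (@lebesgue_prod_bounded_finite _ _ r) => // z oz; apply: Kr => o.
  by have /andP[? ?] := oz o; apply/andP; split; exact: ltW.
have mwb n : measurable_fun (obox a b : set mV) (fun z : mV => (w z * bump a b n z)%:E).
  apply/measurable_EFinP/measurable_funTS; apply: measurable_funM => //.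
  exact: test_function_measurable (tb n).
have wb0 n : (\int[mu]_(z in obox a b) (w z * bump a b n z)%:E = 0)%E.
  have i1 := L2_mul_integrable w2 (test_function_L2 (tb n)).
  rewrite (_ : (\int[mu]_(z in _) _)%E = (\int[mu]_z (w z * bump a b n z)%:E)%E); last first.
    rewrite [LHS]integral_mkcond; apply: eq_integral => z _; rewrite patchE.
    case: ifPn => //; rewrite notin_setE => /bump_eq0 ->; by rewrite mulr0.
  by rewrite -(fineK (integrable_fin_num measurableT i1)) [fine _](wphi _ (tb n)).
have cw : {ae mu, forall z, obox a b z ->
    (w z * bump a b n z)%:E @[n --> \oo] --> (EFin \o w) z}.
  apply: aeW => z abz; apply: cvg_EFin; first exact: nearW.
  suff : w z * bump a b n z @[n --> \oo] --> w z * 1 by rewrite mulr1.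
  by apply: cvgM; [exact: cvg_cst|exact: bump_cvg1].
have dom : {ae mu, forall z n, obox a b z ->
    (`|(w z * bump a b n z)%:E| <= (abse \o (EFin \o w)) z)%E}.
  apply: aeW => z n _ /=; rewrite lee_fin normrM ler_piMr//.
  by rewrite ger0_norm ?bump_le1// bump_ge0.
have := dominated_convergence mB mwb (measurable_int _ iw) cw (integrable_abse iw) dom.
case=> _ _; rewrite /=; under eq_fun do rewrite wb0.
by move/(cvg_lim (@ereal_hausdorff R)) <-; rewrite lim_cst.
Qed.

(* Du Bois-Reymond's lemma on a cylinder, exhausted by boxes. *)
Lemma cyl_orthogonal_eq0 l (w : V -> R) : L2_on mu setT w ->
  (forall phi, test_function (cyl l) phi -> inner mu w phi = 0) ->
  {ae mu, forall z, cyl l z -> w z = 0}.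
Proof.
move=> w2 wphi.
(* The exhausting boxes keep a distance 1/(n+1) from the faces of the cylinder, so that their
   closures stay inside. For [-oo] the value 0 lies below the lower bound and makes the box
   empty. *)
pose top n : R := match l with
  | r%:E => Num.min n%:R (r - n.+1%:R^-1) | +oo%E => n%:R | -oo%E => 0 end.
pose a n (o : option 'I_N) : R := if o is Some i then - n%:R else n.+1%:R^-1.
pose b n (o : option 'I_N) : R := if o is Some i then n%:R else top n.
have sub n a' b' : obox (a n) (b n) `&` obox a' b' =
    obox (fun o => Num.max (a n o) (a' o)) (fun o => Num.min (b n o) (b' o)).
  apply/seteqP; split => [z [h1 h2] o|z h].
    by rewrite gt_max lt_min; have /andP[-> ->] := h1 o; have /andP[-> ->] := h2 o.
  split => o; have := h o; rewrite gt_max lt_min => /andP[/andP[? ?] /andP[? ?]];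
   by apply/andP.
have ncyl n a' b' : cbox (fun o => Num.max (a n o) (a' o)) (fun o => Num.min (b n o) (b' o))
    `<=` cyl l.
  move=> z /(_ None); rewrite ge_max le_min => /andP[/andP[h1 _] /andP[h2 _]].
  split=> //=; have n0 : 0 < n.+1%:R^-1 :> R by rewrite invr_gt0.
  split; first exact: lt_le_trans h1.
  move: h2; rewrite /b /top; case: (l) (wphi) => [r| |] wphi' /=.
  + rewrite le_min lte_fin => /andP[_ h]; apply: le_lt_trans h _.
    by rewrite ltrBlDr ltrDl.
  + by rewrite ltry.
  + by move=> h; have := lt_le_trans n0 (le_trans h1 h); rewrite ltxx.
have ncyl1 n : cbox (a n) (b n) `<=` cyl l.
  move=> z h; apply: (ncyl n (a n) (b n)) => o.
  by rewrite maxxx minxx.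
have w0 n : {ae mu, forall z, obox (a n) (b n) z -> w z = 0}.
  apply: integral_obox_eq0.
  - exact: measurable_obox.
  - apply: L2_integrable_finite => //; first exact: measurable_obox.
    have [r _ Kr] := compact_bounded_coor (@compact_cbox R N (a n) (b n)).
    apply: (@lebesgue_prod_bounded_finite _ _ r); first exact: measurable_obox.
    move=> z oz; apply: Kr => o.
    by have /andP[? ?] := oz o; apply/andP; split; exact: ltW.
  - exact: integral_obox_orthogonal wphi (ncyl1 n).
  - by move=> a' b'; rewrite sub; exact: integral_obox_orthogonal wphi (ncyl n a' b').
have := ae_foralln w0; apply: filterS => z wz [_ /= [z0 zl]].
pose M := \sum_(p : option 'I_N) `|coor p z|.
have M0 : 0 <= M by rewrite sumr_ge0.
pose q : R := if l is r%:E then (r - z.2)^-1 else 0.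
have q0 : 0 <= q.
  rewrite /q; move: zl; case: (l) => // r; rewrite lte_fin => zr.
  by rewrite invr_ge0 subr_ge0 ltW.
have zi0 : 0 < z.2^-1 by rewrite invr_gt0.
(* [M] bounds the coordinates of z, and the two other terms are the inverse distances to the faces
   (0 for an absent upper face): from this n on, z lies in the box. *)
pose n := Num.bound (M + z.2^-1 + q).
have nb : M + z.2^-1 + q < n%:R.
  by apply: archi_boundP; rewrite !addr_ge0// ltW.
have nn1 : n%:R < n.+1%:R :> R by rewrite ltr_nat.
have nM : M < n%:R by lra.
have nz : n.+1%:R^-1 < z.2 by rewrite invf_plt ?posrE//; lra.
apply: (wz n) => o.
have pM : `|coor o z| < n%:R.
  by apply: le_lt_trans nM; rewrite /M (bigD1 o)//= lerDl sumr_ge0.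
move: pM; rewrite ltr_norml => /andP[h1 h2].
case: o h1 h2 => [i|] h1 h2; first by rewrite /a /b h1.
rewrite /a nz /=; move: nb zl; rewrite /q /b /top; case: (l) => // r h.
rewrite lte_fin => zr; rewrite lt_min h2 /= ltrBrDl -ltrBrDr invf_plt ?posrE ?subr_gt0//.
by lra.
Qed.

End test_functions.

(** * Weak derivatives and difference quotients *)

Lemma innerBl d (T : measurableType d) (R : realType) (mu : {measure set T -> \bar R})
    (f g k : T -> R) : L2_on mu setT f -> L2_on mu setT g -> L2_on mu setT k ->
  inner mu (fun z => f z - g z) k = inner mu f k - inner mu g k.
Proof.
move=> f2 g2 k2; have -> : (fun z => f z - g z) = (fun z => (-1) * g z + f z).
  by apply/funext => z; rewrite mulN1r addrC.
by rewrite innerC inner_lin// mulN1r addrC !(innerC mu k).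
Qed.

Lemma Rintegral_support d (T : measurableType d) (R : realType)
    (mu : {measure set T -> \bar R}) (B : set T) (f : T -> R) :
  (forall z, ~ B z -> f z = 0) -> \int[mu]_z f z = \int[mu]_(z in B) f z.
Proof.
move=> fB; rewrite [RHS]Rintegral_mkcond; apply: eq_Rintegral => z _.
by rewrite patchE; case: ifPn => //; rewrite notin_setE => /fB.
Qed.

Lemma ae_impl d (T : measurableType d) (R : realType) (mu : {measure set T -> \bar R})
    (P Q : T -> Prop) : (forall x, P x -> Q x) ->
  {ae mu, forall x, P x} -> {ae mu, forall x, Q x}.
Proof. by move=> PQ; apply: filterS. Qed.

Lemma cvg_dnbhs (R : realType) (u : R^nat) : u @ \oo --> (0 : R) ->
  (forall n, u n != 0) -> u @ \oo --> (0 : R)^'.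
Proof.
move=> u0 un A; rewrite /dnbhs /within /= => nA.
by have [m _ hm] := u0 _ nA; exists m => // n /hm /(_ (un n)).
Qed.

Section weak_derivatives.
Context {R : realType} {N : nat}.
Local Notation V := ('rV[R]_N * R)%type.
Local Notation mV := ('rV[R]_N * measurableTypeR R)%type.
Local Notation mu := (@lebesgue_prod R N).
Implicit Types (Omega : set V) (f g phi : V -> R) (v z : V).

Lemma L2_onS Omega f : measurable (Omega : set mV) -> L2_on mu setT f -> L2_on mu Omega f.
Proof.
move=> mO [mf If]; split; first exact: measurable_funTS.
apply: le_lt_trans If; apply: ge0_subset_integral => //.
  by apply/measurable_EFinP; exact: measurable_funX.
by move=> z _; rewrite lee_fin sqr_ge0.
Qed.

Lemma test_function_eq0 Omega phi z : test_function Omega phi -> ~ Omega z -> phi z = 0.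
Proof. by move=> [_ [K [_ KO phi0]]] nz; apply: phi0 => /KO. Qed.

Lemma is_weak_derivativeP Omega v f g : measurable (Omega : set mV) ->
  is_weak_derivative Omega v f g <-> L2_on mu setT (g \_ Omega) /\
    forall phi, test_function Omega phi ->
      inner mu (f \_ Omega) (fun z => 'D_v phi z) = - inner mu (g \_ Omega) phi.
Proof.
move=> mO; split=> -[g2 H]; split; try exact/(L2_patch _ _ mO).
  by move=> phi tphi; rewrite -!Rintegral_patch; exact: H.
by move=> phi tphi; rewrite !Rintegral_patch; exact: H.
Qed.

(** Since [weak_derivative] is an unspecified choice, its L^2 norm is accessible only through its
    agreement almost everywhere with any weak derivative exhibited. *)
Lemma weak_derivative_unique l v f g1 g2 :
  is_weak_derivative (cyl l) v f g1 -> is_weak_derivative (cyl l) v f g2 ->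
  (\int[mu]_(z in cyl l) (g1 z ^+ 2)%:E = \int[mu]_(z in cyl l) (g2 z ^+ 2)%:E)%E.
Proof.
have mO := @measurable_cyl R N l.
move=> w1 w2; have [[mg1 _] _] := w1; have [[mg2 _] _] := w2.
move: w1 w2 => /(is_weak_derivativeP _ _ _ mO)[L1 H1] /(is_weak_derivativeP _ _ _ mO)[L2 H2].
have : {ae mu, forall z, cyl l z -> (g1 \_ (cyl l)) z - (g2 \_ (cyl l)) z = 0}.
  apply: cyl_orthogonal_eq0; first exact: L2B.
  move=> phi tphi; have p2 := test_function_L2 tphi.
  by rewrite innerBl//; apply/eqP; rewrite subr_eq0 -eqr_opp -H1// -H2.
move=> ae0; apply: ge0_ae_eq_integral => //.
- by apply/measurable_EFinP; exact: measurable_funX.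
- by apply/measurable_EFinP; exact: measurable_funX.
- by move=> z _; rewrite lee_fin sqr_ge0.
- by move=> z _; rewrite lee_fin sqr_ge0.
suff : {ae mu, forall z, cyl l z -> (g1 z ^+ 2)%:E = (g2 z ^+ 2)%:E} by [].
apply: ae_impl ae0 => z h cz; have := h cz; rewrite !patchE (mem_set cz).
by move/eqP; rewrite subr_eq0 => /eqP ->.
Qed.

Lemma weak_derivativeP Omega v f : (exists g, is_weak_derivative Omega v f g) ->
  is_weak_derivative Omega v f (weak_derivative Omega v f).
Proof. by move=> h; rewrite /weak_derivative; exact: xgetPex. Qed.

Lemma weak_derivative_bound l v f (C : R) : 0 <= C -> L2_on mu (cyl l) f ->
  (forall phi, test_function (cyl l) phi ->
    inner mu (f \_ (cyl l)) (fun z => 'D_v phi z) ^+ 2 <= C * inner mu phi phi) ->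
  (exists g, is_weak_derivative (cyl l) v f g) /\
  (\int[mu]_(z in cyl l) (weak_derivative (cyl l) v f z ^+ 2)%:E <= C%:E)%E.
Proof.
have mO := @measurable_cyl R N l.
move=> C0 /(L2_patch _ _ mO) f2 H.
have [||||||g [g2 gL gC]] := @riesz_representation _ mV R mu
  [set phi | test_function (cyl l) phi]
  (fun phi => - inner mu (f \_ (cyl l)) (fun z => 'D_v phi z)) C.
- by [].
- by exists (fun=> 0); exact: test_function0.
- by move=> phi /test_function_L2.
- by move=> c p q; exact: test_function_lin.
- move=> c p q tp tq.
  have [_ dp _] := test_function_derive v tp; have [_ dq _] := test_function_derive v tq.
  have -> : (fun z => 'D_v (fun z => c * p z + q z) z) = (fun z => c * 'D_v p z + 'D_v q z).
    apply/funext => z; rewrite (_ : (fun z => _) = (c *: p) + q)//.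
    by rewrite deriveD ?deriveZ//; exact: derivableZ.
  rewrite inner_lin//; try exact: (derive_test_function_L2 (Omega := cyl l)).
  by rewrite opprD mulrN.
- by move=> phi tphi; rewrite sqrrN; exact: H.
(* Riesz's representation gives [g] on the whole space; as test functions vanish off the cylinder,
   its restriction represents the same functional. *)
have g2c : L2_on mu (cyl l) g by exact: L2_onS.
have wg : is_weak_derivative (cyl l) v f g.
  apply/is_weak_derivativeP => //; split; first exact/(L2_patch _ _ mO).
  move=> phi tphi; rewrite -[LHS]opprK gL//; congr (- _).
  rewrite /inner; apply: eq_Rintegral => z _; rewrite patchE.
  case: ifPn => //; rewrite notin_setE => nz.
  by rewrite (test_function_eq0 tphi nz) !mulr0.
have ex : exists g, is_weak_derivative (cyl l) v f g by exists g.
split=> //; rewrite (weak_derivative_unique (weak_derivativeP ex) wg).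
apply: (@le_trans _ _ (\int[mu]_z (g z ^+ 2)%:E)%E).
  apply: ge0_subset_integral => //.
    by apply/measurable_EFinP; apply: measurable_funX; exact: g2.1.
  by move=> z _; rewrite lee_fin sqr_ge0.
by rewrite L2_sqE.
Qed.

(** The increment is kept only where both of its end points lie in [Omega], so that f is never
    extended across the boundary. *)
Definition shift_diff Omega v f (h : R) : V -> R :=
  (fun z => f (z + h *: v) - f z) \_ (Omega `&` [set z | Omega (z + h *: v)]).

Lemma measurable_preimage_shift Omega v : measurable (Omega : set mV) ->
  measurable ([set z | Omega (z + v)] : set mV).
Proof.
move=> mO; rewrite -[X in measurable X]setTI; exact: (measurable_shift v).
Qed.

Lemma L2_shift f v : L2_on mu setT f -> L2_on mu setT (fun z => f (z + v)).
Proof.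
move=> [mf If]; split.
  by apply: (measurableT_comp mf); exact: measurable_shift.
rewrite (ge0_integral_prod_shift v (F := fun z => (f z ^+ 2)%:E))//.
  by apply/measurable_EFinP; exact: measurable_funX.
by move=> z; rewrite lee_fin sqr_ge0.
Qed.

Lemma measurable_fun_shift f v : measurable_fun setT (f : mV -> R) ->
  measurable_fun setT ((fun z => f (z + v)) : mV -> R).
Proof. by move=> mf; apply: (measurableT_comp mf); exact: measurable_shift. Qed.

Lemma inner_shift f g v : L2_on mu setT f -> L2_on mu setT g ->
  inner mu (fun z => f (z + v)) (fun z => g (z + v)) = inner mu f g.
Proof.
move=> f2 g2; have [mf _] := f2; have [mg _] := g2.
have ifg := L2_mul_integrable f2 g2.
have ifg' := L2_mul_integrable (L2_shift v f2) (L2_shift v g2).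
have mfg : measurable_fun setT (fun z : mV => (f z * g z)%:E).
  by apply/measurable_EFinP; exact: measurable_funM.
have E (F : mV -> \bar R) : measurable_fun setT F -> (forall z, 0 <= F z)%E ->
    (\int[mu]_z F (z + v)%R = \int[mu]_z F z)%E by exact: ge0_integral_prod_shift.
pose FG : mV -> \bar R := fun z => (f z * g z)%:E.
rewrite /inner /Rintegral; congr fine; rewrite integralE [RHS]integralE; congr (_ - _)%E.
  have := E FG^\+%E (measurable_funepos mfg) (fun z => funepos_ge0 FG z).
  by move=> <-; apply: eq_integral => z _; rewrite !funeposE.
have := E FG^\-%E (measurable_funeneg mfg) (fun z => funeneg_ge0 FG z).
by move=> <-; apply: eq_integral => z _; rewrite !funenegE.
Qed.

Lemma measurable_cbox (a b : option 'I_N -> R) : measurable (cbox a b : set mV).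
Proof.
rewrite -[cbox a b]setCK; apply: measurableC; apply: open_measurable_space.
apply: closed_openC.
by apply: (compact_closed _ (@compact_cbox R N _ _)); exact: norm_hausdorff.
Qed.

Lemma compact_line_shift Omega (K : set V) v : open Omega -> compact K -> K `<=` Omega ->
  exists2 d : R, 0 < d & forall z s, K z -> `|s| < d -> Omega (z + s *: v).
Proof.
move=> oO cK KO.
have h : \forall s \near (0 : R), K `<=` [set z | Omega (z + s *: v)].
  apply: ((compact_near_coveringP K).1 cK R (nbhs (0 : R)) (fun s z => Omega (z + s *: v))).
  move=> z Kz.
  have ct : {for (z, 0 : R), continuous (fun p : V * R => p.1 + p.2 *: v)}.
    apply: continuousD; first exact: cvg_fst.
    apply: continuousZ; [exact: cvg_snd|exact: cst_continuous].
  have : nbhs (z + (0 : R) *: v) Omega.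
    by rewrite scale0r addr0; apply: open_nbhs_nbhs; split => //; exact: KO.
  by move=> /ct; exact.
have [d /= d0 hd] := (nbhs_ballP _ _).1 h.
exists d => // z s Kz sd; apply: (hd s _ z Kz).
by rewrite /ball /= sub0r normrN.
Qed.

(** Discrete integration by parts moves the difference quotient from phi to f. Cauchy-Schwarz then
    bounds the pairing uniformly in h, and the quotients of phi tend to its derivative, dominated on
    a fixed box. *)
Lemma shift_diff_criterion Omega v f (C : R) : open Omega -> L2_on mu Omega f -> 0 <= C ->
  (forall h, 0 < h -> (\int[mu]_z (shift_diff Omega v f h z ^+ 2)%:E <= (C * h ^+ 2)%:E)%E) ->
  forall phi, test_function Omega phi ->
    inner mu (f \_ Omega) (fun z => 'D_v phi z) ^+ 2 <= C * inner mu phi phi.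
Proof.
move=> oO f2 C0 HC phi tphi.
have mO := open_measurable_space oO.
have F2 : L2_on mu setT (f \_ Omega) by exact/(L2_patch _ _ mO).
set F := f \_ Omega in F2 *.
have phi2 := test_function_L2 tphi.
have [cD dphi _] := test_function_derive v tphi.
have [_ [K [cK KO phiK]]] := tphi.
have [d d0 Kd] := compact_line_shift v oO cK KO.
have [r [M [r0 M0 DM Dr]]] := derive_test_function_bounds v tphi.
(* The offset 2 makes every step strictly smaller than [d], including the first: the support of phi,
   moved by [h n *: v], remains in [Omega]. *)
pose h n : R := d / n.+2%:R.
have h0 n : 0 < h n by rewrite divr_gt0.
have hd n : h n < d by rewrite ltr_pdivrMr// ltr_pMr// ltr1n.
have hcvg : h @ \oo --> (0 : R).
  suff : (fun n => d * n.+2%:R^-1) @ \oo --> (d * 0 : R) by rewrite mulr0.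
  apply: cvgM; first exact: cvg_cst.
  have h1 : [sequence (@harmonic R) n.+1]_n @ \oo --> (0 : R).
    by rewrite cvg_shiftS; exact: cvg_harmonic.
  exact: h1.
pose q n z := (h n)^-1 * (phi z - phi (z - h n *: v)).
have q2 n : L2_on mu setT (q n).
  apply: L2Z; apply: L2B => //; rewrite -scaleNr; exact: L2_shift.
have qbound n : inner mu F (q n) ^+ 2 <= C * inner mu phi phi.
  set D := shift_diff Omega v f (h n).
  have mOh := measurable_preimage_shift (h n *: v) mO.
  have D2 : L2_on mu setT D.
    split; last by apply: le_lt_trans (HC _ (h0 n)) _; rewrite ltry.
    apply/(measurable_restrictT _ (measurableI _ _ mO mOh)).
    have mF := measurable_fun_shift (h n *: v) F2.1.
    have := measurable_funB mF F2.1 => /(measurable_funTS (D := Omega `&` [set z | Omega (z + h n *: v)])).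
    apply: eq_measurable_fun => z; rewrite inE => -[Oz /= Ozh].
    by rewrite /F !patchE !mem_set.
  have -> : inner mu F (q n) = - (h n)^-1 * inner mu D phi.
    have Fh2 := L2_shift (h n *: v) F2.
    have ph2 : L2_on mu setT (fun z => phi (z - h n *: v)) by exact: L2_shift.
    have -> : inner mu F (q n) = (h n)^-1 * (inner mu F phi - inner mu F (fun z => phi (z - h n *: v))).
      rewrite /q innerZ//; last exact: L2B.
      by rewrite innerC innerBl// !(innerC mu F).
    have -> : inner mu F (fun z => phi (z - h n *: v)) = inner mu (fun z => F (z + h n *: v)) phi.
      rewrite -(inner_shift (- (h n *: v)) Fh2 phi2).
      by congr inner; apply/funext => z; rewrite subrK.
    rewrite -innerBl// mulNr -mulrN; congr (_ * _).
    rewrite -mulN1r -innerZ// innerC.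
    (* Both sides carry the factor [phi z], so only points of [K] matter, and there the truncation
       in [shift_diff] is inactive. *)
    rewrite /inner; apply: eq_Rintegral => z _.
    have [Kz|/phiK ->] := pselect (K z); last by rewrite !(mulr0, mul0r).
    have Oz := KO _ Kz.
    have Ozh : Omega (z + h n *: v) by apply: Kd => //; rewrite gtr0_norm.
    by rewrite /F /D /shift_diff !patchE !mem_set//; ring.
  have cs := inner_cauchy_schwarz D2 phi2.
  have DD : inner mu D D <= C * h n ^+ 2 by rewrite -lee_fin -L2_sqE//; exact: HC.
  rewrite exprMn sqrrN exprVn mulrC ler_pdivrMr ?exprn_gt0//.
  apply: le_trans cs _; rewrite mulrAC; apply: ler_wpM2r => //; exact: inner_ge0.
have qcvg z : q n z @[n --> \oo] --> 'D_v phi z.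
  have hN : (fun n => - h n) @ \oo --> (0 : R)^'.
    apply: cvg_dnbhs; last by move=> n; rewrite oppr_eq0 gt_eqF.
    by rewrite -oppr0; apply: cvgN.
  have /(cvg_comp _ _ hN) := dphi z.
  apply: cvg_trans; apply: near_eq_cvg; apply: nearW => n /=.
  rewrite /q (_ : - h n *: v + z = z - h n *: v); last by rewrite scaleNr addrC.
  by rewrite /GRing.scale /= invrN mulNr -mulrN opprB.
(* By the mean value theorem each quotient is a value of the derivative, hence bounded by [M]
   uniformly in n. *)
have qM n z : `|q n z| <= M.
  have [||c _ E] := @MVT R (fun s => phi (s *: v + (z - h n *: v)))
    (fun s => 'D_v phi (s *: v + (z - h n *: v))) 0 (h n) (h0 n).
  - by move=> s _; exact: is_derive_line.
  - apply: continuous_subspaceT => s; apply: differentiable_continuous.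
    by apply/derivable1_diffP; have [] := is_derive_line (z - h n *: v) s dphi.
  move: E; rewrite scale0r add0r subr0 /q.
  rewrite (_ : h n *: v + (z - h n *: v) = z); last by rewrite addrC subrK.
  move=> ->.
  by rewrite mulrCA mulVf ?gt_eqF// mulr1.
(* Every shift has length at most [d * |v|], so this enlarged box contains the supports of all the
   quotients and gives dominated convergence a set of finite measure. *)
pose r' := r + d * `|v|.
pose B : set V := cbox (fun=> - r') (fun=> r').
have qr n z : ~ B z -> q n z = 0.
  have h1 := h0 n; have h2 := hd n; have hv o : `|coor o (h n *: v)| <= d * `|v|.
    have -> : coor o (h n *: v) = h n * coor o v by case: o => [i|] //=; rewrite mxE.
    by rewrite normrM gtr0_norm//; apply: ler_pM; rewrite ?(ltW h1) ?(ltW h2) ?normr_ge0//; exact: coor_le_norm.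
  move=> nB; have r'r : r <= r' by rewrite lerDl mulr_ge0 ?normr_ge0 ?(ltW d0).
  rewrite /q (Dr z _).1 ?(Dr (z - _) _).1 ?subrr ?mulr0//.
  - move=> H; apply: nB => o; rewrite -ler_norml.
    rewrite -(subrK (h n *: v) z).
    have -> : coor o (z - h n *: v + h n *: v) = coor o (z - h n *: v) + coor o (h n *: v).
      by case: o => [i|] //=; rewrite !mxE.
    by rewrite (le_trans (ler_normD _ _))// lerD.
  - by move=> H; apply: nB => o; rewrite -ler_norml (le_trans (H o)).
have Dr' z : ~ B z -> 'D_v phi z = 0.
  move=> nB; apply: (Dr z _).2 => H; apply: nB => o; rewrite -ler_norml (le_trans (H o))//.
  by rewrite lerDl mulr_ge0 ?normr_ge0 ?(ltW d0).
have mB : measurable (B : set mV) by exact: measurable_cbox.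
have iF : mu.-integrable B (EFin \o F).
  apply: L2_integrable_finite => //.
  by apply: (@lebesgue_prod_bounded_finite _ _ r') => // z Bz o; rewrite ler_norml; exact: Bz.
have Fq : inner mu F (q n) @[n --> \oo] --> inner mu F (fun z => 'D_v phi z).
  have E g : (forall z, ~ B z -> g z = 0) ->
      inner mu F g = \int[mu]_(z in B) (F z * g z).
    by move=> gB; apply: Rintegral_support => z /gB ->; rewrite mulr0.
  have -> : (fun n => inner mu F (q n)) = (fun n => \int[mu]_(z in B) (F z * q n z)).
    by apply/funext => n; apply: E; exact: qr.
  rewrite E//.
  apply: fine_cvg.
  have mFq n : measurable_fun (B : set mV) (fun z : mV => (F z * q n z)%:E).
    apply/measurable_EFinP/measurable_funTS/measurable_funM; [exact: F2.1|exact: (q2 n).1].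
  have cFq : {ae mu, forall z, B z ->
      (F z * q n z)%:E @[n --> \oo] --> (F z * 'D_v phi z)%:E}.
    apply: aeW => z _; apply: cvg_EFin; first exact: nearW.
    by apply: cvgM; [exact: cvg_cst|exact: qcvg].
  have dom : {ae mu, forall z n, B z ->
      (`|(F z * q n z)%:E| <= (fun z => M%:E * `|F z|%:E) z)%E}.
    apply: aeW => z n _ /=; rewrite lee_fin normrM mulrC ler_wpM2r//.
  have iM : mu.-integrable B (fun z => M%:E * `|F z|%:E)%E.
    by apply: integrableZl => //; exact: (integrable_abse iF).
  have mFD : measurable_fun (B : set mV) (fun z : mV => (F z * 'D_v phi z)%:E).
    apply/measurable_EFinP/measurable_funTS/measurable_funM; first exact: F2.1.
    exact: derive_test_function_measurable tphi.
  have [iFD _ h1] := dominated_convergence mB mFq mFD cFq iM dom.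
  rewrite fineK//; exact: integrable_fin_num.
have Fq2 : inner mu F (q n) ^+ 2 @[n --> \oo] --> inner mu F (fun z => 'D_v phi z) ^+ 2.
  exact: cvgM.
rewrite -(cvg_lim _ Fq2)//; apply: limr_le; first by apply/cvg_ex; eexists; exact: Fq2.
exact: nearW.
Qed.

End weak_derivatives.

Section Rintegral_fubini.
Context d1 d2 (T1 : measurableType d1) (T2 : measurableType d2) (R : realType).
Variables (m1 : {sigma_finite_measure set T1 -> \bar R})
  (m2 : {sigma_finite_measure set T2 -> \bar R}).

Lemma Rintegral_fubini (H : T1 * T2 -> R) :
  (m1 \x m2)%E.-integrable setT (EFin \o H) ->
  \int[m1]_x \int[m2]_y H (x, y) = \int[m2]_y \int[m1]_x H (x, y).
Proof.
move=> iH; rewrite /Rintegral.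
have -> : (\int[m1]_x (fine (\int[m2]_y (H (x, y))%:E))%:E =
    \int[m1]_x \int[m2]_y (H (x, y))%:E)%E.
  apply: ae_eq_integral => //.
  - apply/measurable_EFinP; apply: (measurableT_comp (fine_measurable _)) => //.
    exact: (measurable_fubini_F iH).
  - exact: (measurable_fubini_F iH).
  - apply: ae_impl (ae_integrable1 iH) => x ix _.
    by rewrite fineK//; exact: (integrable_fin_num measurableT ix).
rewrite (Fubini iH).
congr fine; apply: ae_eq_integral => //.
- exact: (measurable_fubini_G iH).
- apply/measurable_EFinP; apply: (measurableT_comp (fine_measurable _)) => //.
  exact: (measurable_fubini_G iH).
- apply: ae_impl (ae_integrable2 iH) => y iy _.
  by rewrite fineK//; exact: (integrable_fin_num measurableT iy).
Qed.

End Rintegral_fubini.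

Section sf_product.
Context d1 d2 (T1 : measurableType d1) (T2 : measurableType d2) (R : realType).
Variables (m1 : {sigma_finite_measure set T1 -> \bar R})
  (m2 : {sigma_finite_measure set T2 -> \bar R}).

(* An alias of [m1 \x m2] on which unification finds the sigma-finite structure
   that the Fubini theorems ask for. *)
Definition sf_product : set (T1 * T2) -> \bar R := (m1 \x m2)%E.

HB.instance Definition _ := Measure.on sf_product.

Let sigma_finite_sf_product : sigma_finite setT sf_product.
Proof.
have /sigma_finiteP[F [TF ndF Foo]] := sigma_finiteT m1.
have /sigma_finiteP[G [TG ndG Goo]] := sigma_finiteT m2.
exists (fun n => F n `*` G n).
  rewrite -setXTT TF TG predeqE => -[x y]; split.
    move=> [/= [n _ Fnx] [k _ Gky]]; exists (maxn n k) => //; split.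
    - by move: x Fnx; exact/subsetPset/ndF/leq_maxl.
    - by move: y Gky; exact/subsetPset/ndG/leq_maxr.
  by move=> [n _ []/= ? ?]; split; exists n.
move=> k; have [? ?] := Foo k; have [? ?] := Goo k.
split; first exact: measurableX.
have -> : sf_product (F k `*` G k) = (m1 (F k) * m2 (G k))%E by exact: product_measure1E.
by rewrite lte_mul_pinfty// ge0_fin_numE.
Qed.

HB.instance Definition _ := Measure_isSigmaFinite.Build _ _ _ sf_product
  sigma_finite_sf_product.

End sf_product.

(** * Increments of a function as line integrals of its weak derivative *)

Section line_average.
Context {R : realType} {N : nat}.
Local Notation V := ('rV[R]_N * R)%type.
Local Notation mV := ('rV[R]_N * measurableTypeR R)%type.
Local Notation mu := (@lebesgue_prod R N).
Local Notation leb := (@lebesgue_measure R).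
Implicit Types (F G phi : V -> R) (v z : V).

Local Notation smu := (sf_product (@lebesgue_rV R N) leb).

Lemma measurable_line v :
  measurable_fun setT ((fun p => p.1 + p.2 *: v) : mV * measurableTypeR R -> mV).
Proof.
apply: measurable_fun_pair.
  apply: measurable_fun_rV => i; rewrite /comp /rV_coord.
  under eq_fun do rewrite !mxE.
  apply: measurable_funD.
    apply: (measurableT_comp (measurable_rV_coord i)).
    exact: measurableT_comp.
  by apply: measurable_funM.
apply: measurable_funD; first exact: measurableT_comp.
exact: measurable_funM.
Qed.

Variable h : R.
Hypothesis h0 : 0 < h.
Local Notation I := (\1_(`[0, h]%classic : set R) : R -> R).

Let mI : measurable_fun setT (I : measurableTypeR R -> R).
Proof. exact: measurable_indic. Qed.

Let intI : (\int[leb]_s (I s)%:E = h%:E)%E.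
Proof.
rewrite integral_indic// setIT.
have lI : lebesgue_measure (`[0, h]%classic : set R) = h%:E.
  by rewrite lebesgue_measure_itv /= lte_fin h0 oppr0 adde0.
exact: lI.
Qed.

(** The integral of G along the segment from z to z + h v, parametrised by [0, h]; there is no
    division by h. *)
Definition line_average v G z : R := \int[leb]_s (G (z + s *: v) * I s).

Lemma measurable_line_kernel v G : measurable_fun setT (G : mV -> R) ->
  measurable_fun setT
    ((fun p => G (p.1 + p.2 *: v) * I p.2) : mV * measurableTypeR R -> R).
Proof.
move=> mG; apply: measurable_funM.
  by apply: (measurableT_comp mG); exact: measurable_line.
by apply: (measurableT_comp mI).
Qed.

Let intGI v G : L2_on mu setT G ->
  (\int[smu]_z \int[leb]_s ((G (z + s *: v)) ^+ 2 * I s)%:E = h%:E * \int[mu]_z (G z ^+ 2)%:E)%E.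
Proof.
move=> [mG IG].
have mG2 : measurable_fun setT ((fun z => G z ^+ 2) : mV -> R) by exact: measurable_funX.
have mK := measurable_line_kernel v mG2.
have I0 s : 0 <= I s by rewrite indicE.
rewrite (@fubini_tonelli _ _ _ _ R smu leb (fun p => (G (p.1 + p.2 *: v) ^+ 2 * I p.2)%:E)); last 2 first.
- exact/measurable_EFinP.
- by move=> p; rewrite lee_fin mulr_ge0 ?sqr_ge0.
transitivity (\int[leb]_s ((I s)%:E * \int[mu]_z (G z ^+ 2)%:E))%E.
  apply: eq_integral => s _ /=.
  under eq_integral do rewrite mulrC EFinM.
  rewrite ge0_integralZl//.
  - by congr (_ * _)%E; apply: (@ge0_integral_prod_shift R N (s *: v) (fun z => (G z ^+ 2)%:E)) => [|z];
      [exact/measurable_EFinP|rewrite lee_fin sqr_ge0].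
  - apply/measurable_EFinP; exact: (measurable_fun_shift _ mG2).
  - by move=> z _; rewrite lee_fin sqr_ge0.
rewrite ge0_integralZr//.
- by rewrite intI.
- exact/measurable_EFinP.
- by apply: integral_ge0 => z _; rewrite lee_fin sqr_ge0.
Qed.

Let int_square v G : L2_on mu setT G ->
  (smu \x leb)%E.-integrable setT (fun p => (G (p.1 + p.2 *: v) ^+ 2 * I p.2)%:E).
Proof.
move=> G2; have [mG IG] := G2.
have mG2 : measurable_fun setT ((fun z => G z ^+ 2) : mV -> R) by exact: measurable_funX.
have mK := measurable_line_kernel v mG2.
have p0 (p : mV * measurableTypeR R) : 0 <= G (p.1 + p.2 *: v) ^+ 2 * I p.2.
  by rewrite mulr_ge0 ?sqr_ge0// indicE.
apply/integrable12ltyP; first exact/measurable_EFinP.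
under eq_integral do under eq_integral do rewrite gee0_abs ?lee_fin ?(p0 (_, _))//.
by rewrite (intGI v G2) lte_mul_pinfty ?lee_fin// ltW.
Qed.

Let II s : I s * I s = I s.
Proof. by rewrite indicE; case: (_ \in _); rewrite ?mulr1 ?mulr0. Qed.

Let I2 : L2_on leb setT I.
Proof.
split => //; under eq_integral do rewrite expr2 II.
by rewrite intI ltry.
Qed.

Let line_slice_L2 v G : L2_on mu setT G ->
  {ae mu, forall z, L2_on leb setT (fun s => G (z + s *: v) * I s)}.
Proof.
move=> G2; have [mG _] := G2.
have := ae_integrable1 (int_square v G2).
apply: ae_impl => z /integrableP[_ zoo]; split.
  exact: (measurable_fun_pair2 z (measurable_line_kernel v mG)).
apply: le_lt_trans zoo; apply: ge0_le_integral => //.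
- by move=> s _; rewrite lee_fin sqr_ge0.
- apply/measurable_EFinP/measurable_funX.
  exact: (measurable_fun_pair2 z (measurable_line_kernel v mG)).
- apply: measurableT_comp => //; apply/measurable_EFinP.
  have mG2 : measurable_fun setT ((fun z => G z ^+ 2) : mV -> R) by exact: measurable_funX.
  exact: (measurable_fun_pair2 z (measurable_line_kernel v mG2)).
move=> s _ /=; rewrite lee_fin (le_trans _ (ler_norm _))//.
by rewrite exprMn [I s ^+ 2]expr2 II.
Qed.

Lemma measurable_line_average v G : measurable_fun setT (G : mV -> R) ->
  measurable_fun setT (line_average v G : mV -> R).
Proof.
move=> mG; have mK := measurable_line_kernel v mG.
pose K : mV * measurableTypeR R -> \bar R := fun p => (G (p.1 + p.2 *: v) * I p.2)%:E.
have mKE : measurable_fun setT K by exact/measurable_EFinP.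
apply: (measurableT_comp (fine_measurable _)) => //.
have -> : (fun z => \int[leb]_s (G (z + s *: v)%R * I s)%:E)%E =
    (fun z => \int[leb]_s K^\+ (z, s) - \int[leb]_s K^\- (z, s))%E.
  apply/funext => z; rewrite integralE; congr (_ - _)%E; apply: eq_integral => s _.
    by rewrite !funeposE.
  by rewrite !funenegE.
apply: emeasurable_funB.
  exact: (@measurable_fun_fubini_tonelli_F _ _ _ _ R leb K^\+%E (measurable_funepos mKE) (funepos_ge0 K)).
exact: (@measurable_fun_fubini_tonelli_F _ _ _ _ R leb K^\-%E (measurable_funeneg mKE) (funeneg_ge0 K)).
Qed.

(** Cauchy-Schwarz on the segment gives one factor h; integrating in z first, translation invariance
    gives the other. *)
Lemma line_average_bound v G : L2_on mu setT G ->
  L2_on mu setT (line_average v G) /\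
  (\int[mu]_z (line_average v G z ^+ 2)%:E <= (h ^+ 2)%:E * \int[mu]_z (G z ^+ 2)%:E)%E.
Proof.
move=> G2; have [mG IG] := G2.
have mG2 : measurable_fun setT ((fun z => G z ^+ 2) : mV -> R) by exact: measurable_funX.
have mK2 := measurable_line_kernel v mG2.
have mA := measurable_line_average v mG.
have K0 (p : mV * measurableTypeR R) : (0 <= (G (p.1 + p.2 *: v) ^+ 2 * I p.2)%:E)%E.
  by rewrite lee_fin mulr_ge0 ?sqr_ge0// indicE.
have mS : measurable_fun setT ((fun z => \int[leb]_s ((G (z + s *: v)%R) ^+ 2 * I s)%:E)%E : mV -> \bar R).
  pose K : mV * measurableTypeR R -> \bar R := fun p => (G (p.1 + p.2 *: v) ^+ 2 * I p.2)%:E.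
  have mK : measurable_fun setT K by exact/measurable_EFinP.
  exact: (@measurable_fun_fubini_tonelli_F _ _ _ _ R leb K mK K0).
have bound : (\int[mu]_z (line_average v G z ^+ 2)%:E <= (h ^+ 2)%:E * \int[mu]_z (G z ^+ 2)%:E)%E.
  apply: (@le_trans _ _ (\int[mu]_z (h%:E * \int[leb]_s ((G (z + s *: v)%R) ^+ 2 * I s)%:E))%E).
    apply: ae_ge0_le_integral => //.
    - by move=> z _; rewrite lee_fin sqr_ge0.
    - by apply/measurable_EFinP; exact: measurable_funX.
    - by move=> z _; rewrite mule_ge0 ?lee_fin ?(ltW h0)//; apply: integral_ge0 => s _; exact: (K0 (z, s)).
    - exact: measurable_funeM.
    apply: ae_impl (line_slice_L2 v G2) => z K2 _.
    have E : line_average v G z = inner leb (fun s => G (z + s *: v) * I s) I.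
      by apply: eq_Rintegral => s _; rewrite -mulrA II.
    have := inner_cauchy_schwarz K2 I2; rewrite -E => cs.
    have -> : (\int[leb]_s ((G (z + s *: v)%R) ^+ 2 * I s)%:E =
        (inner leb (fun s => G (z + s *: v) * I s) (fun s => G (z + s *: v) * I s))%:E)%E.
      rewrite -L2_sqE//; apply: eq_integral => s _.
      by rewrite exprMn [I s ^+ 2]expr2 II.
    rewrite -EFinM lee_fin mulrC; apply: le_trans cs _.
    rewrite ler_wpM2l ?inner_ge0// -lee_fin -L2_sqE//.
    by under eq_integral do rewrite expr2 II; rewrite intI.
  rewrite ge0_integralZl//; last 2 first.
    by move=> z _; apply: integral_ge0 => s _; exact: (K0 (z, s)).
    by rewrite lee_fin ltW.
  by rewrite (intGI v G2) muleA -EFinM -expr2.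
split=> //; split=> //; apply: le_lt_trans bound _.
by rewrite lte_mul_pinfty// lee_fin sqr_ge0.
Qed.

Lemma line_average_fubini v F G : L2_on mu setT F -> L2_on mu setT G ->
  inner mu F (line_average v G) =
  \int[leb]_s (inner mu F (fun z => G (z + s *: v)) * I s).
Proof.
move=> F2 G2; have [mF _] := F2; have [mG _] := G2.
pose H (p : mV * measurableTypeR R) := F p.1 * (G (p.1 + p.2 *: v) * I p.2).
have mH : measurable_fun setT H.
  apply: measurable_funM; first exact: measurableT_comp.
  exact: measurable_line_kernel.
have iH : (smu \x leb)%E.-integrable setT (EFin \o H).
  (* Writing F as its own translate in the direction 0 lets [int_square] cover both squares
     dominating the product. *)
  pose a (p : mV * measurableTypeR R) := F (p.1 + p.2 *: (0 : V)) ^+ 2 * I p.2.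
  pose b (p : mV * measurableTypeR R) := G (p.1 + p.2 *: v) ^+ 2 * I p.2.
  apply: (@le_integrable _ _ _ _ _ measurableT _ ((EFin \o a) \+ (EFin \o b))%E).
  - exact/measurable_EFinP.
  - move=> p _; rewrite /= lee_fin /a /b scaler0 addr0 -mulrDl.
    have i0 : 0 <= I p.2 by rewrite indicE.
    rewrite [leRHS]ger0_norm ?mulr_ge0 ?addr_ge0 ?sqr_ge0//.
    rewrite /H mulrA normrM (ger0_norm i0) ler_wpM2r//.
    by rewrite ler_norml; apply/andP; split; nra.
  - by apply: integrableD => //; exact: int_square.
have step1 : inner mu F (line_average v G) = \int[smu]_z \int[leb]_s H (z, s).
  rewrite /inner /Rintegral; congr fine; apply: ae_eq_integral => //.
  - apply/measurable_EFinP; apply: measurable_funM => //; exact: measurable_line_average.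
  - apply/measurable_EFinP; apply: (measurableT_comp (fine_measurable _)) => //.
    exact: (measurable_fubini_F iH).
  - apply: ae_impl (line_slice_L2 v G2) => z K2 _; congr EFin.
    rewrite /line_average -RintegralZl//.
    have := L2_mul_integrable K2 I2; apply: eq_integrable => // s _ /=.
    by rewrite -mulrA II.
rewrite step1 (Rintegral_fubini iH); apply: eq_Rintegral => s _.
rewrite /inner -RintegralZr//; first by apply: eq_Rintegral => z _; rewrite /H /= mulrA.
by apply: L2_mul_integrable => //; exact: L2_shift.
Qed.

Variable (Omega Omega' : set V) (v : V) (f g : V -> R).
Hypothesis mO : measurable (Omega : set mV).
Hypothesis wfg : is_weak_derivative Omega v f g.
Hypothesis f2 : L2_on mu Omega f.
Hypothesis Omega'P : forall z s, Omega' z -> 0 <= s <= h -> Omega (z + s *: v).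

(** The increment is moved onto phi, where the classical fundamental theorem of calculus expresses
    it by the derivatives of the translates of phi. By the hypothesis on [Omega'] these translates
    are test functions on [Omega], so the definition of weak derivative applies to each of them
    under the integral in s. *)
Let increment_test phi : test_function Omega' phi ->
  inner mu (fun z => (f \_ Omega) (z + h *: v) - (f \_ Omega) z -
    line_average v (g \_ Omega) z) phi = 0.
Proof.
have [G2 HG] := (is_weak_derivativeP _ _ _ mO).1 wfg.
have F2 : L2_on mu setT (f \_ Omega) by exact/(L2_patch _ _ mO).
set F := f \_ Omega in F2 HG *; set G := g \_ Omega in G2 HG *.
move=> tphi; have phi2 := test_function_L2 tphi.
have [cD dphi _] := test_function_derive v tphi.
have D2 := derive_test_function_L2 v tphi.
have [A2 _] := line_average_bound v G2.
have Fh2 := L2_shift (h *: v) F2.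
rewrite (innerBl (L2B Fh2 F2) A2 phi2) (innerBl Fh2 F2 phi2).
have phih2 : L2_on mu setT (fun z => phi (z - h *: v)) by exact: L2_shift.
have -> : inner mu (fun z => F (z + h *: v)) phi = inner mu F (fun z => phi (z - h *: v)).
  rewrite -(inner_shift (- (h *: v)) Fh2 phi2).
  by congr inner; apply/funext => z; rewrite subrK.
pose nD (y : V) : R := (-1) * 'D_v phi y.
have nD2 : L2_on mu setT nD by exact: L2Z.
have ftc z : phi (z - h *: v) - phi z = line_average (- v) nD z.
  pose k t := phi (t *: v + z).
  have dk (t : R) : is_derive t (1 : R) k ('D_v phi (t *: v + z)) by exact: is_derive_line.
  have dkN (t : R) : is_derive t (1 : R) (k \o -%R) ('D_v phi (- t *: v + z) * - 1).
    exact: (@is_derive1_comp _ k -%R t _ (-1) (dk (- t)) (is_deriveNid t 1)).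
  have ckN : continuous (k \o -%R).
    by move=> t; apply: differentiable_continuous; apply/derivable1_diffP; have [] := dkN t.
  have cD1 : continuous (fun t : R => 'D_v phi (- t *: v + z) * - 1).
    move=> t; apply: cvgM; last exact: cvg_cst.
    apply: (@continuous_comp _ _ _ (fun t : R => - t *: v + z) (fun y => 'D_v phi y)); last exact: cD.
    apply: continuousD; last exact: cst_continuous.
    apply: continuousZ; last exact: cst_continuous.
    exact: opp_continuous.
  have h1 : {within `[0, h], continuous (fun t : R => 'D_v phi (- t *: v + z) * - 1)}.
    exact: continuous_subspaceT.
  have h2 : derivable_oo_LRcontinuous (k \o -%R) 0 h.
    split => [t _||]; first by have [] := dkN t.
    - by apply: cvg_at_right_filter; exact: ckN.
    - by apply: cvg_at_left_filter; exact: ckN.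
  have h3 : {in `]0, h[, derive1 (k \o -%R) =1 (fun t : R => 'D_v phi (- t *: v + z) * - 1)}.
    by move=> t _; rewrite derive1E; have [_ ->] := dkN t.
  have := @continuous_FTC2 R _ _ 0 h h0 h1 h2 h3.
  rewrite /k /comp oppr0 scale0r add0r scaleNr [- _ + z]addrC => E.
  rewrite /line_average /Rintegral.
  suff -> : (\int[leb]_s (nD (z + s *: - v)%R * I s)%:E = (phi (z - h *: v) - phi z)%:E)%E by [].
  rewrite EFinB -E [RHS]integral_mkcond; apply: eq_integral => s _.
  rewrite patchE indicE; case: ifP => _; last by rewrite mulr0.
  by rewrite mulr1 /nD mulrC scalerN scaleNr addrC.
have -> : inner mu F (fun z => phi (z - h *: v)) - inner mu F phi =
    inner mu F (line_average (- v) nD).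
  rewrite (innerC mu F (fun z => phi (z - h *: v))) (innerC mu F phi) -innerBl//.
  by rewrite innerC; congr inner; apply/funext => z; rewrite ftc.
rewrite (innerC mu _ phi) !line_average_fubini//.
apply/eqP; rewrite subr_eq0; apply/eqP; apply: eq_Rintegral => s _.
rewrite indicE; have [|] := boolP (s \in _); last by rewrite !mulr0.
rewrite inE /= in_itv /= => sh; rewrite !mulr1.
have ts : test_function Omega (fun z => phi (z + s *: - v)).
  apply: test_function_translate tphi => z Oz; rewrite scalerN opprK.
  exact: Omega'P.
have ps2 : L2_on mu setT (fun z => phi (z + s *: - v)) by exact: L2_shift.
have -> : inner mu F (fun z => nD (z + s *: - v)) = inner mu G (fun z => phi (z + s *: - v)).
  rewrite (innerZ (-1) F2 (L2_shift (s *: - v) D2)).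
  have -> : (fun z => 'D_v phi (z + s *: - v)) = (fun z => 'D_v (fun y => phi (y + s *: - v)) z).
    by apply/funext => z; rewrite derive_translate.
  by rewrite HG// mulN1r opprK.
rewrite (innerC mu phi) -(inner_shift (s *: - v) (L2_shift (s *: v) G2) phi2).
congr inner; apply/funext => z; by rewrite scalerN subrK.
Qed.

(** The set of starting points has to be a cylinder for du Bois-Reymond's lemma. In the direction y
    it is the cylinder shortened by h, in the directions of R^N the cylinder itself. *)
Lemma weak_derivative_increment l : Omega' = cyl l ->
  {ae mu, forall z, Omega' z ->
    (f \_ Omega) (z + h *: v) - (f \_ Omega) z = line_average v (g \_ Omega) z}.
Proof.
move=> Ol.
have [G2 HG] := (is_weak_derivativeP _ _ _ mO).1 wfg.
have F2 : L2_on mu setT (f \_ Omega) by exact/(L2_patch _ _ mO).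
have [A2 _] := line_average_bound v G2.
have Fh2 := L2_shift (h *: v) F2.
suff : {ae mu, forall z, cyl l z -> (f \_ Omega) (z + h *: v) - (f \_ Omega) z -
    line_average v (g \_ Omega) z = 0}.
  by rewrite Ol; apply: ae_impl => z H cz; apply/eqP; rewrite -subr_eq0 H.
apply: cyl_orthogonal_eq0; first by apply: L2B => //; exact: L2B.
by move=> phi tphi; apply: increment_test; rewrite Ol.
Qed.

End line_average.

(** * Decreasing rearrangements *)

Lemma measurable_set_bool d (T : measurableType d) (b : T -> bool) :
  measurable_fun setT b -> measurable [set x | b x].
Proof.
move=> mb; have := mb measurableT [set true] I; rewrite setTI.
by congr measurable; apply/seteqP; split => x //= ->.
Qed.

Lemma measurable_fun_gt d (T : measurableType d) (R : realType) (f : T -> R) :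
  (forall t, measurable [set x | t < f x]) -> measurable_fun setT f.
Proof.
move=> mf; apply: (measurability _ (RGenOInfty.measurableE R)) => //.
move=> /= _ [_ [t ->] <-]; rewrite setTI.
rewrite (_ : _ @^-1` _ = [set x | t < f x]); first exact: mf.
by apply/seteqP; split => x /=; rewrite in_itv /= andbT.
Qed.

(** * Layer cake formulas *)

Section layer_cake.
Context d1 d2 (T1 : measurableType d1) (T2 : measurableType d2) (R : realType).
Variables (m1 : {sigma_finite_measure set T1 -> \bar R})
  (m2 : {sigma_finite_measure set T2 -> \bar R}).

Lemma integral_sections (A : set (T1 * T2)) : measurable A ->
  (\int[m1]_x m2 [set y | A (x, y)] = \int[m2]_y m1 [set x | A (x, y)])%E.
Proof.
move=> mA; transitivity ((m1 \x m2)%E A).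
  apply: eq_integral => x _; congr (m2 _); apply/seteqP.
  by split => y; rewrite /xsection /= inE.
rewrite (@product_measure_unique _ _ _ _ _ m1 m2 (m1 \x^ m2)%E)//; last first.
  by move=> *; exact: product_measure2E.
apply: eq_integral => y _; congr (m1 _); apply/seteqP.
by split => x; rewrite /ysection /= inE.
Qed.

Lemma measurable_sections (A : set (T1 * T2)) : measurable A ->
  measurable_fun setT (fun y => m1 [set x | A (x, y)]).
Proof.
move=> mA; have := measurable_fun_ysection m1 mA; congr measurable_fun.
apply/funext => y; congr (m1 _); apply/seteqP.
by split => x; rewrite /ysection /= inE.
Qed.

End layer_cake.

Section layer_cake_real.
Context d (T : measurableType d) (R : realType).
Variable mu : {sigma_finite_measure set T -> \bar R}.
Local Notation leb := (@lebesgue_measure R).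
Local Notation mR := (measurableTypeR R).

Lemma lebesgue_itvco (a b : R) :
  leb (`[a, b[%classic : set R) = (Num.max (b - a) 0)%:E.
Proof.
have -> : leb (`[a, b[%classic : set R) = (if a < b then (b - a)%:E else 0%E).
  by rewrite lebesgue_measure_itv /= lte_fin; case: ifP.
case: ltP => ab; first by rewrite max_l// subr_ge0 ltW.
by rewrite max_r// subr_le0.
Qed.

Lemma layer_cake (F : T -> R) : measurable_fun setT F -> (forall x, 0 <= F x) ->
  (\int[mu]_x (F x)%:E = \int[leb]_t mu [set x | (0 <= t < F x)%R])%E.
Proof.
move=> mF F0; pose A : set (T * mR) := [set p | 0 <= p.2 < F p.1].
have mA : measurable A.
  apply: measurable_set_bool; apply: measurable_and.
    by apply: measurable_fun_ler => //.
  apply: measurable_fun_ltr => //; exact: measurableT_comp.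
rewrite -(@integral_sections _ _ _ _ R mu leb A mA).
apply: eq_integral => x _.
have -> : [set y | A (x, y)] = `[0, F x[%classic.
  by apply/seteqP; split => t; rewrite /A /= in_itv.
by apply: esym; apply: (etrans (lebesgue_itvco 0 (F x))); rewrite subr0 max_l.
Qed.

Let layer (F G : T -> R) : set (T * (mR * mR)) :=
  [set p | (G p.1 <= p.2.1 < F p.1) && (G p.1 <= p.2.2 < F p.1)].

Let measurable_layer (F G : T -> R) : measurable_fun setT F ->
  measurable_fun setT G -> measurable (layer F G).
Proof.
move=> mF mG.
have mp1 : measurable_fun setT (fun p : T * (mR * mR) => p.2.1).
  exact: (measurableT_comp measurable_fst measurable_snd).
have mp2 : measurable_fun setT (fun p : T * (mR * mR) => p.2.2).
  exact: (measurableT_comp measurable_snd measurable_snd).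
have mF1 : measurable_fun setT (fun p : T * (mR * mR) => F p.1).
  exact: (measurableT_comp mF measurable_fst).
have mG1 : measurable_fun setT (fun p : T * (mR * mR) => G p.1).
  exact: (measurableT_comp mG measurable_fst).
apply: measurable_set_bool.
by apply: measurable_and; apply: measurable_and;
  [exact: measurable_fun_ler|exact: measurable_fun_ltr
  |exact: measurable_fun_ler|exact: measurable_fun_ltr].
Qed.

Lemma measurable_layer_measure (F G : T -> R) : measurable_fun setT F ->
  measurable_fun setT G ->
  measurable_fun setT (fun q : mR * mR =>
    mu [set x | (G x <= q.1 < F x) && (G x <= q.2 < F x)]).
Proof.
move=> mF mG; exact: measurable_sections (measurable_layer mF mG).
Qed.

(** The square of the positive part of F - G is the area of [G, F[ x [G, F[. It thus becomes an
    integral over pairs of levels, and a contraction inequality can be checked one pair of levels at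
    a time. *)
Lemma layer_cake2 (F G : T -> R) :
  measurable_fun setT F -> measurable_fun setT G ->
  (\int[mu]_x ((Num.max (F x - G x) 0)^+2)%:E =
   \int[sf_product leb leb]_q mu [set x | (G x <= q.1 < F x)%R && (G x <= q.2 < F x)%R])%E.
Proof.
move=> mF mG.
have := @integral_sections _ _ _ _ R mu (sf_product leb leb) _ (measurable_layer mF mG) => <-.
apply: eq_integral => x _.
have -> : [set y | layer F G (x, y)] = `[G x, F x[%classic `*` `[G x, F x[%classic.
  apply/seteqP; split => -[s t]; rewrite /layer /= !in_itv /=; first by move/andP.
  by move=> [-> ->].
apply: esym; apply: (etrans (@product_measure1E _ _ _ _ R leb leb _ _
  (measurable_itv _) (measurable_itv _))).
have e := lebesgue_itvco (G x) (F x).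
by apply: (etrans (congr2 mule e e)); rewrite -EFinM expr2.
Qed.

End layer_cake_real.

(** * Decreasing rearrangement on a sigma-finite measure space *)

Section decreasing_rearrangement.
Context d (Y : measurableType d) (R : realType).
Variable nu : {sigma_finite_measure set Y -> \bar R}.
Local Notation leb := (@lebesgue_measure R).
Local Notation mR := (measurableTypeR R).
Local Notation pos := (`]0, +oo[%classic : set R).
Implicit Types f g : Y -> R.

(** [distr] and [rearr] are the formulas of [distribution_fun] and [rearrangement] on an arbitrary
    space; a graph is recovered with [nat * R] under counting times Lebesgue measure. *)
Definition distr f (t : R) : \bar R := nu [set z | t < f z].

Definition rearr f (y : R) : R :=
  inf [set t : R | 0 <= t /\ (distr f t <= y%:E)%E].

(** For y > 0 the set whose infimum defines [rearr f y] is then nonempty, so the conventional value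
    0 of the infimum of the empty set never interferes. *)
Definition vanishing f := forall y : R, 0 < y ->
  exists n : nat, (distr f n%:R <= y%:E)%E.

Lemma measurable_gt f t : measurable_fun setT f -> measurable [set z | t < f z].
Proof. by move=> mf; apply: measurable_set_bool; exact: measurable_fun_ltr. Qed.

Lemma distr_decreasing f s t : measurable_fun setT f -> s <= t ->
  (distr f t <= distr f s)%E.
Proof.
move=> mf st; apply: le_measure; rewrite ?inE; try exact: measurable_gt.
by move=> z /=; exact: le_lt_trans.
Qed.

(** The set {f > t} is the increasing union of the sets {f > t + 1/(n+1)}. This is why the infimum
    defining the rearrangement, over a nonempty set, is attained. *)
Lemma distr_right_continuous f t a : measurable_fun setT f ->
  (forall t', t < t' -> (distr f t' <= a)%E) -> (distr f t <= a)%E.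
Proof.
move=> mf H; pose F n := [set z | t + n.+1%:R^-1 < f z].
have mF n : measurable (F n) by exact: measurable_gt.
have UF : \bigcup_n F n = [set z | t < f z].
  apply/seteqP; split => z /=.
    by move=> [n _]; apply: lt_trans; rewrite ltrDl invr_gt0.
  move=> tz; have /ltr_add_invr[n] := tz; by exists n.
have ndF : nondecreasing_seq F.
  move=> m n mn; apply/subsetPset => z /=; apply: le_lt_trans.
  by rewrite lerD2l lef_pV2 ?posrE// ler_nat ltnS.
have := nondecreasing_cvg_mu mF _ ndF; rewrite UF.
move=> /(_ _ nu (measurable_gt t mf)) cF.
rewrite /distr; move/cvg_lim : (cF) => <-//.
apply: lime_le; first by apply/cvg_ex; eexists; exact: cF.
by apply: nearW => n; apply: H; rewrite ltrDl invr_gt0.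
Qed.

Lemma rearr_ge0 f y : 0 <= rearr f y.
Proof.
rewrite /rearr; set S := [set t : R | _].
have [->|/set0P ne] := eqVneq S set0; first by rewrite inf0.
by apply: lb_le_inf => // t [].
Qed.

(** The existence clause excludes the empty set, whose infimum is 0. Stated with natural levels it
    is a countable condition, from which [measurable_rearr_param] draws joint measurability in the
    parameter and y. *)
Lemma rearr_gtP f t y : measurable_fun setT f -> 0 <= t ->
  t < rearr f y <-> (exists n : nat, (distr f n%:R <= y%:E)%E) /\ (y%:E < distr f t)%E.
Proof.
move=> mf t0; set S := [set t : R | 0 <= t /\ (distr f t <= y%:E)%E].
have lbS : has_lbound S by exists 0 => s [].
split=> [tf|[[n Hn] yt]].
  have [S0|/set0P[s [s0 Ss]]] := eqVneq S set0.
    by move: tf; rewrite /rearr -/S S0 inf0 ltNge t0.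
  split.
    exists (Num.truncn s).+1; apply: le_trans Ss; apply: distr_decreasing => //.
    by rewrite ltW// truncnS_gt.
  rewrite ltNge; apply/negP => yt; move: tf; rewrite ltNge => /negP; apply.
  exact: ge_inf.
rewrite ltNge; apply/negP => ft; move: yt; rewrite ltNge => /negP; apply.
apply: distr_right_continuous => // t' tt'.
have hS : has_inf S by split => //; exists n%:R.
have [s [s0 Ss]] := @inf_adherent _ S (t' - t) (ltac:(by rewrite subr_gt0)) hS.
rewrite -/(rearr f y) => st'.
apply: le_trans Ss; apply: distr_decreasing => //.
by move: st' ft; rewrite /rearr -/S; lra.
Qed.

Lemma rearr_gtE f t y : measurable_fun setT f -> vanishing f -> 0 <= t -> 0 < y ->
  (t < rearr f y) = (y%:E < distr f t)%E.
Proof.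
move=> mf vf t0 y0; apply/idP/idP => [/(rearr_gtP y mf t0)[]//|yt].
by apply/(rearr_gtP y mf t0); split => //; exact: vf.
Qed.

(** Chebyshev's inequality: n^2 times the measure of {f > n} is at most the integral of f^2. *)
Lemma vanishing_L2 f : measurable_fun setT f -> (forall z, 0 <= f z) ->
  (\int[nu]_z (f z ^+ 2)%:E < +oo)%E -> vanishing f.
Proof.
move=> mf f0 If y y0; set I := (\int[nu]_z _)%E in If.
have I0 : (0 <= I)%E by apply: integral_ge0 => z _; rewrite lee_fin sqr_ge0.
have markov (n : nat) : ((n%:R ^+ 2)%:E * distr f n%:R <= I)%E.
  rewrite /distr -integral_cst; last exact: measurable_gt.
  rewrite integral_mkcond; apply: ge0_le_integral => //.
  - by move=> z _; rewrite patchE; case: ifP => // _; rewrite lee_fin sqr_ge0.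
  - apply/(measurable_restrictT _ _).1 => //; exact: measurable_gt.
  - by apply/measurable_EFinP; exact: measurable_funX.
  move=> z _; rewrite patchE; case: ifPn => [|_]; last by rewrite lee_fin sqr_ge0.
  by rewrite inE /= lee_fin => nz; rewrite lerXn2r ?nnegrE// ltW.
have If' : I = (fine I)%:E by rewrite fineK// ge0_fin_numE.
have [n Hn] : exists n : nat, fine I / y <= n%:R.
  exists (Num.truncn (fine I / y)).+1; exact/ltW/truncnS_gt.
exists n.+1; have := markov n.+1; rewrite If'.
case: (distr f n.+1%:R) (measure_ge0 nu [set z | n.+1%:R < f z]) => [r| |] //=.
- move=> _; rewrite -EFinM !lee_fin => H.
  have n1 : (1 <= n.+1%:R :> R) by rewrite ler1n.
  have {Hn} : fine I <= n.+1%:R * y.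
    by rewrite -ler_pdivrMr// (le_trans Hn)// ler_nat.
  move=> H2; have H3 : n.+1%:R ^+ 2 * r <= n.+1%:R ^+ 2 * y.
    apply: (le_trans H); apply: (le_trans H2); rewrite ler_wpM2r ?(ltW y0)//.
    by rewrite ler_eXnr.
  by move: H3; rewrite ler_pM2l// exprn_gt0.
- by move=> _; rewrite gt0_muley ?lte_fin ?exprn_gt0// leye_eq.
- by rewrite leNye.
Qed.

Lemma measurable_distr d' (X : measurableType d') (U : X * Y -> R) t :
  measurable_fun setT U -> measurable_fun setT (fun x => distr (fun z => U (x, z)) t).
Proof.
move=> mU; have mA : measurable [set p | t < U p].
  by apply: measurable_set_bool; exact: measurable_fun_ltr.
have := measurable_fun_xsection nu mA; congr measurable_fun; apply/funext => x.
by congr (nu _); apply/seteqP; split => z; rewrite /xsection /= inE.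
Qed.

Lemma measurable_rearr_param d' (X : measurableType d') (U : X * Y -> R) :
  measurable_fun setT U ->
  measurable_fun setT ((fun p => rearr (fun z => U (p.1, z)) p.2) : X * mR -> R).
Proof.
move=> mU; apply: measurable_fun_gt => t.
have mUx x : measurable_fun setT (fun z => U (x, z)) by exact: measurable_fun_pair2.
have [t0|t0] := leP 0 t; last first.
  rewrite [X in measurable X](_ : _ = setT)//; apply/seteqP; split => // p _ /=.
  exact: lt_le_trans (rearr_ge0 _ _).
rewrite [X in measurable X](_ : _ =
  (\bigcup_n [set p : X * mR | (distr (fun z => U (p.1, z)) n%:R <= (p.2)%:E)%E]) `&`
  [set p : X * mR | ((p.2)%:E < distr (fun z => U (p.1, z)) t)%E]).
  have m2 : measurable_fun setT (fun p : X * mR => (p.2)%:E) by exact/measurable_EFinP.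
  apply: measurableI.
    apply: bigcup_measurable => n _; apply: measurable_set_bool.
    apply: measurable_fun_lee => //.
    exact: (measurableT_comp (measurable_distr n%:R mU) measurable_fst).
  apply: measurable_set_bool; apply: measurable_fun_lte => //.
  exact: (measurableT_comp (measurable_distr t mU) measurable_fst).
apply/seteqP; split => -[x y] /=.
  by move/(rearr_gtP y (mUx x) t0) => [[n Hn] yt]; split => //; exists n.
by move=> [[n _ Hn] yt]; apply/(rearr_gtP y (mUx x) t0); split => //; exists n.
Qed.

Lemma measurable_rearr f : measurable_fun setT f -> measurable_fun setT (rearr f : mR -> R).
Proof.
move=> mf; have mU : measurable_fun setT (fun p : unit * Y => f p.2).
  exact: measurableT_comp.
exact: (measurable_fun_pair2 tt (measurable_rearr_param mU)).
Qed.

Lemma lebesgue_gap (a b c : \bar R) : b != -oo%E -> (0 <= c)%E -> (a <= c + b)%E ->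
  (leb [set y | (b <= y%:E < a)%E] <= c)%E.
Proof.
case: b => [b| |]// b0 c0 H; last first.
  rewrite (_ : [set _ | _] = set0) ?measure0//.
  by apply/seteqP; split => y //= /andP[]; rewrite leye_eq.
case: c c0 H => [c| |]// c0 H; last by rewrite leey.
apply: (@le_trans _ _ (leb (`[b, c + b[%classic : set R))).
  apply: le_measure; rewrite ?inE.
  - apply: measurable_set_bool; apply: measurable_and.
      by apply: measurable_fun_lee => //; exact/measurable_EFinP.
    by apply: measurable_fun_lte => //; exact/measurable_EFinP.
  - exact: measurable_itv.
  - move=> y /= /andP[by_ ya]; rewrite in_itv /= -lee_fin by_ /= -lte_fin.
    exact: lt_le_trans H.
by rewrite lebesgue_itvco addrK /Num.max ltNge -lee_fin c0.
Qed.

Lemma distr_diff f g s t : measurable_fun setT f -> measurable_fun setT g ->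
  (distr f t <= nu [set z | (g z <= s)%R && (t < f z)%R] + distr g s)%E.
Proof.
move=> mf mg.
have m1 : measurable [set z | (g z <= s) && (t < f z)].
  apply: measurable_set_bool; apply: measurable_and.
    exact: measurable_fun_ler.
  exact: measurable_fun_ltr.
apply: le_trans (measureU2 nu m1 (measurable_gt s mg)).
apply: le_measure; rewrite ?inE.
- exact: measurable_gt.
- by apply: measurableU => //; exact: measurable_gt.
by move=> z /= tf; have [gs|gs] := leP (g z) s; [left; rewrite tf|right].
Qed.

Let mpos : measurable (pos : set mR). Proof. exact: measurable_itv. Qed.

Let patch_ge0 f y : 0 <= (rearr f \_ pos) y.
Proof. by rewrite patchE; case: ifP => // _; exact: rearr_ge0. Qed.

Let mpatch f : measurable_fun setT f -> measurable_fun setT (rearr f \_ pos : mR -> R).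
Proof.
move=> mf; apply: (measurable_restrictT _ mpos).1.
by apply: measurable_funTS; exact: measurable_rearr.
Qed.

(** By [rearr_gtE] the superlevel set on the open half-line is the interval from 0 to
    [distr f t]. *)
Lemma rearr_equimeasurable f t : measurable_fun setT f -> vanishing f -> 0 <= t ->
  leb [set y | t < (rearr f \_ pos) y] = distr f t.
Proof.
move=> mf vf t0.
have -> : [set y | t < (rearr f \_ pos) y] = pos `&` [set y | (y%:E < distr f t)%E].
  apply/seteqP; split => y /=; rewrite patchE in_itv /= andbT.
    case: ifPn; last by rewrite ltNge t0.
    by rewrite inE /= in_itv /= andbT => y0 /=; rewrite rearr_gtE.
  by move=> [y0 ?]; rewrite mem_set /= ?in_itv /= ?y0// rearr_gtE.
have d0 : (0 <= distr f t)%E := measure_ge0 nu _.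
case: (distr f t) d0 => [r| |]// r0.
- have -> : pos `&` [set y | (y%:E < r%:E)%E] = `]0, r[%classic.
    by apply/seteqP; split => y /=; rewrite !in_itv /= andbT lte_fin => /andP.
  have -> : leb (`]0, r[%classic : set R) = (if 0 < r then r%:E else 0%E).
    by rewrite lebesgue_measure_itv /= lte_fin; case: ifP => // _; rewrite oppr0 adde0.
  by case: ltP => // r1; congr EFin; apply/eqP; rewrite eq_le -lee_fin r0 r1.
have -> : pos `&` [set y | (y%:E < +oo)%E] = pos.
  by apply/seteqP; split => y /=; [case|rewrite ltry].
have -> : leb pos = (if (0%:E < +oo :> \bar R)%E then +oo - 0 else 0)%E.
  exact: lebesgue_measure_itv.
by rewrite ltry oppe0 adde0.
Qed.

Lemma rearr_Lp f (p : R) : measurable_fun setT f -> (forall z, 0 <= f z) ->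
  vanishing f -> 1 <= p ->
  (\int[leb]_(y in pos) (rearr f y `^ p)%:E = \int[nu]_z (f z `^ p)%:E)%E.
Proof.
move=> mf f0 vf p1; have p0 : 0 < p by lra.
(* The superlevel set of f^p at t is that of f at t^(1/p), which brings the p-th powers back to
   equimeasurability. *)
have pw (a t : R) : 0 <= a -> 0 <= t -> (t < a `^ p) = (t `^ p^-1 < a).
  move=> a0 t0; have -> : (t < a `^ p) = ((t `^ p^-1) `^ p < a `^ p).
    by rewrite -powRrM ?mulVf ?gt_eqF// powRr1.
  by rewrite !ltNge; congr negb; apply/idP/idP => [|H];
    [rewrite leNgt => H; rewrite leNgt; apply: contra H; apply: gt0_ltr_powR
    |apply: ge0_ler_powR]; rewrite ?nnegrE ?powR_ge0// ltW.
rewrite integral_mkcond.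
transitivity (\int[leb]_y (((rearr f \_ pos) y) `^ p)%:E)%E.
  apply: eq_integral => y _; rewrite !patchE; case: ifP => // _.
  by rewrite powR0// gt_eqF.
have mF1 : measurable_fun setT (fun y => (rearr f \_ pos) y `^ p : R).
  by apply: (measurableT_comp (measurable_powR p)); exact: mpatch.
have mF2 : measurable_fun setT (fun z => f z `^ p : R).
  exact: (measurableT_comp (measurable_powR p)).
apply: etrans (layer_cake leb mF1 (fun y => powR_ge0 _ _)) _.
apply: etrans (esym (layer_cake nu mF2 (fun y => powR_ge0 _ _))).
apply: eq_integral => t _; have [t0|t0] := leP 0 t; last first.
    have e0 (T : Type) (b : T -> bool) : [set x | false && b x] = set0 by apply/seteqP; split.
  by rewrite !e0 !measure0.
transitivity (leb [set y | t `^ p^-1 < (rearr f \_ pos) y]).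
  by congr (leb _); apply/seteqP; split => y /=; rewrite pw.
rewrite rearr_equimeasurable ?powR_ge0//.
by congr (nu _); apply/seteqP; split => y /=; rewrite pw.
Qed.

(** For levels s and t with minimum m and maximum w, the layer of the rearrangements is the interval
    [[distr g m], [distr f w][. Its length is at most the measure of {g <= m, f > w}, which is the
    layer of f and g. *)
Let rearr_contraction_pos f g : measurable_fun setT f -> measurable_fun setT g ->
  (forall z, 0 <= f z) -> (forall z, 0 <= g z) -> vanishing f -> vanishing g ->
  (\int[leb]_y ((Num.max ((rearr f \_ pos) y - (rearr g \_ pos) y) 0) ^+ 2)%:E <=
   \int[nu]_z ((Num.max (f z - g z) 0) ^+ 2)%:E)%E.
Proof.
move=> mf mg f0 g0 vf vg; rewrite !layer_cake2//; try exact: mpatch.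
set L := (fun q => leb _); set M := (fun q => nu _).
have LM q : (L q <= M q)%E.
  case: q => s t; rewrite /L /M /=.
  pose m := Num.min s t; pose w := Num.max s t.
  have E (a b : R) : (b <= s < a) && (b <= t < a) = (b <= m) && (w < a).
    rewrite /m /w le_min gt_max.
    by case: (b <= s); case: (b <= t); case: (s < a); case: (t < a).
  under eq_set do rewrite E.
  under [X in nu X]eq_set do rewrite E.
  (* [rearr_gtE] needs nonnegative levels; below 0 the layer on the left is empty, since the
     rearrangement of g is nonnegative. *)
  have [m0|m0] := leP 0 m; last first.
    rewrite (_ : [set _ | _] = set0) ?measure0//; apply/seteqP; split => y //=.
    by move=> /andP[+ _]; rewrite leNgt => /negP; apply; exact: lt_le_trans (patch_ge0 g y).
  have w0 : 0 <= w by rewrite (le_trans m0)// /m /w ge_min le_max lexx.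
  have dN : distr g m != -oo%E.
    by rewrite gt_eqF// (lt_le_trans ltNy0) ?measure_ge0.
  apply: le_trans (lebesgue_gap dN (measure_ge0 nu _) (distr_diff m w mf mg)).
  apply: le_measure; rewrite ?inE.
  - apply: measurable_set_bool; apply: measurable_and.
      by apply: measurable_fun_ler => //; exact: mpatch.
    by apply: measurable_fun_ltr => //; exact: mpatch.
  - apply: measurable_set_bool; apply: measurable_and.
      by apply: measurable_fun_lee => //; exact/measurable_EFinP.
    by apply: measurable_fun_lte => //; exact/measurable_EFinP.
  move=> y /= /andP[]; rewrite !patchE; case: ifPn => [|_ _]; last by rewrite ltNge w0.
  rewrite inE /= in_itv /= andbT => y0.
  by rewrite leNgt !rearr_gtE// -leNgt => -> ->.
apply: ge0_le_integral => //.
- by apply: measurable_layer_measure; exact: mpatch.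
- exact: measurable_layer_measure.
- by move=> q _; exact: LM.
Qed.

Let sqr_max (a b : R) : (a - b) ^+ 2 = Num.max (a - b) 0 ^+ 2 + Num.max (b - a) 0 ^+ 2.
Proof.
by case: (leP a b) => ab; [rewrite max_r ?subr_le0// max_l ?subr_ge0//
  |rewrite max_l ?subr_ge0 ?(ltW ab)// max_r ?subr_le0 ?(ltW ab)//]; ring.
Qed.

Lemma rearr_contraction f g : measurable_fun setT f -> measurable_fun setT g ->
  (forall z, 0 <= f z) -> (forall z, 0 <= g z) -> vanishing f -> vanishing g ->
  (\int[leb]_(y in pos) ((rearr f y - rearr g y) ^+ 2)%:E <=
   \int[nu]_z ((f z - g z) ^+ 2)%:E)%E.
Proof.
move=> mf mg f0 g0 vf vg; rewrite integral_mkcond.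
have mx d' (T : measurableType d') (a b : T -> R) : measurable_fun setT a ->
    measurable_fun setT b ->
    measurable_fun setT (fun z => (Num.max (a z - b z) 0 ^+ 2)%:E).
  move=> ma mb; apply/measurable_EFinP/measurable_funX.
  by apply: measurable_maxr => //; exact: measurable_funB.
under eq_integral => y _.
  rewrite (_ : _ y = (Num.max ((rearr f \_ pos) y - (rearr g \_ pos) y) 0 ^+ 2)%:E +
    (Num.max ((rearr g \_ pos) y - (rearr f \_ pos) y) 0 ^+ 2)%:E)%E; last first.
    rewrite -EFinD -sqr_max !patchE; case: ifP => //; by rewrite subrr expr0n.
  over.
under [leRHS]eq_integral do rewrite sqr_max EFinD.
rewrite !ge0_integralD//; try by move=> *; rewrite lee_fin sqr_ge0.
- by apply: leeD; exact: rearr_contraction_pos.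
- exact: mx.
- exact: mx.
- by apply: mx; exact: mpatch.
- by apply: mx; exact: mpatch.
Qed.

(* [a] and [b] are at distance [h]; for each value [f z] the set of [y] with
   [f* (y + h) < f z < f* y] has measure at most [h]. *)
Lemma rearr_modulus f (w : Y -> R) (l : \bar R) (h : R) :
  measurable_fun setT f -> (forall z, 0 <= f z) -> vanishing f ->
  measurable_fun setT w -> (forall z, 0 <= w z) -> 0 < h ->
  (forall a b : R, 0 < a -> a < b -> (b%:E < l)%E ->
    (((rearr f a - rearr f b) ^+ 2)%:E <=
     (b - a)%:E * \int[nu]_(z in [set z | (rearr f b < f z < rearr f a)%R]) (w z)%:E)%E) ->
  (\int[leb]_(y in [set y : R | (0 < y)%R /\ ((y + h)%:E < l)%E])
     ((rearr f (y + h) - rearr f y) ^+ 2)%:E <= (h ^+ 2)%:E * \int[nu]_z (w z)%:E)%E.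
Proof.
move=> mf f0 vf mw w0 h0 H; set D := [set y : R | _].
have mr := measurable_rearr mf.
have mrh : measurable_fun setT (fun y : mR => rearr f (y + h)).
  by apply: (measurableT_comp mr); exact: measurable_funD.
(* Fubini on [A] exchanges the two points of view: its section at y is the level set of the
   hypothesis, its section at z the short set of y estimated at the end. *)
pose A : set (mR * Y) := [set p | [&& 0 < p.1, ((p.1 + h)%:E < l)%E,
  rearr f (p.1 + h) < f p.2 & f p.2 < rearr f p.1]].
have mA : measurable A.
  have m1 : measurable_fun setT (fun p : mR * Y => f p.2) by exact: measurableT_comp.
  apply: measurable_set_bool; apply: measurable_and; last apply: measurable_and; last apply: measurable_and.
  - exact: measurable_fun_ltr.
  - apply: measurable_fun_lte => //; apply/measurable_EFinP.
    exact: measurable_funD.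
  - by apply: measurable_fun_ltr => //; exact: (measurableT_comp mrh measurable_fst).
  - by apply: measurable_fun_ltr => //; exact: (measurableT_comp mr measurable_fst).
have mD : measurable (D : set mR).
  have -> : D = [set y | (0 < y) && ((y + h)%:E < l)%E].
    by apply/seteqP; split => y /=; [case=> -> ->|move/andP].
  apply: measurable_set_bool; apply: measurable_and; first exact: measurable_fun_ltr.
  by apply: measurable_fun_lte => //; apply/measurable_EFinP; exact: measurable_funD.
pose K (p : mR * Y) : \bar R := (w p.2 * \1_A p)%:E.
have K0 p : (0 <= K p)%E by rewrite lee_fin mulr_ge0// indicE.
have mK : measurable_fun setT K.
  apply/measurable_EFinP; apply: measurable_funM; first exact: measurableT_comp.
  exact: measurable_indic.
apply: (@le_trans _ _ (\int[leb]_y (h%:E * \int[nu]_z K (y, z)))%E).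
  rewrite integral_mkcond; apply: ge0_le_integral => //.
  - by move=> y _; rewrite patchE; case: ifP => // _; rewrite lee_fin sqr_ge0.
  - apply: (measurable_restrictT _ mD).1; apply: measurable_funTS.
    by apply/measurable_EFinP/measurable_funX; exact: measurable_funB.
  - apply: measurable_funeM.
    exact: (@measurable_fun_fubini_tonelli_F _ _ _ _ R nu K mK K0).
  move=> y _; rewrite patchE; case: ifPn => [|_]; last first.
    by rewrite mule_ge0 ?lee_fin ?(ltW h0)//; apply: integral_ge0 => z _; exact: K0.
  rewrite inE => -[y0 yl].
  have := H y (y + h) y0 (ltac:(by rewrite ltrDl)) yl.
  rewrite [y + h]addrC addrK -sqrrN opprB; move/le_trans; apply.
  apply: lee_wpmul2l; first by rewrite lee_fin ltW.
  rewrite integral_mkcond; apply: ge0_le_integral => //.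
  - by move=> z _; rewrite patchE; case: ifP => // _; rewrite lee_fin w0.
  - have mS : measurable [set z | rearr f (h + y) < f z < rearr f y].
      by apply: measurable_set_bool; apply: measurable_and; exact: measurable_fun_ltr.
    by apply: (measurable_restrictT _ mS).1; apply: measurable_funTS; exact/measurable_EFinP.
  - exact: (measurable_fun_pair2 y mK).
  move=> z _; rewrite patchE; case: ifPn => [|_]; last exact: K0.
  rewrite inE /= => /andP[z1 z2]; rewrite /K indicE mem_set ?mulr1//.
  by apply/and4P; split => //; rewrite [y + h]addrC.
rewrite ge0_integralZl//; last 3 first.
- exact: (@measurable_fun_fubini_tonelli_F _ _ _ _ R nu K mK K0).
- by move=> y _; apply: integral_ge0 => z _; exact: K0.
- by rewrite lee_fin ltW.
rewrite expr2 EFinM -muleA; apply: lee_wpmul2l; first by rewrite lee_fin ltW.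
rewrite (@fubini_tonelli _ _ _ _ R leb nu K mK K0).
rewrite -ge0_integralZl//; last 3 first.
- exact/measurable_EFinP.
- by move=> z _; rewrite lee_fin.
- by rewrite lee_fin ltW.
apply: ge0_le_integral => //.
- by move=> z _; apply: integral_ge0 => y _; exact: K0.
- exact: (@measurable_fun_fubini_tonelli_G _ _ _ _ R leb K mK K0).
- by apply: measurable_funeM; exact/measurable_EFinP.
move=> z _.
have mz : measurable [set y | A (y, z)].
  have := measurable_ysection z mA; congr measurable.
  by apply/seteqP; split => y; rewrite /ysection /= inE.
have -> : (\int[leb]_y K (y, z) = (w z)%:E * leb [set y | A (y, z)])%E.
  have -> : (\int[leb]_y K (y, z) = \int[leb]_y ((w z)%:E * (\1_[set y | A (y, z)] y)%:E))%E.
    apply: eq_integral => y _; rewrite /K EFinM !indicE.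
    by have -> : ((y, z) \in A) = (y \in [set y | A (y, z)]) by apply/idP/idP; rewrite !inE.
  rewrite ge0_integralZl//; last 2 first.
  - by apply/measurable_EFinP; exact: measurable_indic.
  - by rewrite lee_fin.
  by rewrite integral_indic// setIT.
rewrite muleC; apply: lee_wpmul2r; first by rewrite lee_fin.
set c := f z.
have dc0 : (0 <= distr f c)%E by exact: measure_ge0.
(* For a level c, f*(y + h) <= c < f*(y) means [distr f c] - h <= y < [distr f c]. *)
apply: (@le_trans _ _ (leb [set y | (distr f c - h%:E <= y%:E < distr f c)%E])).
  apply: le_measure; rewrite ?inE//.
    apply: measurable_set_bool; apply: measurable_and.
      by apply: measurable_fun_lee => //; exact/measurable_EFinP.
    by apply: measurable_fun_lte => //; exact/measurable_EFinP.
  move=> y /and4P[/= y0 yl]; rewrite -/c => c1 c2.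
  have c0 : 0 <= c by exact: f0.
  have yh0 : 0 < y + h by lra.
  move: c2; rewrite rearr_gtE// => -> /=; rewrite andbT.
  move: (ltW c1); rewrite leNgt rearr_gtE// -leNgt => H'.
  by rewrite -[(- h)%:E]/(- h%:E)%E leeBlDr// -EFinD.
apply: lebesgue_gap; rewrite ?lee_fin ?(ltW h0)//.
  by case: (distr f c) dc0.
by rewrite addeC subeK.
Qed.

End decreasing_rearrangement.

(** * Functions on a graph *)

HB.instance Definition _ (R : realType) := Measure_isSigmaFinite.Build _ _ _
  (@counting nat R) (sigma_finite_counting R).

Lemma esum_pickle (R : realType) (E : countType) (a : E -> \bar R) :
  (forall e, (0 <= a e)%E) ->
  (\esum_(e in [set: E]) a e =
   \sum_(n <oo) if pickle_inv n is Some e then a e else 0)%E.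
Proof.
move=> a0; pose b n : \bar R := if @pickle_inv E n is Some e then a e else 0%E.
have b0 n : (0 <= b n)%E by rewrite /b; case: pickle_inv.
rewrite -[RHS]/(\sum_(n <oo) b n)%E nneseries_esumT// (esumID (range (@pickle E)))//.
rewrite [X in (_ + X)%E]esum1 ?adde0; last first.
  move=> n [_ nE]; rewrite /b; case: pickle_inv (@pickle_invK E n) => //= e eE.
  by exfalso; apply: nE; exists e.
rewrite setTI esum_image; last by move=> x y _ _; exact: (pcan_inj pickleK).
by apply: eq_esum => e _; rewrite /b pickleK_inv.
Qed.

(** * A countable family of functions as one function on a product with nat *)

Section glue.
Context {R : realType} {E : countType}.
Local Notation leb := (@lebesgue_measure R).
Local Notation cnt := (@counting nat R).
Local Notation mR := (measurableTypeR R).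

(** Edges are numbered by [pickle]; a number coding no edge carries the value 0, so that it
    contributes to no integral and to no superlevel set at a nonnegative level. *)
Definition glue (T : Type) (f : E -> T -> R) (n : nat) (t : T) : R :=
  if pickle_inv n is Some e then f e t else 0.

Lemma glue_pickle (T : Type) (f : E -> T -> R) e : glue f (pickle e) = f e.
Proof. by rewrite /glue pickleK_inv. Qed.

Lemma measurable_glue d (T : measurableType d) (f : E -> T -> R) :
  (forall e, measurable_fun setT (f e)) ->
  measurable_fun setT (fun p : nat * T => glue f p.1 p.2).
Proof.
move=> mf _ B mB; rewrite setTI.
have -> : (fun p : nat * T => glue f p.1 p.2) @^-1` B =
    \bigcup_n ([set n] `*` (glue f n @^-1` B)).
  apply/seteqP; split => -[n t] /=; first by move=> Bt; exists n.
  by move=> [k _ [/= -> ?]].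
apply: bigcup_measurable => n _; apply: measurableX => //.
rewrite -[X in measurable X]setTI; suff : measurable_fun setT (glue f n) by apply.
rewrite /glue; case: pickle_inv => [e|]; [exact: mf|exact: measurable_cst].
Qed.

Lemma integral_glue d (T : measurableType d)
    (m : {sigma_finite_measure set T -> \bar R}) (f : E -> T -> R) :
  (forall e, measurable_fun setT (f e)) -> (forall e t, 0 <= f e t) ->
  (\int[sf_product cnt m]_p (glue f p.1 p.2)%:E =
   \esum_(e in [set: E]) \int[m]_t (f e t)%:E)%E.
Proof.
move=> mf f0.
have mF : measurable_fun setT (fun p : nat * T => (glue f p.1 p.2)%:E).
  by apply/measurable_EFinP; exact: measurable_glue.
have F0 (p : nat * T) : (0 <= (glue f p.1 p.2)%:E)%E.
  by rewrite lee_fin /glue; case: pickle_inv.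
transitivity (\int[cnt]_n \int[m]_t (glue f n t)%:E)%E.
  exact: (@fubini_tonelli1 _ _ _ _ R cnt m _ mF F0).
rewrite ge0_integral_count; last first.
  by move=> n; apply: integral_ge0 => t _; exact: (F0 (n, t)).
rewrite esum_pickle; last by move=> e; apply: integral_ge0 => t _; rewrite lee_fin.
apply: eq_eseriesr => n _; rewrite /glue; case: pickle_inv => // ; exact: integral0.
Qed.

Lemma sf_product_glue d (T : measurableType d)
    (m : {sigma_finite_measure set T -> \bar R}) (A : set (nat * T)) :
  measurable A -> (forall n t, A (n, t) -> @pickle_inv E n) ->
  (sf_product cnt m A = \esum_(e in [set: E]) m [set t | A (pickle e, t)])%E.
Proof.
move=> mA AE; rewrite esum_pickle//.
transitivity (\int[cnt]_n m (xsection A n))%E => //.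
rewrite ge0_integral_count//; apply: eq_eseriesr => n _.
have := @pickle_invK E n; case EQ : (pickle_inv n) => [e|] /=.
  by move=> ->; congr (m _); apply/seteqP; split => t; rewrite /xsection /= inE.
move=> _; rewrite (_ : xsection A n = set0) ?measure0//.
by apply/seteqP; split => t //; rewrite /xsection /= inE => /AE; rewrite EQ.
Qed.

End glue.

(** * Primitives of square integrable functions *)

Section primitive.
Context {R : realType}.
Local Notation leb := (@lebesgue_measure R).
Local Notation mR := (measurableTypeR R).
Implicit Types (g F : R -> R) (a b : R).

Lemma L2_indic (A : set R) : measurable (A : set mR) -> (leb A < +oo)%E ->
  L2_on leb setT (\1_A : R -> R).
Proof.
move=> mA Aoo; split; first exact: measurable_indic.
have E y : (\1_A y : R) ^+ 2 = \1_A y.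
  by rewrite indicE; case: (_ \in _); rewrite ?expr1n ?expr0n.
by under eq_integral do rewrite E; rewrite integral_indic// setIT.
Qed.

Lemma inner_indic (A : set R) : measurable (A : set mR) -> (leb A < +oo)%E ->
  inner leb \1_A \1_A = fine (leb A).
Proof.
move=> mA Aoo; rewrite -[LHS]/(fine _%:E) -L2_sqE; last exact: L2_indic.
have E y : (\1_A y : R) ^+ 2 = \1_A y.
  by rewrite indicE; case: (_ \in _); rewrite ?expr1n ?expr0n.
by under eq_integral do rewrite E; rewrite integral_indic// setIT.
Qed.

Lemma lebesgue_itvcc a b : leb (`[a, b]%classic : set R) = (Num.max (b - a) 0)%:E.
Proof.
have -> : leb (`[a, b]%classic : set R) = (if a < b then (b - a)%:E else 0%E).
  by rewrite lebesgue_measure_itv /= lte_fin; case: ifP.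
case: ltP => ab; first by rewrite max_l// subr_ge0 ltW.
by rewrite max_r// subr_le0.
Qed.

Lemma lebesgue_itvoo a b : leb (`]a, b[%classic : set R) = (Num.max (b - a) 0)%:E.
Proof.
have -> : leb (`]a, b[%classic : set R) = (if a < b then (b - a)%:E else 0%E).
  by rewrite lebesgue_measure_itv /= lte_fin; case: ifP.
case: ltP => ab; first by rewrite max_l// subr_ge0 ltW.
by rewrite max_r// subr_le0.
Qed.

(* The open interval makes the increment over [a, b] an integral over a subset
   of [a, b[ that avoids 0. *)
Definition primitive g y := inner leb g (\1_(`]0, y[%classic : set R)).

Let slab a b : set R := `]0, b[%classic `\` `]0, a[%classic.

Let measurable_slab a b : measurable (slab a b : set mR).
Proof. by apply: measurableD; exact: measurable_itv. Qed.

Let slab_sub a b y : slab a b y -> 0 < y /\ a <= y < b.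
Proof.
move=> [] /=; rewrite !in_itv /= => /andP[y0 yb] /negP.
by rewrite y0 /= -leNgt yb => ->.
Qed.

Let leb_slab a b : a <= b -> (leb (slab a b) <= (b - a)%:E)%E.
Proof.
move=> ab; apply: (@le_trans _ _ (leb (`[a, b[%classic : set R))).
  apply: le_measure; rewrite ?inE//.
  by move=> y /slab_sub[_]; rewrite /= in_itv.
by rewrite lebesgue_itvco max_l// subr_ge0.
Qed.

Let L2_slab a b : a <= b -> L2_on leb setT (\1_(slab a b) : R -> R).
Proof.
move=> ab; apply: L2_indic => //.
by apply: le_lt_trans (leb_slab ab) _; rewrite ltry.
Qed.

Lemma L2_itvoo a b : L2_on leb setT (\1_(`]a, b[%classic : set R) : R -> R).
Proof.
apply: L2_indic; first exact: measurable_itv.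
by have -> := lebesgue_itvoo a b; rewrite ltry.
Qed.

Let primitiveB g a b : L2_on leb setT g -> a <= b ->
  primitive g b - primitive g a = inner leb g \1_(slab a b).
Proof.
move=> g2 ab; rewrite /primitive (innerC leb g _) (innerC leb g \1_`]0, a[).
rewrite -innerBl//; try exact: L2_itvoo.
rewrite innerC; congr inner; apply/funext => y; rewrite !indicE.
have memE (i : interval R) : (y \in [set` i]) = (y \in i).
  by apply/idP/idP => [/set_mem|/mem_set].
have -> : (y \in slab a b) = (y \in `]0, b[%R) && ~~ (y \in `]0, a[%R).
  apply/idP/idP => [/set_mem[/= -> /negP ->]//|/andP[? /negP ?]].
  by apply/mem_set.
rewrite !memE.
rewrite !in_itv /=; case: (0 < y) => //=; rewrite ?subrr//.
case: (ltP y a) => ya; last by rewrite andbT subr0.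
by rewrite (lt_le_trans ya ab) /= subrr.
Qed.

(** Cauchy-Schwarz against the indicator of the slab. The signs of a and b are free: the primitive
    vanishes for y <= 0, hence is continuous on the whole line, which spares one-sided arguments at
    the ends of the edges. *)
Lemma primitive_diff_sqr g a b : L2_on leb setT g -> a <= b ->
  (primitive g b - primitive g a) ^+ 2 <= (b - a) * inner leb g g.
Proof.
move=> g2 ab; rewrite primitiveB//.
apply: le_trans (inner_cauchy_schwarz g2 (L2_slab ab)) _.
rewrite mulrC ler_wpM2r ?inner_ge0//.
have h := leb_slab ab; have hoo : (leb (slab a b) < +oo)%E by rewrite (le_lt_trans h) ?ltry.
by rewrite inner_indic// -lee_fin fineK// ge0_fin_numE.
Qed.

Lemma continuous_sqr_bound F K : (forall a b, a <= b -> (F b - F a) ^+ 2 <= (b - a) * K) ->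
  continuous F.
Proof.
move=> H; have K0 : 0 <= K.
  by have := H 0 1 ler01; rewrite subr0 mul1r; apply: le_trans; exact: sqr_ge0.
have H' a b : (F b - F a) ^+ 2 <= `|b - a| * K.
  have [ab|ab] := leP a b; first by rewrite ger0_norm ?subr_ge0//; exact: H.
  by rewrite distrC ger0_norm ?subr_ge0 ?(ltW ab)// -sqrrN opprB; exact/H/ltW.
move=> y; apply/cvgrPdist_lt => e e0.
have d0 : 0 < e ^+ 2 / (K + 1) by rewrite divr_gt0 ?exprn_gt0// ltr_wpDl.
near=> z; have zy : `|y - z| < e ^+ 2 / (K + 1) by near: z; exact: cvgr_dist_lt.
have : `|F y - F z| ^+ 2 < e ^+ 2.
  rewrite real_normK ?num_real//; apply: le_lt_trans (H' z y) _.
  apply: (@le_lt_trans _ _ (`|y - z| * (K + 1))); last by rewrite -ltr_pdivlMr// ltr_wpDl.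
  by rewrite ler_wpM2l// lerDl.
by rewrite ltr_pXn2r// nnegrE ltW.
Unshelve. all: by end_near. Qed.

Lemma continuous_primitive g : L2_on leb setT g -> continuous (primitive g).
Proof.
move=> g2; apply: (@continuous_sqr_bound _ (inner leb g g)) => a b ab.
exact: primitive_diff_sqr.
Qed.

Lemma primitive_diff_le g a b (D : set R) : L2_on leb setT g -> a <= b ->
  measurable (D : set mR) -> (forall y, 0 < y -> a <= y < b -> D y) ->
  ((`|primitive g b - primitive g a|)%:E <= \int[leb]_(y in D) `|g y|%:E)%E.
Proof.
move=> g2 ab mD abD; have [mg _] := g2; rewrite primitiveB//.
have ig := L2_mul_integrable g2 (L2_slab ab).
have -> : (`|inner leb g \1_(slab a b)|%:E = `|\int[leb]_y (g y * \1_(slab a b) y)%:E|)%E.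
  by rewrite -[in RHS](fineK (integrable_fin_num measurableT ig)).
apply: le_trans (le_abse_integral _ _ _) _ => //; first exact: (measurable_int leb).
rewrite [leRHS]integral_mkcond; apply: ge0_le_integral => //.
- by apply: measurableT_comp => //; exact: (measurable_int leb).
- by apply: (measurable_restrictT _ mD).1; apply: measurable_funTS; apply/measurable_EFinP; exact: measurableT_comp.
move=> y _; rewrite patchE indicE.
case: ifPn => [_|yD]; rewrite lee_fin; first by rewrite normrM ler_piMr// ger0_norm//; case: (_ \in _).
rewrite memNset ?mulr0 ?normr0//; move=> /slab_sub[y0 yab]; have yD' := abD y y0 yab.
by move: yD; rewrite notin_setE.
Qed.

End primitive.

(** * Level crossings and covering of an interval of values *)

Section crossing.
Context {R : realType}.
Implicit Types (F : R -> R) (p q a b : R).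

Lemma last_crossing F p q a : continuous F -> p <= q -> F p <= a <= F q ->
  exists r, [/\ p <= r <= q, F r = a & forall y, r < y <= q -> a < F y].
Proof.
move=> cF pq /andP[pa aq]; pose S := [set y | p <= y <= q /\ F y <= a].
have Sp : S p by split; rewrite ?lexx.
have ubS : ubound S q by move=> y [/andP[]].
have hS : has_sup S by split; [exists p|exists q].
set r := sup S.
have pr : p <= r by apply: ub_le_sup => //; exists q.
have rq : r <= q by apply: ge_sup => //; exists p.
have ra : F r <= a.
  rewrite leNgt; apply/negP => ar.
  have /nbhs_ballP[d /= d0 Hd] : \forall y \near r, a < F y.
    by have := cvgr_gt _ (cF r); apply.
  have [y [/andP[py yq] ya] yr] := sup_adherent d0 hS.
  have : a < F y; last by rewrite ltNge ya.
  apply: Hd; rewrite /ball /= -/r ger0_norm; last by rewrite subr_ge0; apply: ub_le_sup => //; [exists q|split; rewrite ?py].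
  by move: yr; rewrite -/r; lra.
have far y : r < y <= q -> a < F y.
  move=> /andP[ry yq]; rewrite ltNge; apply/negP => ya.
  have : y <= r by apply: ub_le_sup; [exists q|split => //; rewrite yq andbT; lra].
  lra.
exists r; split=> //; first by rewrite pr.
apply/eqP; rewrite eq_le ra /= leNgt; apply/negP => ra'.
have [c] : exists2 c, c \in `[r, q] & F c = a.
  apply: IVT => //; first exact: continuous_subspaceT.
  by rewrite ge_min (ltW ra') /= le_max aq orbT.
rewrite in_itv /= => /andP[rc cq] Fc; have [rc'|cr] := ltP r c.
  by have := far c; rewrite rc' cq Fc ltxx => /(_ isT).
by move: ra'; rewrite -Fc (_ : c = r) ?ltxx//; apply/eqP; rewrite eq_le cr.
Qed.

(** Between the last crossing of a and the first crossing of b after it, the values stay in [a, b].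
    A first crossing is a last crossing for y -> - F (- y). *)
Lemma crossing_interval F p q a b : continuous F -> p <= q -> a <= b ->
  F p <= a -> b <= F q -> exists p' q', [/\ p <= p', p' <= q' & q' <= q] /\
    [/\ F p' = a, F q' = b & forall y, p' <= y <= q' -> a <= F y <= b].
Proof.
move=> cF pq ab pa bq.
have [r [/andP[pr rq] Fr far]] : exists r, [/\ p <= r <= q, F r = a &
    forall y, r < y <= q -> a < F y].
  by apply: last_crossing => //; rewrite pa (le_trans ab bq).
have cF' : continuous (fun y => - F (- y)).
  move=> y; apply: continuousN; apply: continuous_comp; last exact: cF.
  exact: opp_continuous.
have [s [/andP[qs sr] Fs fas]] : exists s, [/\ - q <= s <= - r, - F (- s) = - b &
    forall y, s < y <= - r -> - b < - F (- y)].
  by apply: last_crossing => //; rewrite ?lerN2// !opprK bq Fr.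
exists r, (- s); split; first by split=> //; lra.
have Fs' : F (- s) = b by apply: oppr_inj.
split=> // y /andP[ry ys]; apply/andP; split.
  have [->|yr] := eqVneq y r; first by rewrite Fr.
  by apply/ltW/far; rewrite lt_neqAle eq_sym yr ry /=; lra.
have [->|ys'] := eqVneq y (- s); first by rewrite Fs'.
have := fas (- y); rewrite opprK ltrN2 => H; apply/ltW/H.
by rewrite lerN2 ry andbT ltrNr lt_neqAle ys'.
Qed.

(** Only points with values strictly between s and t may be charged. So the increment is taken on a
    subinterval where F stays between its end values; if q precedes p, the same is done with - F. *)
Lemma primitive_oscillation (T : R) (g : R -> R) (D : set R) p q s t :
  L2_on lebesgue_measure setT g -> let F y := T + primitive g y in
  measurable (D : set (measurableTypeR R)) ->
  (forall y, 0 < y -> Num.min p q <= y < Num.max p q -> s < F y < t -> D y) ->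
  s < F p -> F p <= F q -> F q < t ->
  ((F q - F p)%:E <= \int[lebesgue_measure]_(y in D) `|g y|%:E)%E.
Proof.
move=> g2 F mD HD sp pq qt.
have cF : continuous F.
  by move=> y; apply: continuousD; [exact: cst_continuous|exact: continuous_primitive].
have [pleq|qltp] := leP p q.
  have [p' [q' [[pp' p'q' q'q] [Fp Fq Fy]]]] := crossing_interval cF pleq pq (lexx _) (lexx _).
  rewrite -Fp -Fq; apply: le_trans (primitive_diff_le g2 p'q' mD _).
    by rewrite lee_fin /F opprD addrACA subrr add0r ler_norm.
  move=> y y0 /andP[y1 y2]; apply: HD => //.
    by rewrite ge_min lt_max (le_trans pp' y1) (lt_le_trans y2 q'q) orbT.
  have := Fy y; rewrite y1 (ltW y2) => /(_ isT) /andP[y3 y4].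
  by rewrite (lt_le_trans sp y3) (le_lt_trans y4 qt).
have cNF : continuous (fun y => - F y) by move=> y; apply: continuousN; exact: cF.
have [p' [q' [[pp' p'q' q'q] [Fp Fq Fy]]]] : exists p' q',
    [/\ q <= p', p' <= q' & q' <= p] /\ [/\ - F p' = - F q, - F q' = - F p &
    forall y, p' <= y <= q' -> - F q <= - F y <= - F p].
  by apply: crossing_interval => //; [exact: ltW|rewrite lerN2].
move: Fp Fq => /oppr_inj Fp /oppr_inj Fq.
rewrite -Fp -Fq; apply: le_trans (primitive_diff_le g2 p'q' mD _).
  by rewrite lee_fin /F opprD addrACA subrr add0r distrC ler_norm.
move=> y y0 /andP[y1 y2]; apply: HD => //.
  by rewrite ge_min lt_max (le_trans pp' y1) (lt_le_trans y2 q'q) orbT.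
have := Fy y; rewrite y1 (ltW y2) !lerN2 => /(_ isT) /andP[y3 y4].
by rewrite (lt_le_trans sp y4) (le_lt_trans y3 qt).
Qed.

(** The hulls of the sets [A n] have lengths at most [K n] and cover ]s, t[, so countable
    subadditivity of the Lebesgue measure bounds t - s. For a graph, [A n] will be a set of values
    taken on one edge. *)
Lemma cover_diameter (s t : R) (A : nat -> set R) (K : nat -> \bar R) :
  (forall n a b, A n a -> A n b -> ((b - a)%:E <= K n)%E) ->
  (forall n, (0 <= K n)%E) -> (forall c, s < c < t -> exists n, A n c) ->
  ((t - s)%:E <= \sum_(n <oo) K n)%E.
Proof.
move=> AK K0 cov; have [ts|st] := leP t s.
  by apply: (@le_trans _ _ 0%E); [rewrite lee_fin; lra|exact: nneseries_ge0].
(* When [K n] is infinite nothing bounds [A n], and the whole line is used; otherwise [A n] is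
   bounded and its infimum and supremum are meaningful. *)
pose J n : set R := if K n is r%:E%E then
  if A n != set0 then `[inf (A n), sup (A n)]%classic else set0 else setT.
have bnd n a r : K n = r%:E -> A n a -> forall b, A n b -> a - r <= b <= a + r.
  move=> Kr Aa b Ab; have := AK n a b Aa Ab; have := AK n b a Ab Aa.
  by rewrite Kr !lee_fin; lra.
have mJ n : measurable (J n : set (measurableTypeR R)).
  rewrite /J; by case: (K n) => [r| |] //; case: ifP.
have KJ n : (lebesgue_measure (J n) <= K n)%E.
  rewrite /J; case Kr : (K n) (K0 n) => [r| |] // r0; last by rewrite leey.
  case: ifPn => [/set0P[a Aa]|_]; last by rewrite measure0.
  have r0' : 0 <= r by rewrite -lee_fin.
  rewrite lebesgue_itvcc lee_fin ge_max r0' andbT.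
  have -> : sup (A n) - inf (A n) <= r; last by [].
  rewrite lerBlDr; apply: ge_sup; first by exists a.
  move=> b Ab; rewrite -lerBlDl; apply: lb_le_inf; first by exists a.
  by move=> c Ac; have /andP[] := bnd n c r Kr Ac b Ab; lra.
have lst : lebesgue_measure (`]s, t[%classic : set R) = (t - s)%:E.
  by rewrite lebesgue_measure_itv /= lte_fin st.
rewrite -lst; apply: (@le_trans _ _ (\sum_(n <oo) lebesgue_measure (J n))%E); last first.
  by apply: lee_nneseries.
apply: measure_sigma_subadditive => // c /=; rewrite in_itv /= => /cov[n Anc]; exists n => //.
rewrite /J; case Kr : (K n) => [r| |]//.
rewrite (_ : A n != set0); last by apply/set0P; exists c.
rewrite /= in_itv /=; apply/andP; split.
  by apply: ge_inf => //; exists (c - r) => b /(bnd n c r Kr Anc) /andP[].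
by apply: ub_le_sup => //; exists (c + r) => b /(bnd n c r Kr Anc) /andP[].
Qed.

End crossing.

Lemma measurable_edge_interior (R : realType) (G : metric_graph R) (e : edge G) :
  measurable (edge_interior e : set (measurableTypeR R)).
Proof.
have -> : edge_interior e = [set y | (0 < y) && (y%:E < elen e)%E].
  by apply/seteqP; split => y /=; [case=> -> ->|move/andP].
apply: measurable_set_bool; apply: measurable_and; first exact: measurable_fun_ltr.
by apply: measurable_fun_lte => //; exact/measurable_EFinP.
Qed.

Lemma lebesgue_edge_interior (R : realType) (G : metric_graph R) (e : edge G) :
  lebesgue_measure (edge_interior e) = elen e.
Proof.
have := elen_gt0 e; rewrite /edge_interior; case: (elen e) => [l| |]// l0.
  have -> : [set y : R | 0 < y /\ (y%:E < l%:E)%E] = `]0, l[%classic.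
    by apply/seteqP; split => y /=; rewrite in_itv /= lte_fin; [case=> -> ->|move/andP].
  by rewrite lebesgue_itvoo subr0 max_l// -lee_fin ltW.
have -> : [set y : R | 0 < y /\ (y%:E < +oo)%E] = `]0, +oo[%classic.
  by apply/seteqP; split => y /=; rewrite in_itv /= andbT ltry; [case|].
have -> : lebesgue_measure (`]0, +oo[%classic : set R) = (if (0%:E < +oo :> \bar R)%E then +oo - 0 else 0)%E.
  exact: lebesgue_measure_itv.
by rewrite ltry oppe0 adde0.
Qed.

(** Cauchy-Schwarz against the indicator of S, where the integral of f^2 is allowed to be
    infinite. *)
Lemma sqr_le_integral d (Y : measurableType d) (R : realType)
    (m : {measure set Y -> \bar R}) (f : Y -> R) (S : set Y) (x d' : R) :
  measurable S -> measurable_fun setT f -> 0 <= x -> 0 < d' ->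
  (x%:E <= \int[m]_(z in S) `|f z|%:E)%E -> (m S <= d'%:E)%E ->
  ((x ^+ 2)%:E <= d'%:E * \int[m]_(z in S) (f z ^+ 2)%:E)%E.
Proof.
move=> mS mf x0 d0 xI mSd; set J := (\int[m]_(z in S) (f z ^+ 2)%:E)%E.
have J0 : (0 <= J)%E by apply: integral_ge0 => z _; rewrite lee_fin sqr_ge0.
have [Joo|] := eqVneq J +oo%E; first by rewrite Joo gt0_muley ?lte_fin// leey.
rewrite -ltey => Joo.
have i2 z : (\1_S z : R) ^+ 2 = \1_S z.
  by rewrite indicE; case: (_ \in _); rewrite ?expr1n ?expr0n.
pose a z := `|f z| * \1_S z.
have EJ : (\int[m]_z (a z ^+ 2)%:E = J)%E.
  rewrite /J [RHS]integral_mkcond; apply: eq_integral => z _.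
  rewrite patchE /a exprMn i2 indicE real_normK ?num_real//.
  by case: (_ \in _); rewrite ?mulr1 ?mulr0.
have a2 : L2_on m setT a.
  split; last by rewrite EJ.
  by apply: measurable_funM; [exact: measurableT_comp|exact: measurable_indic].
have E1 : (\int[m]_z ((\1_S z : R) ^+ 2)%:E = m S)%E.
  by under eq_integral do rewrite i2; rewrite integral_indic// setIT.
have I2 : L2_on m setT (\1_S : Y -> R).
  split; first exact: measurable_indic.
  by rewrite E1 (le_lt_trans mSd) ?ltry.
have EI : (\int[m]_(z in S) `|f z|%:E = (inner m a \1_S)%:E)%E.
  rewrite /inner /Rintegral fineK; last first.
    exact: (integrable_fin_num measurableT (L2_mul_integrable a2 I2)).
  rewrite integral_mkcond; apply: eq_integral => z _.
  rewrite patchE /a -mulrA -expr2 i2 indicE.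
  by case: (_ \in _); rewrite ?mulr1 ?mulr0.
rewrite EI lee_fin in xI.
rewrite -EJ L2_sqE// -EFinM lee_fin.
apply: (@le_trans _ _ (inner m a \1_S ^+ 2)).
  by rewrite lerXn2r// ?nnegrE// (le_trans x0).
apply: le_trans (inner_cauchy_schwarz a2 I2) _.
rewrite mulrC ler_wpM2r ?inner_ge0//.
by rewrite -lee_fin -L2_sqE// E1.
Qed.

(** * Oscillation of a function on a connected graph *)

Section graph_profile.
Context {R : realType} (G : metric_graph R).
Hypothesis G_connected : graph_connected G.
Variables (T : vertex G -> R) (g : edge G -> R -> R).
Local Notation leb := (@lebesgue_measure R).
Local Notation mR := (measurableTypeR R).
Local Notation nu := (sf_product (@counting nat R) leb).
Hypothesis g2 : forall e, L2_on leb setT (g e).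

(** [T] gives the vertex values and [g] the slopes. Continuity at the origin of each edge is built
    into the formula; at the terminus it is the hypothesis [FT]. *)
Definition edge_profile (e : edge G) (y : R) := T (origin e) + primitive (g e) y.
Local Notation F := edge_profile.

Hypothesis FT : forall e w, terminus e = Some w -> F e (fine (elen e)) = T w.

Definition graph_profile (p : nat * R) : R :=
  glue (fun e => F e \_ (edge_interior e)) p.1 p.2.
Definition graph_slope (p : nat * R) : R :=
  glue (fun e => g e \_ (edge_interior e)) p.1 p.2.

Let cF e : continuous (F e).
Proof. by move=> y; apply: continuousD; [exact: cst_continuous|exact: continuous_primitive]. Qed.

Let F0 e : F e 0 = T (origin e).
Proof.
rewrite /F /primitive (_ : \1_`]0, 0[ = fun=> 0 : R); last first.
  by apply/funext => y; rewrite set_itvoo0 indic0.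
rewrite /inner /Rintegral (eq_integral (cst 0%E)) ?integral0 ?addr0//.
by move=> y _; rewrite mulr0.
Qed.

Let on_edge (e : edge G) (y : R) := (0 <= y) && (y%:E <= elen e)%E.

Let attain (f : R -> R) p q c : continuous f -> f p <= c <= f q ->
  exists2 y, Num.min p q <= y <= Num.max p q & f y = c.
Proof.
move=> cf /andP[pc cq].
have [y] : exists2 y, y \in `[Num.min p q, Num.max p q] & f y = c.
  apply: IVT; [by rewrite ge_min le_max lexx|exact: continuous_subspaceT|].
  by case: (leP p q) => _; rewrite ge_min le_max pc cq ?orbT.
by rewrite in_itv; exists y.
Qed.

(** If c is never attained, the side of c on which the profile lies is constant on each closed edge,
    hence the same at adjacent vertices, hence at all vertices by connectedness. *)
Lemma level_attained (c : R) e1 y1 e2 y2 : on_edge e1 y1 -> c < F e1 y1 ->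
  on_edge e2 y2 -> F e2 y2 < c -> exists e y, on_edge e y /\ F e y = c.
Proof.
move=> p1 c1 p2 c2; apply: contrapT => N.
have sgn e p q : on_edge e p -> on_edge e q -> c < F e p -> c < F e q.
  move=> op oq cp; rewrite ltNge; apply/negP => qc.
  have [y /andP[ym yM] Fy] := attain (@cF e) (ltac:(by rewrite qc ltW) : F e q <= c <= F e p).
  apply: N; exists e, y; split => //; apply/andP.
  move: op oq ym yM => /andP[p0 pl] /andP[q0 ql].
  rewrite ge_min le_max => /orP H1 /orP H2; split.
    by case: H1; exact: le_trans.
  case: H2 => H2; [apply: le_trans ql|apply: le_trans pl]; rewrite lee_fin//.
have on0 e : on_edge e 0 by rewrite /on_edge lexx ltW// elen_gt0.
have adj v w : Defs.adjacent v w -> c < T v <-> c < T w.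
  move=> [e [<- ew]].
  have efin : elen e \is a fin_num.
    rewrite ge0_fin_numE ?(ltW (elen_gt0 e))// lt_neqAle leey andbT.
    by rewrite -terminus_None ew.
  have onl : on_edge e (fine (elen e)).
    by rewrite /on_edge fineK// lexx andbT -lee_fin fineK// ltW// elen_gt0.
  by rewrite -(FT ew) -F0; split; exact: sgn.
have inv v w : c < T v <-> c < T w.
  elim: (G_connected v w) => [x y|x|x y _|x y z _ xy _ yz] //; first exact: adj.
    by move=> ->.
  by rewrite xy.
have : c < F e2 y2.
  by apply: (@sgn e2 0) => //; rewrite F0; apply/(inv (origin e1)); rewrite -F0; exact: (@sgn e1 y1).
by rewrite ltNge (ltW c2).
Qed.

Let mF e : measurable_fun setT (F e \_ (edge_interior e) : mR -> R).
Proof.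
apply: (measurable_restrictT _ (measurable_edge_interior e)).1.
by apply: measurable_funTS; exact: continuous_measurable_fun.
Qed.

Let mg e : measurable_fun setT (g e \_ (edge_interior e) : mR -> R).
Proof.
apply: (measurable_restrictT _ (measurable_edge_interior e)).1.
by apply: measurable_funTS; have [] := g2 e.
Qed.

Lemma measurable_graph_profile :
  measurable_fun setT (graph_profile : (nat * mR)%type -> R).
Proof. exact: measurable_glue. Qed.

Lemma measurable_graph_slope :
  measurable_fun setT (graph_slope : (nat * mR)%type -> R).
Proof. exact: measurable_glue. Qed.

Let interior_on_edge (e : edge G) y : edge_interior e y -> on_edge e y.
Proof. by move=> [y0 yl]; rewrite /on_edge !ltW. Qed.

Let profile_gt (c : R) : 0 <= c -> (0 < distr nu graph_profile c)%E ->
  exists e y, on_edge e y /\ c < F e y.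
Proof.
move=> c0; apply: contraPP => N; rewrite /distr.
rewrite (_ : [set _ | _] = set0) ?measure0 ?ltxx//.
apply/seteqP; split => -[n y] //=; rewrite /graph_profile /glue /=.
case: pickle_inv => [e|]; last by rewrite ltNge c0.
rewrite patchE; case: ifPn => [|_]; last by rewrite ltNge c0.
by rewrite inE => ey cFe; apply: N; exists e, y; split => //; exact: interior_on_edge.
Qed.

(** If all values were at least c, the set {f > s} would contain the interior of every edge and its
    measure would be at least the total length. *)
Let profile_lt (s c : R) : s < c -> 0 <= s -> (distr nu graph_profile s < total_length G)%E ->
  exists e y, on_edge e y /\ F e y < c.
Proof.
move=> sc s0; apply: contraPP => N; apply/negP; rewrite -leNgt.
pose D : set (nat * mR) := [set p | s < graph_profile p].
have mD : measurable D by exact: measurable_gt measurable_graph_profile.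
have -> : distr nu graph_profile s =
    (\esum_(e in [set: edge G]) leb [set y | D (pickle e, y)])%E.
  apply: (@sf_product_glue R (edge G) _ _ leb D mD) => n y.
  rewrite /D /= /graph_profile /glue; case: pickle_inv => //=.
  by rewrite ltNge s0.
apply: le_esum => e _; rewrite -lebesgue_edge_interior; apply: le_measure; rewrite ?inE.
- exact: measurable_edge_interior.
- have := measurable_xsection (pickle e) mD; congr measurable.
  by apply/seteqP; split => y; rewrite /xsection /= inE.
move=> y ey; rewrite /D /= /graph_profile /= glue_pickle patchE mem_set//.
apply: lt_le_trans sc _; rewrite leNgt; apply/negP => Fc.
by apply: N; exists e, y; split => //; exact: interior_on_edge.
Qed.

(** Every level strictly between s and c is attained on some edge, and on one edge such values span
    at most the integral of |g| over the points where they are taken; [cover_diameter] adds up the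
    edges. *)
Let profile_oscillation (s c : R) : 0 <= s -> s < c ->
  (0 < distr nu graph_profile c)%E -> (distr nu graph_profile s < total_length G)%E ->
  ((c - s)%:E <= \int[nu]_(p in [set p | (s < graph_profile p < c)%R]) `|graph_slope p|%:E)%E.
Proof.
move=> s0 sc dc ds; set S := [set p | _].
pose D e : set R := edge_interior e `&` [set y | s < F e y < c].
have mD e : measurable (D e : set mR).
  apply: measurableI; first exact: measurable_edge_interior.
  by apply: measurable_set_bool; apply: measurable_and; apply: measurable_fun_ltr => //;
    exact: continuous_measurable_fun.
have mS : measurable (S : set (nat * mR)).
  by apply: measurable_set_bool; apply: measurable_and; apply: measurable_fun_ltr => //;
    exact: measurable_graph_profile.
have -> : (\int[nu]_(p in S) `|graph_slope p|%:E =
    \sum_(n <oo) if pickle_inv n is Some e then \int[leb]_(y in D e) `|g e y|%:E else 0)%E.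
  rewrite -esum_pickle; last by move=> e; apply: integral_ge0.
  rewrite integral_mkcond.
  transitivity (\esum_(e in [set: edge G]) \int[leb]_y (`|(g e \_ (D e)) y|)%:E)%E; last first.
    apply: eq_esum => e _; rewrite [RHS]integral_mkcond; apply: eq_integral => y _.
    by rewrite !patchE; case: ifP => // _; rewrite normr0.
  rewrite -(@integral_glue R (edge G) _ _ leb (fun e y => `|(g e \_ (D e)) y|)); last 2 first.
  - move=> e; apply: measurableT_comp => //.
    apply: (measurable_restrictT _ (mD e)).1.
    by apply: measurable_funTS; have [] := g2 e.
  - by [].
  apply: eq_integral => -[n y] _; rewrite patchE /= /graph_slope /glue /S /graph_profile /glue.
  case EQ : (pickle_inv n) => [e|] /=; last first.
    by case: ifP => // _; rewrite normr0.
  rewrite !patchE; have [ey|ey] := boolP (y \in edge_interior e).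
    have -> : (y \in D e) = ((n, y) \in S).
      apply/idP/idP; rewrite !inE /S /D /= /graph_profile /glue /= EQ patchE ey.
        by case.
      by move=> ?; split => //; rewrite inE in ey.
    by case: ifP => // _; rewrite normr0.
  have -> : (y \in D e) = false.
    by apply/negbTE; move: ey; rewrite !notin_setE => ey [].
  by case: ifP => // _; exact: (congr1 EFin (esym (normr0 _))).
have [e1 [y1 [p1 c1]]] := profile_gt (le_trans s0 (ltW sc)) dc.
(* The values in ]s, c[ taken on the closed edge number n. *)
pose A n : set R := if @pickle_inv (edge G) n is Some e then
  [set r | s < r < c /\ exists2 y, on_edge e y & F e y = r] else set0.
apply: (@cover_diameter _ _ _ A).
- move=> n a b; rewrite /A; case: pickle_inv => // e.
  move=> [/andP[sa ac] [p op Fp]] [/andP[sb bc] [q oq Fq]].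
  have [ab|ba] := leP a b; last first.
    by apply: (@le_trans _ _ 0%E); [rewrite lee_fin subr_le0 ltW|exact: integral_ge0].
  rewrite -Fp -Fq; apply: (@primitive_oscillation _ (T (origin e)) (g e) (D e) p q s c) => //;
    rewrite -?/(F e p) -?/(F e q) ?Fp ?Fq//.
  move=> y y0; rewrite ge_min lt_max => /andP[_ ypq] sFc; split => //; split => //.
  by move: op oq => /andP[_ pl] /andP[_ ql]; case/orP: ypq => yp;
    [apply: lt_le_trans pl|apply: lt_le_trans ql]; rewrite lte_fin.
- by move=> n; case: pickle_inv => // e; apply: integral_ge0.
move=> r /andP[sr rc].
have [e2 [y2 [p2 c2]]] := profile_lt sr s0 ds.
have [e [y [pe Fe]]] := level_attained p1 (lt_trans rc c1) p2 c2.
exists (pickle e); rewrite /A pickleK_inv; split; first by rewrite sr.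
by exists y.
Qed.

(** At a level c strictly below t = f*(a) one has [distr c] > a, which gives both a point above c
    and the bound b - a for the measure of {s < f < c}, since [distr s] <= b. At t itself the strict
    inequality fails, so the estimate is proved for c < t and extended by approximation. *)
Lemma graph_profile_modulus (a b : R) : vanishing nu graph_profile ->
  0 < a -> a < b -> (b%:E < total_length G)%E ->
  (((rearr nu graph_profile a - rearr nu graph_profile b) ^+ 2)%:E <=
   (b - a)%:E * \int[nu]_(p in [set p |
      (rearr nu graph_profile b < graph_profile p < rearr nu graph_profile a)%R])
     (graph_slope p ^+ 2)%:E)%E.
Proof.
move=> vf a0 ab bl; have b0 : 0 < b := lt_trans a0 ab.
set s := rearr nu graph_profile b; set t := rearr nu graph_profile a.
have mf := measurable_graph_profile; have ba : 0 < b - a by rewrite subr_gt0.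
have s0 : 0 <= s by exact: rearr_ge0.
have ds : (distr nu graph_profile s <= b%:E)%E.
  by have : s < s = false := ltxx _; rewrite {2}/s rearr_gtE// => /negbT; rewrite -leNgt.
have mSet c : measurable ([set p | s < graph_profile p < c] : set (nat * mR)).
  by apply: measurable_set_bool; apply: measurable_and; apply: measurable_fun_ltr.
have key (c : R) : s < c -> c < t -> (((c - s) ^+ 2)%:E <=
    (b - a)%:E * \int[nu]_(p in [set p | (s < graph_profile p < t)%R]) (graph_slope p ^+ 2)%:E)%E.
  move=> sc ct; have c0 : 0 <= c by rewrite (le_trans s0)// ltW.
  move: (ct); rewrite rearr_gtE// => dc.
  apply: (@le_trans _ _ ((b - a)%:E * \int[nu]_(p in [set p | (s < graph_profile p < c)%R]) (graph_slope p ^+ 2)%:E)%E); last first.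
    apply: lee_wpmul2l; first by rewrite lee_fin ltW.
    apply: ge0_subset_integral => //.
    - apply/measurable_EFinP/measurable_funTS/measurable_funX.
      exact: measurable_graph_slope.
    - by move=> p _; rewrite lee_fin sqr_ge0.
    - by move=> p /= /andP[-> pc]; exact: lt_trans pc ct.
  apply: sqr_le_integral => //.
  - exact: measurable_graph_slope.
  - by rewrite subr_ge0 ltW.
  - apply: profile_oscillation => //.
      by apply: lt_trans dc; rewrite lte_fin.
    exact: le_lt_trans ds bl.
  have mC : measurable ([set p | c < graph_profile p] : set (nat * mR)) by exact: measurable_gt.
  have : (nu [set p | (s < graph_profile p < c)%R] + distr nu graph_profile c <= distr nu graph_profile s)%E.
    rewrite /distr -measureU//.
      apply: le_measure; rewrite ?inE.
      - exact: measurableU.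
      - exact: measurable_gt.
      - by move=> p [/andP[]//|/=]; exact: lt_trans.
    apply/seteqP; split => p //= [/andP[_ pc] cp].
    by move: (lt_trans pc cp); rewrite ltxx.
  move=> H; have H2 : (nu [set p | (s < graph_profile p < c)%R] + a%:E <= b%:E)%E.
    apply: le_trans ds; apply: le_trans H; exact: leeD2l (ltW dc).
  by rewrite EFinB leeBrDr.
(* Monotonicity of the rearrangement leaves only t = s here, where the left-hand side is 0. *)
have [ts|st] := leP t s.
  have -> : t = s.
    apply/eqP; rewrite eq_le ts /= leNgt; apply/negP => ts'.
    have t0 : 0 <= t by exact: rearr_ge0.
    move: (ts'); rewrite /s rearr_gtE// => bt.
    have : t < t = false := ltxx _; rewrite {2}/t rearr_gtE// => /negbT; rewrite -leNgt => ta.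
    by move: (lt_le_trans bt ta); rewrite lte_fin ltNge (ltW ab).
  rewrite subrr expr0n mule_ge0 ?lee_fin ?(ltW ba)//.
  by apply: integral_ge0 => p _; rewrite lee_fin sqr_ge0.
set M := (_ * _)%E in key *.
have M0 : (0 <= M)%E.
  rewrite mule_ge0 ?lee_fin ?(ltW ba)//.
  by apply: integral_ge0 => p _; rewrite lee_fin sqr_ge0.
case: M M0 key => [m| |]// m0 key; last by rewrite leey.
rewrite lee_fin in m0.
rewrite lee_fin leNgt; apply/negP => mts.
have qs : Num.sqrt m < t - s.
  by rewrite -(@ltr_pXn2r _ 2)// ?nnegrE ?sqrtr_ge0 ?subr_ge0 ?(ltW st)// sqr_sqrtr.
have q0 := sqrtr_ge0 m.
(* This level lies at a distance from s halfway between [Num.sqrt m] and t - s: it is still below t,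
   yet the square of its distance to s exceeds m. *)
have := key (s + (Num.sqrt m + (t - s)) / 2) (ltac:(by lra)) (ltac:(by lra)).
rewrite lee_fin addrC addKr leNgt => /negP; apply.
rewrite -{1}(sqr_sqrtr m0) ltr_pXn2r// ?nnegrE//; lra.
Qed.

End graph_profile.

(** * Slices and traces *)

Section almost_everywhere_tools.
Context (R : realType).

Lemma ae_preimage d (T : measurableType d) (m : {measure set T -> \bar R}) (phi : T -> T)
    (Q : T -> Prop) :
  (forall A, measurable A -> m (phi @^-1` A) = m A) -> measurable_fun setT phi ->
  {ae m, forall z, Q z} -> {ae m, forall z, Q (phi z)}.
Proof.
move=> mphi phim [A [mA A0 QA]]; exists (phi @^-1` A); split.
- by rewrite -[X in measurable X]setTI; exact: phim.
- by rewrite mphi.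
by move=> z /= Qz; exact: QA.
Qed.

Lemma ae_ge0_integral_eq0 d (T : measurableType d) (m : {measure set T -> \bar R})
    (D : set T) (f : T -> R) : measurable D -> measurable_fun D f ->
  (forall z, 0 <= f z) -> (\int[m]_(z in D) (f z)%:E = 0)%E ->
  {ae m, forall z, D z -> f z = 0}.
Proof.
move=> mD mf f0 If; have mfE : measurable_fun D (EFin \o f) by exact/measurable_EFinP.
have /(ae_eq_integral_abs m mD mfE) : (\int[m]_(z in D) `|(EFin \o f) z| = 0)%E.
  by rewrite -[RHS]If; apply: eq_integral => z _; rewrite /= ger0_norm.
by apply: ae_impl => z H Dz; apply: EFin_inj; exact: H.
Qed.

Context d1 d2 (T1 : measurableType d1) (T2 : measurableType d2).
Variables (m1 : {sigma_finite_measure set T1 -> \bar R})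
  (m2 : {sigma_finite_measure set T2 -> \bar R}).

Lemma ae_section (P : T1 * T2 -> Prop) : {ae (m1 \x m2)%E, forall z, P z} ->
  {ae m1, forall x, {ae m2, forall y, P (x, y)}}.
Proof.
move=> [A [mA A0 PA]].
have mx := measurable_fun_xsection m2 mA.
have /(ae_eq_integral_abs m1 measurableT mx) : (\int[m1]_x `|m2 (xsection A x)| = 0)%E.
  by rewrite -[RHS]A0; apply: eq_integral => x _; rewrite gee0_abs.
apply: ae_impl => x /(_ I) Ax; exists (xsection A x); split => //.
  exact: measurable_xsection.
by move=> y /= Py; rewrite /xsection /= inE; exact: PA.
Qed.

Lemma ae_fst (P : T1 -> Prop) : {ae m1, forall x, P x} ->
  {ae (m1 \x m2)%E, forall z, P z.1}.
Proof.
move=> [A [mA A0 PA]]; exists (A `*` setT); split.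
- exact: measurableX.
- have -> : (m1 \x m2)%E (A `*` setT) = (m1 A * m2 setT)%E by exact: product_measure1E.
  by rewrite A0 mul0e.
by move=> z /= Pz; split => //; exact: PA.
Qed.

End almost_everywhere_tools.

(** * Reflection in the last coordinate *)

Section reflection.
Context {R : realType} {N : nat}.
Local Notation mR := (measurableTypeR R).
Local Notation mV := ('rV[R]_N * measurableTypeR R)%type.
Local Notation mu := (@lebesgue_prod R N).
Local Notation leb := (@lebesgue_measure R).

Let mrefl (l : R) : measurable_fun setT ((fun x : mR => l - x) : mR -> mR).
Proof. by apply: measurable_funB => //; exact: measurable_cst. Qed.

Lemma lebesgue_measure_reflect (l : R) (A : set R) : measurable (A : set mR) ->
  leb ((fun x => l - x) @^-1` A) = leb A.
Proof.
move=> mA; apply/esym.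
apply: (@lebesgue_measure_unique R (pushforward leb ((fun x : mR => l - x) : mR -> mR)))
  => // _ [[a b]] _ <-.
rewrite /pushforward.
transitivity (leb (`[l - b, l - a[%classic : set R)); last first.
  congr (leb _); by apply/seteqP; split => x /=; rewrite !in_itv /= => /andP[? ?]; apply/andP; split; lra.
rewrite lebesgue_itvco lebesgue_measure_itv /= lte_fin.
case: ltP => ab; first by rewrite max_l -?EFinB; [congr EFin; ring|lra].
by rewrite max_r//; lra.
Qed.

Lemma ge0_integral_reflect (l : R) (F : R -> \bar R) :
  measurable_fun setT (F : mR -> \bar R) -> (forall x, (0 <= F x)%E) ->
  (\int[leb]_x F (l - x)%R = \int[leb]_x F x)%E.
Proof.
move=> mF F0; rewrite -[LHS](@ge0_integral_pushforward _ _ _ _ R _ (mrefl l) leb setT F)//.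
by apply: eq_measure_integral => A mA _; exact: lebesgue_measure_reflect.
Qed.

Definition reflect_y (l : R) (z : 'rV[R]_N * R) : 'rV[R]_N * R := (z.1, l - z.2).

Lemma measurable_reflect_y (l : R) : measurable_fun setT (reflect_y l : mV -> mV).
Proof.
apply: measurable_fun_pair => //.
by apply: measurable_funB => //; exact: measurable_cst.
Qed.

Lemma ge0_integral_reflect_y (l : R) (F : mV -> \bar R) :
  measurable_fun setT F -> (forall z, (0 <= F z)%E) ->
  (\int[mu]_z F (reflect_y l z) = \int[mu]_z F z)%E.
Proof.
move=> mF F0.
have mFr : measurable_fun setT (fun z : mV => F (reflect_y l z)).
  by apply: (measurableT_comp mF); exact: measurable_reflect_y.
rewrite /lebesgue_prod (fubini_tonelli1 _ mF F0) (fubini_tonelli1 _ mFr (fun=> F0 _)).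
apply: eq_integral => x _; apply: (ge0_integral_reflect l) => //.
exact: (measurable_fun_pair2 x mF).
Qed.

Lemma lebesgue_prod_reflect_y (l : R) (A : set mV) : measurable A ->
  mu (reflect_y l @^-1` A) = mu A.
Proof.
move=> mA.
have mA' : measurable (reflect_y l @^-1` A : set mV).
  by rewrite -[X in measurable X]setTI; exact: measurable_reflect_y.
rewrite -[in RHS](setIT A) -integral_indic//.
rewrite -(ge0_integral_reflect_y l); last 2 first.
- by apply/measurable_EFinP; exact: measurable_indic.
- by move=> z; rewrite lee_fin.
by rewrite -[X in mu X]setIT -integral_indic.
Qed.

End reflection.

Section primitive_shift.
Context {R : realType}.
Local Notation leb := (@lebesgue_measure R).
Local Notation mR := (measurableTypeR R).

Lemma primitive0 (g : R -> R) : primitive g 0 = 0.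
Proof.
rewrite /primitive (_ : \1_`]0, 0[ = fun=> 0 : R); last first.
  by apply/funext => y; rewrite set_itvoo0 indic0.
by rewrite /inner /Rintegral (eq_integral (cst 0%E)) ?integral0// => y _; rewrite mulr0.
Qed.

Lemma primitive_sqr_le (g : R -> R) (y : R) : L2_on leb setT g -> 0 <= y ->
  primitive g y ^+ 2 <= y * inner leb g g.
Proof.
by move=> g2 y0; have := primitive_diff_sqr g2 y0; rewrite primitive0 !subr0.
Qed.

Lemma integral_shift (k : R -> \bar R) (a : R) : measurable_fun setT (k : mR -> \bar R) ->
  (\int[leb]_s k (s + a)%R = \int[leb]_s k s)%E.
Proof.
move=> mk; rewrite integralE [RHS]integralE.
rewrite -(ge0_integral_shift a (measurable_funepos mk) (funepos_ge0 k)).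
rewrite -(ge0_integral_shift a (measurable_funeneg mk) (funeneg_ge0 k)).
by congr (_ - _)%E; apply: eq_integral => s _; rewrite ?funeposE ?funenegE.
Qed.

Lemma primitive_shift (g : R -> R) (y h : R) : L2_on leb setT g -> 0 < y -> 0 < h ->
  \int[leb]_s (g (y + s) * \1_(`[0, h]%classic : set R) s) = primitive g (y + h) - primitive g y.
Proof.
move=> g2 y0 h0; have [mg _] := g2.
pose k s : R := g s * \1_(`[y, y + h]%classic : set R) s.
have mI (i : interval R) : measurable_fun setT (\1_([set` i] : set R) : mR -> R).
  exact: measurable_indic.
have mk : measurable_fun setT (k : mR -> R) by exact: measurable_funM.
rewrite /primitive (innerC leb g) (innerC leb g \1_`]0, y[) -innerBl//; try exact: L2_itvoo.
have mk' : measurable_fun setT (EFin \o k : mR -> \bar R) by exact/measurable_EFinP.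
transitivity (fine (\int[leb]_s (k s)%:E)).
  rewrite -(integral_shift y mk') /Rintegral; congr fine; apply: eq_integral => s _.
  rewrite /k /= [s + y]addrC !indicE; congr (_ * (nat_of_bool _)%:R)%:E.
  by apply/idP/idP => /set_mem /=; rewrite in_itv /= => ?; apply/mem_set; rewrite /= in_itv /=; lra.
rewrite /inner /Rintegral; congr fine; apply: ae_eq_integral => //.
  by apply/measurable_EFinP; apply: measurable_funM => //; exact: measurable_funB.
(* The closed interval of [line_average] and the half-open difference of the open intervals of
   [primitive] have indicators that differ at most at these two points. *)
exists [set y; y + h]; split.
- by apply: measurableU; exact: measurable_set1.
- by apply: countable_lebesgue_measure0; apply: finite_set_countable; exact: finite_set2.
move=> s /= Hs; apply: contrapT => N; apply: Hs => _.
rewrite /k mulrC; congr (_ * _)%:E; rewrite !indicE.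
have memE (i : interval R) : (s \in [set` i]) = (s \in i).
  by apply/idP/idP => [/set_mem|/mem_set].
rewrite !memE !in_itv /=.
have /eqP sy : s <> y by move=> E; apply: N; left.
have /eqP syh : s <> y + h by move=> E; apply: N; right.
rewrite !le_eqVlt (eq_sym y s) (negbTE sy) (negbTE syh) /=.
case: (ltP y s) => ys /=.
  have s0 : 0 < s by lra.
  rewrite s0 /= (_ : (s < y) = false) ?subr0//; apply/negbTE; rewrite -leNgt ltW//.
have sy' : s < y by rewrite lt_neqAle sy.
have syh' : s < y + h by lra.
by rewrite sy' syh' subrr.
Qed.

End primitive_shift.

Section slices.
Context {R : realType} {N : nat}.
Local Notation V := ('rV[R]_N * R)%type.
Local Notation mR := (measurableTypeR R).
Local Notation mV := ('rV[R]_N * measurableTypeR R)%type.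
Local Notation mu := (@lebesgue_prod R N).
Local Notation leb := (@lebesgue_measure R).
Local Notation lamX := (@lebesgue_rV R N).
Implicit Types (G : V -> R) (A : set R).

Lemma L2_slice G : L2_on mu setT G ->
  {ae lamX, forall x, L2_on leb setT (fun s => G (x, s))}.
Proof.
move=> G2; have [mG _] := G2.
have := @ae_integrable1 _ _ _ _ R lamX leb _ (L2_mul_integrable G2 G2).
apply: ae_impl => x /integrableP[_ xoo]; split; first exact: (measurable_fun_pair2 x mG).
apply: le_lt_trans xoo; rewrite le_eqVlt; apply/orP; left; apply/eqP.
by apply: eq_integral => s _; rewrite -expr2 gee0_abs// lee_fin sqr_ge0.
Qed.

Lemma measurable_slice_primitive G : measurable_fun setT (G : mV -> R) ->
  measurable_fun setT ((fun z => primitive (fun s => G (z.1, s)) z.2) : mV -> R).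
Proof.
move=> mG; pose A : set (mV * mR) := [set p | 0 < p.2 < p.1.2].
have m1 : measurable_fun setT (fun p : mV * mR => p.1.2).
  exact: (measurableT_comp measurable_snd measurable_fst).
have mA : measurable A.
  by apply: measurable_set_bool; apply: measurable_and; exact: measurable_fun_ltr.
pose K (p : mV * mR) : \bar R := (G (p.1.1, p.2) * \1_A p)%:E.
have mK : measurable_fun setT K.
  apply/measurable_EFinP; apply: measurable_funM; last exact: measurable_indic.
  apply: (measurableT_comp mG); apply: measurable_fun_pair => //.
  exact: (measurableT_comp measurable_fst measurable_fst).
have -> : (fun z => primitive (fun s => G (z.1, s)) z.2) = (fun z => fine (\int[leb]_s K (z, s))).
  by [].
apply: (measurableT_comp (fine_measurable _)) => //.
have -> : (fun z => \int[leb]_s K (z, s))%E =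
    (fun z => \int[leb]_s K^\+ (z, s) - \int[leb]_s K^\- (z, s))%E.
  apply/funext => z; rewrite integralE; congr (_ - _)%E; apply: eq_integral => s _.
    by rewrite !funeposE.
  by rewrite !funenegE.
apply: emeasurable_funB.
  exact: (@measurable_fun_fubini_tonelli_F _ _ _ _ R leb K^\+%E (measurable_funepos mK) (funepos_ge0 K)).
exact: (@measurable_fun_fubini_tonelli_F _ _ _ _ R leb K^\-%E (measurable_funeneg mK) (funeneg_ge0 K)).
Qed.

Lemma integral_fst_slab (E : 'rV[R]_N -> \bar R) A : measurable_fun setT E ->
  (forall x, (0 <= E x)%E) -> measurable (A : set mR) ->
  (\int[mu]_(z in setT `*` A) E z.1 = leb A * \int[lamX]_x E x)%E.
Proof.
move=> mE E0 mA; rewrite integral_mkcond.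
pose H (z : mV) : \bar R := ((\1_A z.2)%:E * E z.1)%E.
have H0 z : (0 <= H z)%E by rewrite mule_ge0// lee_fin indicE.
have mH : measurable_fun setT H.
  apply: emeasurable_funM; last exact: measurableT_comp.
  apply/measurable_EFinP; apply: measurableT_comp => //; exact: measurable_indic.
transitivity (\int[mu]_z H z)%E.
  apply: eq_integral => -[x y] _; rewrite patchE /H /= indicE.
  have -> : ((x, y) \in [set: 'rV[R]_N] `*` A) = (y \in A).
    by apply/idP/idP => [/set_mem[_]|/set_mem] H'; apply/mem_set.
  by case: (y \in A); rewrite ?mul1e ?mul0e.
rewrite (@fubini_tonelli1 _ _ _ _ R lamX leb H mH H0) /fubini_F.
rewrite -ge0_integralZl//; apply: eq_integral => x _; rewrite /H /=.
rewrite ge0_integralZr//.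
- by rewrite integral_indic// setIT.
apply/measurable_EFinP; exact: measurable_indic.
Qed.

Definition slice_energy G (x : 'rV[R]_N) : \bar R := (\int[leb]_s (G (x, s) ^+ 2)%:E)%E.

Lemma slice_energy_ge0 G x : (0 <= slice_energy G x)%E.
Proof. by apply: integral_ge0 => s _; rewrite lee_fin sqr_ge0. Qed.

Let mG2 G : measurable_fun setT (G : mV -> R) ->
  measurable_fun setT ((fun z => (G z ^+ 2)%:E) : mV -> \bar R).
Proof. by move=> mG; apply/measurable_EFinP; exact: measurable_funX. Qed.

Lemma measurable_slice_energy G : measurable_fun setT (G : mV -> R) ->
  measurable_fun setT (slice_energy G).
Proof.
move=> mG; apply: (@measurable_fun_fubini_tonelli_F _ _ _ _ R leb _ (mG2 mG)) => z.
by rewrite lee_fin sqr_ge0.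
Qed.

Lemma integral_slice_energy G : measurable_fun setT (G : mV -> R) ->
  (\int[lamX]_x slice_energy G x = \int[mu]_z (G z ^+ 2)%:E)%E.
Proof.
move=> mG; rewrite (@fubini_tonelli1 _ _ _ _ R lamX leb _ (mG2 mG))// => z.
by rewrite lee_fin sqr_ge0.
Qed.

End slices.

Lemma trace_small (R : realType) (I : R -> \bar R) : (forall h, (0 <= I h)%E) ->
  (fun h : R => h^-1%:E * I h)%E @ 0^'+ --> 0%E ->
  forall eps : R, 0 < eps -> exists2 d, 0 < d &
    forall h, 0 < h -> h < d -> (I h <= (h * eps)%:E)%E.
Proof.
move=> I0 cI eps eps0.
have : \forall h \near 0^'+, (h^-1%:E * I h < eps%:E)%E.
  have H : nbhs (0%E : \bar R) [set x | (x < eps%:E)%E].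
    by apply: open_ereal_lt'; rewrite lte_fin.
  exact: (cI _ H).
rewrite near_withinE => /nbhs_ballP[d /= d0 H]; exists d => // h h0 hd.
have -> : I h = (h%:E * (h^-1%:E * I h))%E by rewrite muleA -EFinM divff ?gt_eqF// mul1e.
rewrite EFinM; apply: lee_wpmul2l; first by rewrite lee_fin ltW.
by apply/ltW/H => //; rewrite /ball /= sub0r normrN gtr0_norm.
Qed.

Lemma add_y_dir (R : realType) (N : nat) (z : 'rV[R]_N * R) (s : R) :
  z + s *: y_dir = (z.1, z.2 + s).
Proof.
case: z => x y; rewrite /y_dir; congr (_, _) => /=.
  by rewrite scaler0 addr0.
by rewrite /GRing.scale /= mulr1.
Qed.

(** * Traces and the absolutely continuous representative on an edge *)

Section edge_trace.
Context {R : realType} {N : nat}.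
Local Notation V := ('rV[R]_N * R)%type.
Local Notation mR := (measurableTypeR R).
Local Notation mV := ('rV[R]_N * measurableTypeR R)%type.
Local Notation mu := (@lebesgue_prod R N).
Local Notation leb := (@lebesgue_measure R).
Local Notation lamX := (@lebesgue_rV R N).
Variables (l : \bar R) (f g : V -> R).
Hypothesis l0 : (0 < l)%E.
Hypothesis f2 : L2_on mu (cyl l) f.
Hypothesis wfg : is_weak_derivative (cyl l) y_dir f g.
Local Notation F := (f \_ (cyl l)).
Local Notation G := (g \_ (cyl l)).
Local Notation W := (fun z : V => primitive (fun s => G (z.1, s)) z.2).

Let mO : measurable (cyl l : set mV). Proof. exact: measurable_cyl. Qed.

Let G2 : L2_on mu setT G.
Proof. by have [] := (is_weak_derivativeP _ _ _ mO).1 wfg. Qed.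

Let F2 : L2_on mu setT F. Proof. exact/(L2_patch _ _ mO). Qed.

Let K : R := inner mu G G.

Let KE : (\int[mu]_z (G z ^+ 2)%:E = K%:E)%E. Proof. exact: L2_sqE. Qed.

Let K0 : 0 <= K. Proof. exact: inner_ge0. Qed.

Let mW : measurable_fun setT (W : mV -> R).
Proof. by apply: measurable_slice_primitive; have [] := G2. Qed.

Let slice_ae : {ae mu, forall z, L2_on leb setT (fun s => G (z.1, s))}.
Proof. exact: (@ae_fst _ _ _ _ _ lamX leb _ (L2_slice G2)). Qed.

(** F - W is invariant under translation by h in y. The exceptional null set depends on h, so
    independence of y cannot be read off pointwise and is obtained by integrating over slabs. *)
Let increment h : 0 < h -> {ae mu, forall z, cyl (l - h%:E) z ->
  F (z + h *: y_dir) - W (z + h *: y_dir) = F z - W z}.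
Proof.
move=> h0.
have OP (z : V) s : cyl (l - h%:E) z -> 0 <= s <= h -> cyl l (z + s *: y_dir).
  move=> [_ [/= z0 zl]] /andP[s0 sh]; rewrite add_y_dir; split => //=; split; first by lra.
  rewrite -[(- h)%:E]/(- h%:E)%E lteBrDr// -EFinD in zl.
  by apply: le_lt_trans zl; rewrite lee_fin lerD2l.
have := @weak_derivative_increment _ _ h h0 _ _ _ _ _ mO wfg f2 OP _ erefl.
move: slice_ae; apply: filterS2 => z z2 H cz; have [_ [z0 _]] := cz.
move/eqP: (H cz); rewrite subr_eq => /eqP ->.
have := primitive_shift z2 z0 h0.
have -> : line_average h y_dir G z =
    \int[leb]_s (G (z.1, z.2 + s) * \1_(`[0, h]%classic : set R) s).
  by apply: eq_Rintegral => s _; rewrite add_y_dir.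
by move=> ->; rewrite add_y_dir /=; lra.
Qed.

Let slab (d : R) : set R := [set y : R | 0 < y <= d].

Let mslab d : measurable (slab d : set mR).
Proof. by apply: measurable_set_bool; apply: measurable_and; [exact: measurable_fun_ltr|exact: measurable_fun_ler]. Qed.

Let mXslab d : measurable (setT `*` slab d : set mV).
Proof. exact: measurableX. Qed.

Let leb_slab d : 0 <= d -> leb (slab d) = d%:E.
Proof.
move=> d0; have -> : slab d = `]0, d]%classic by apply/seteqP; split => y; rewrite /= in_itv.
have -> : leb (`]0, d]%classic : set R) = (if 0 < d then (d - 0)%:E else 0%E).
  by rewrite lebesgue_measure_itv /= lte_fin; case: ifP.
by case: ltP => [|d0']; [rewrite subr0|congr EFin; lra].
Qed.

(** On a slice W^2 is at most d times the slice energy, and the slab has width d. The quadratic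
    order in d shows that W has zero trace at y = 0. *)
Let W_slab d : 0 < d -> (\int[mu]_(z in setT `*` slab d) (W z ^+ 2)%:E <= (d ^+ 2 * K)%:E)%E.
Proof.
move=> d0; have [mG _] := G2.
apply: (@le_trans _ _ (\int[mu]_(z in setT `*` slab d) (d%:E * slice_energy G z.1))%E).
  apply: ae_ge0_le_integral => //.
  - by move=> z _; rewrite lee_fin sqr_ge0.
  - by apply/measurable_EFinP/measurable_funTS/measurable_funX.
  - by move=> z _; rewrite mule_ge0 ?slice_energy_ge0// lee_fin ltW.
  - apply/measurable_funTS/measurable_funeM.
    exact: (measurableT_comp (measurable_slice_energy mG) measurable_fst).
  move: slice_ae; apply: ae_impl => z z2 [_ /andP[z0 zd]].
  rewrite /slice_energy L2_sqE// -EFinM lee_fin.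
  apply: le_trans (primitive_sqr_le z2 (ltW z0)) _.
  by rewrite ler_wpM2r ?inner_ge0.
rewrite (@integral_fst_slab _ _ (fun x => d%:E * slice_energy G x)%E (slab d)) //; last 2 first.
- by apply: measurable_funeM; exact: measurable_slice_energy.
- by move=> x; rewrite mule_ge0 ?slice_energy_ge0// lee_fin ltW.
rewrite ge0_integralZl//; last 3 first.
- exact: measurable_slice_energy.
- by move=> x _; exact: slice_energy_ge0.
- by rewrite lee_fin ltW.
rewrite leb_slab ?(ltW d0)// integral_slice_energy// KE.
by rewrite -!EFinM lee_fin expr2 mulrA.
Qed.

Section origin_trace.
Variable T : 'rV[R]_N -> R.
Hypothesis mT : measurable_fun setT T.
Hypothesis trT : (fun h : R => h^-1%:E * \int[mu]_(z in setT `*` [set s : R | (0 < s < h)%R])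
  ((f z - T z.1) ^+ 2)%:E)%E @ 0^'+ --> 0%E.

Let D (z : V) : R := (F z - W z - T z.1) ^+ 2.

Let D0 z : 0 <= D z. Proof. exact: sqr_ge0. Qed.

Let mF : measurable_fun setT (F : mV -> R). Proof. by have [] := F2. Qed.

Let mD : measurable_fun setT (D : mV -> R).
Proof.
apply: measurable_funX; apply: measurable_funB; first exact: measurable_funB.
exact: measurableT_comp.
Qed.

Let e (d : R) : \bar R := (\int[mu]_(z in setT `*` slab d) (D z)%:E)%E.

Let e0 d : (0 <= e d)%E. Proof. by apply: integral_ge0 => z _; rewrite lee_fin. Qed.

(** D is invariant under translation by d, so the part of the slab between d and 2 d contributes no
    more than the part below d. *)
Let e_double d : 0 < d -> ((2 * d)%:E < l)%E -> (e (2 * d) <= 2%:E * e d)%E.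
Proof.
move=> d0 dl; pose H (z : V) : R := (D \_ (setT `*` slab d)) z.
have H0 z : 0 <= H z by rewrite /H patchE; case: ifP.
have mH : measurable_fun setT (H : mV -> R).
  by apply: (measurable_restrictT _ (mXslab d)).1; exact: measurable_funTS.
have mHE : measurable_fun setT (fun z : mV => (H z)%:E) by exact/measurable_EFinP.
have eH : e d = (\int[mu]_z (H z)%:E)%E.
  rewrite /e integral_mkcond; apply: eq_integral => z _.
  by rewrite /H !patchE; case: ifP.
have eHs : e d = (\int[mu]_z (H (z + - (d *: y_dir)))%:E)%E.
  rewrite eH -(ge0_integral_prod_shift (- (d *: y_dir)) mHE) => // z.
rewrite mule_natl mule2n {1}eH eHs -ge0_integralD//; last 3 first.
- by move=> z _; rewrite lee_fin.
- by move=> z _; rewrite lee_fin.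
- apply/measurable_EFinP; apply: (measurableT_comp mH); exact: measurable_shift.
rewrite /e [leLHS]integral_mkcond.
apply: (@ae_ge0_le_integral _ mV R mu setT measurableT) => //.
- by move=> z _; rewrite patchE; case: ifP => // _; rewrite lee_fin.
- apply: (measurable_restrictT _ (mXslab _)).1; apply: measurable_funTS.
  exact/measurable_EFinP.
- by move=> z _; rewrite adde_ge0// lee_fin.
- apply: emeasurable_funD => //; apply/measurable_EFinP; apply: (measurableT_comp mH).
  exact: measurable_shift.
have inc : {ae mu, forall z, cyl (l - d%:E) (z + - (d *: y_dir)) ->
    D z = D (z + - (d *: y_dir))}.
  have := ae_preimage (lebesgue_prod_shift (- (d *: y_dir))) (measurable_shift _) (increment d0).
  apply: ae_impl => z Hz cz; have := Hz cz; rewrite subrK => E.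
  by rewrite /D E -scaleNr add_y_dir /=.
apply: ae_impl inc => z Hz _; rewrite patchE; case: ifPn => [|_]; last by rewrite adde_ge0// lee_fin.
move=> /set_mem[_ /andP[z0 zd]].
rewrite -EFinD lee_fin; have [zd'|zd'] := leP z.2 d.
  rewrite {1}/H patchE mem_set; last by split => //; apply/andP.
  by rewrite lerDl.
rewrite Hz; last first.
  rewrite -scaleNr add_y_dir; split => //=; split; first by lra.
  by rewrite -[(- d)%:E]/(- d%:E)%E lteBrDr// -EFinD; apply: le_lt_trans dl; rewrite lee_fin; lra.
rewrite {2}/H patchE mem_set ?lerDr//.
by rewrite -scaleNr add_y_dir; split => //=; apply/andP; split; lra.
Qed.

Let e_small (eps : R) : 0 < eps ->
  exists2 d0, 0 < d0 & forall d, 0 < d -> d < d0 -> (e d <= (d * eps)%:E)%E.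
Proof.
move=> eps0.
have [r r0 rl] : exists2 r : R, 0 < r & (r%:E <= l)%E.
  case: (l) l0 => [r| |]// r0; first by exists r.
  by exists 1; rewrite ?leey.
have eps8 : 0 < eps / 8 by rewrite divr_gt0.
set I := (fun h : R => \int[mu]_(z in setT `*` [set s : R | (0 < s < h)%R])
  ((f z - T z.1) ^+ 2)%:E)%E.
have I0 h : (0 <= I h)%E by apply: integral_ge0 => z _; rewrite lee_fin sqr_ge0.
have [h0 h00 Hh] := trace_small I0 trT (ltac:(by rewrite divr_gt0) : 0 < eps / 8).
have K1 : 0 < 4 * (K + 1) by rewrite mulr_gt0// ltr_wpDl.
(* D is at most 2 (F - T)^2 + 2 W^2. The slab ]0, d] is enlarged to ]0, 2 d[ to match the trace, so
   the first term gives 2 * 2 d * eps / 8 = d eps / 2. The last bound on d makes 2 d^2 K at most d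
   eps / 2, and [r / 2] keeps 2 d below l. *)
exists (Num.min (Num.min (h0 / 2) (r / 2)) (eps / (4 * (K + 1)))).
  by rewrite !lt_min !divr_gt0.
move=> d d0; rewrite !lt_min => /andP[/andP[dh dr] dK].
have dl : ((2 * d)%:E < l)%E by apply: lt_le_trans rl; rewrite lte_fin; lra.
have sub : (setT `*` slab d : set V) `<=` cyl l.
  move=> z [_ /andP[z0 zd]]; split => //=; split=> //.
  by apply: le_lt_trans dl; rewrite lee_fin; lra.
have m1 : measurable_fun setT (fun z : mV => ((F z - T z.1) ^+ 2)%:E).
  apply/measurable_EFinP/measurable_funX/measurable_funB => //.
  exact: measurableT_comp.
have m2 : measurable_fun setT (fun z : mV => (W z ^+ 2)%:E).
  by apply/measurable_EFinP; exact: measurable_funX.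
apply: (@le_trans _ _ (\int[mu]_(z in setT `*` slab d)
    (2%:E * ((F z - T z.1) ^+ 2)%:E + 2%:E * (W z ^+ 2)%:E))%E).
  apply: ge0_le_integral => //.
  - by move=> z _; rewrite lee_fin.
  - by apply/measurable_EFinP; exact: measurable_funTS.
  - by apply: measurable_funTS; apply: emeasurable_funD; exact: measurable_funeM.
  move=> z _; have := sqr_ge0 (F z + W z - T z.1).
  by rewrite -!EFinM -EFinD lee_fin /D; set a := F z; set b := primitive _ _; nra.
rewrite ge0_integralD//; last 4 first.
- by move=> z _; rewrite -EFinM lee_fin mulr_ge0// sqr_ge0.
- by apply: measurable_funTS; exact: measurable_funeM.
- by move=> z _; rewrite -EFinM lee_fin mulr_ge0// sqr_ge0.
- by apply: measurable_funTS; exact: measurable_funeM.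
rewrite !ge0_integralZl//; last 4 first.
- exact: measurable_funTS.
- by move=> z _; rewrite lee_fin sqr_ge0.
- exact: measurable_funTS.
- by move=> z _; rewrite lee_fin sqr_ge0.
apply: (@le_trans _ _ (2%:E * (2 * d * (eps / 8))%:E + 2%:E * (d ^+ 2 * K)%:E)%E).
  apply: leeD; apply: lee_wpmul2l; rewrite ?lee_fin//; last exact: W_slab.
  apply: le_trans (Hh (2 * d) (ltac:(by rewrite mulr_gt0)) (ltac:(by lra))).
  have mI : measurable (setT `*` [set s : R | 0 < s < 2 * d] : set mV).
    apply: measurableX => //; apply: measurable_set_bool.
    by apply: measurable_and; exact: measurable_fun_ltr.
  have subI : (setT `*` [set s : R | 0 < s < 2 * d] : set V) `<=` cyl l.
    move=> z [_ /andP[z0 zd]]; split => //=; split=> //.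
    by apply: lt_trans dl; rewrite lte_fin.
  rewrite /I; have -> : (\int[mu]_(z in setT `*` [set s : R | (0 < s < 2 * d)%R]) ((f z - T z.1) ^+ 2)%:E =
      \int[mu]_(z in setT `*` [set s : R | (0 < s < 2 * d)%R]) ((F z - T z.1) ^+ 2)%:E)%E.
    by apply: eq_integral => z /set_mem /subI zl; rewrite patchE mem_set.
  apply: ge0_subset_integral => //.
  - exact: measurable_funTS.
  - by move=> z _; rewrite lee_fin sqr_ge0.
  - by move=> z [_ /andP[z0 zd]]; split => //=; apply/andP; split; lra.
rewrite -!EFinM -EFinD lee_fin.
have : d * (4 * (K + 1)) <= eps by rewrite -ler_pdivlMr// ltW.
move=> H; have : d * (d * (4 * (K + 1))) <= d * eps by rewrite ler_wpM2l// ltW.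
by have := mulr_ge0 (ltW d0) (ltW d0); nra.
Qed.

Let e_scale n d : 0 < d -> (d%:E < l)%E -> (e d <= (2 ^+ n)%:E * e (d / 2 ^+ n))%E.
Proof.
move=> d0 dl; elim: n => [|n IH]; first by rewrite expr0 divr1 mul1e.
have p0 : (0 : R) < 2 ^+ n by rewrite exprn_gt0.
apply: le_trans IH _; rewrite exprSr EFinM -muleA.
apply: lee_wpmul2l; first by rewrite lee_fin ltW.
have -> : d / 2 ^+ n = 2 * (d / (2 ^+ n * 2)) by field; rewrite gt_eqF.
apply: e_double; first by rewrite divr_gt0// mulr_gt0.
have -> : 2 * (d / (2 ^+ n * 2)) = d / 2 ^+ n by field; rewrite gt_eqF.
apply: le_lt_trans dl; rewrite lee_fin ler_pdivrMr// ler_peMr ?(ltW d0)//.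
by rewrite exprn_ege1// ler1n.
Qed.

(** Halving d n times costs a factor 2^n, while [e] of a small width is at most that width times any
    given positive number: the powers of 2 cancel and [e d] is below every positive number. *)
Let e_eq0 d : 0 < d -> (d%:E < l)%E -> e d = 0%E.
Proof.
move=> d0 dl; apply/eqP; rewrite eq_le e0 andbT.
apply/lee_addgt0Pr => eps eps0; rewrite add0e.
have [d1 d10 Hd] := e_small (ltac:(by rewrite divr_gt0) : 0 < eps / d).
have [n Hn] : exists n : nat, d / 2 ^+ n < d1.
  exists (Num.truncn (d / d1)).+1; rewrite ltr_pdivrMr ?exprn_gt0// mulrC -ltr_pdivrMr//.
  apply: lt_trans (truncnS_gt _) _; rewrite -natrX ltr_nat.
  exact: ltn_expl.
have p0 : (0 : R) < 2 ^+ n by rewrite exprn_gt0.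
apply: le_trans (e_scale n d0 dl) _.
apply: (@le_trans _ _ ((2 ^+ n)%:E * (d / 2 ^+ n * (eps / d))%:E)%E).
  by apply: lee_wpmul2l; [rewrite lee_fin ltW|apply: Hd => //; rewrite divr_gt0].
rewrite -EFinM lee_fin le_eqVlt; apply/orP; left; apply/eqP.
by field; rewrite !gt_eqF.
Qed.

Lemma trace_representation : {ae mu, forall z, cyl l z -> f z = T z.1 + W z}.
Proof.
(* [e_eq0] needs widths strictly less than l; these widths exhaust the edge. *)
pose L (n : nat) : R := if l is r%:E%E then r - n.+1%:R^-1 else n.+1%:R.
have Ll n : ((L n)%:E < l)%E.
  rewrite /L; case: (l) l0 => [r| |]// _; last by rewrite ltry.
  by rewrite lte_fin ltrBlDr ltrDl invr_gt0.
have Lz (y : R) : (y%:E < l)%E -> exists n, y <= L n.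
  rewrite /L; case: (l) l0 => [r| |]// _; last first.
    move=> _; exists (Num.truncn y); apply/ltW; exact: truncnS_gt.
  rewrite lte_fin => yr; have /ltr_add_invr[n Hn] := yr.
  by exists n; rewrite lerBrDr ltW.
have H n : {ae mu, forall z, (setT `*` slab (L n)) z -> D z = 0}.
  have [L0|L0] := ltP 0 (L n); last first.
    apply: aeW => z [_ /andP[z0 zL]]; exfalso; lra.
  apply: ae_ge0_integral_eq0 => //; first exact: measurable_funTS.
  exact: e_eq0.
apply: ae_impl (ae_foralln H) => z Hz zl.
have [n zL] := Lz z.2 (zl.2).2.
have : D z = 0 by apply: (Hz n); split => //; apply/andP; split => //; exact: zl.2.1.
move/eqP; rewrite sqrf_eq0 => /eqP; rewrite patchE mem_set// => E.
by lra.
Qed.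

End origin_trace.

(** On the strip of width h at the terminus, W differs from its end value by at most the square root
    of h times the slice energy. So h times the squared norm of the discrepancy is at most 2 I h + 2
    h^2 K, where I h is h times a quantity tending to 0; dividing by h kills the discrepancy. *)
Lemma terminus_trace (r : R) (T T' : 'rV[R]_N -> R) : l = r%:E ->
  measurable_fun setT T -> measurable_fun setT T' ->
  {ae mu, forall z, cyl l z -> f z = T z.1 + W z} ->
  (fun h : R => h^-1%:E * \int[mu]_(z in setT `*` [set s : R | (0 < s < h)%R])
    ((f (reflect_y r z) - T' z.1) ^+ 2)%:E)%E @ 0^'+ --> 0%E ->
  {ae lamX, forall x, T x + primitive (fun s => G (x, s)) r = T' x}.
Proof.
move=> lr mT mT' rep; have [mG _] := G2; have [mF _] := F2.
set I := (fun h : R => \int[mu]_(z in setT `*` [set s : R | (0 < s < h)%R])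
  ((f (reflect_y r z) - T' z.1) ^+ 2)%:E)%E => trT'.
have I0 h : (0 <= I h)%E by apply: integral_ge0 => z _; rewrite lee_fin sqr_ge0.
have r0 : 0 < r by rewrite -lte_fin -lr.
pose S x := T x + primitive (fun s => G (x, s)) r - T' x.
have mS : measurable_fun setT S.
  apply: measurable_funB => //; apply: measurable_funD => //.
  exact: (measurable_fun_pair1 r mW).
have mS2 : measurable_fun setT (fun x => (S x ^+ 2)%:E) by apply/measurable_EFinP/measurable_funX.
pose J := (\int[lamX]_x (S x ^+ 2)%:E)%E.
have J0 : (0 <= J)%E by apply: integral_ge0 => x _; rewrite lee_fin sqr_ge0.
have mFr : measurable_fun setT (fun z : mV => ((F (reflect_y r z) - T' z.1) ^+ 2)%:E).
  apply/measurable_EFinP/measurable_funX/measurable_funB; last exact: measurableT_comp.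
  by apply: (measurableT_comp mF); exact: measurable_reflect_y.
have mE : measurable_fun setT (fun z : mV => slice_energy G z.1).
  exact: (measurableT_comp (measurable_slice_energy mG) measurable_fst).
have bound h : 0 < h -> h < r -> (h%:E * J <= 2%:E * I h + (2 * h ^+ 2 * K)%:E)%E.
  move=> h0 hr; pose A : set R := `]0, h[%classic.
  have AE : [set s : R | 0 < s < h] = A by apply/seteqP; split => y; rewrite /A /= in_itv.
  have mA : measurable (A : set mR) by exact: measurable_itv.
  have mXA : measurable (setT `*` A : set mV) by exact: measurableX.
  have lA : leb A = h%:E by rewrite /A lebesgue_itvoo subr0 max_l// ltW.
  have := @integral_fst_slab _ N (fun x => (S x ^+ 2)%:E) A mS2.
  rewrite lA => <- //; last by move=> x; rewrite lee_fin sqr_ge0.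
  have Ih : I h = (\int[mu]_(z in setT `*` A) ((F (reflect_y r z) - T' z.1) ^+ 2)%:E)%E.
    rewrite /I AE; apply: eq_integral => z /set_mem[_]; rewrite /A /= in_itv /= => /andP[z0 zh].
    rewrite patchE mem_set//; split => //=; rewrite lr lte_fin.
    by split; lra.
  apply: (@le_trans _ _ (\int[mu]_(z in setT `*` A) (2%:E * ((F (reflect_y r z) - T' z.1) ^+ 2)%:E +
      (2 * h)%:E * slice_energy G z.1))%E).
    apply: ae_ge0_le_integral => //.
    - by move=> z _; rewrite lee_fin sqr_ge0.
    - apply: measurable_funTS; exact: (measurableT_comp mS2 measurable_fst).
    - move=> z _; rewrite adde_ge0 ?mule_ge0 ?lee_fin ?sqr_ge0 ?slice_energy_ge0//.
      by rewrite mulr_ge0// ltW.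
    - by apply: measurable_funTS; apply: emeasurable_funD; exact: measurable_funeM.
    have := ae_preimage (lebesgue_prod_reflect_y r) (measurable_reflect_y r) rep.
    move: slice_ae; apply: filterS2 => z z2 Hz [_]; rewrite /A /= in_itv /= => /andP[z0 zh].
    have cz : cyl l (reflect_y r z) by split => //=; rewrite lr lte_fin; split; lra.
    have rz : r - z.2 <= r by lra.
    have := primitive_diff_sqr z2 rz; have := Hz cz.
    rewrite patchE mem_set// /slice_energy L2_sqE// -!EFinM -EFinD lee_fin /S /=.
    move=> ->; set a := primitive _ _; set b := primitive _ _; set k := inner _ _ _.
    move=> ab; have k0 : 0 <= k by exact: inner_ge0.
    have ab' : (a - b) ^+ 2 <= h * k.
      by apply: le_trans ab _; rewrite ler_wpM2r// subKr ltW.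
    rewrite -subr_ge0 (_ : _ - _ = (T z.1 + b - T' z.1 - (a - b)) ^+ 2 +
      2 * (h * k - (a - b) ^+ 2)); last by ring.
    by rewrite addr_ge0 ?sqr_ge0// mulr_ge0// subr_ge0.
  rewrite ge0_integralD//; last 4 first.
  - by move=> z _; rewrite -EFinM lee_fin mulr_ge0// sqr_ge0.
  - by apply: measurable_funTS; exact: measurable_funeM.
  - by move=> z _; rewrite mule_ge0 ?slice_energy_ge0// lee_fin mulr_ge0// ltW.
  - by apply: measurable_funTS; exact: measurable_funeM.
  apply: leeD.
    rewrite ge0_integralZl//; first by rewrite Ih.
      exact: measurable_funTS.
    by move=> z _; rewrite lee_fin sqr_ge0.
  rewrite (@integral_fst_slab _ N (fun x => (2 * h)%:E * slice_energy G x)%E A) //; last 2 first.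
  - by apply: measurable_funeM; exact: measurable_slice_energy.
  - by move=> x; rewrite mule_ge0 ?slice_energy_ge0// lee_fin mulr_ge0// ltW.
  rewrite ge0_integralZl//; last 3 first.
  - exact: measurable_slice_energy.
  - by move=> x _; exact: slice_energy_ge0.
  - by rewrite lee_fin mulr_ge0// ltW.
  rewrite lA integral_slice_energy// KE -!EFinM lee_fin le_eqVlt; apply/orP; left; apply/eqP; ring.
have J_eq0 : J = 0%E.
  apply/eqP; rewrite eq_le J0 andbT; apply/lee_addgt0Pr => eps eps0; rewrite add0e.
  have [d0 d00 Hd] := trace_small I0 trT' (ltac:(by rewrite divr_gt0) : 0 < eps / 4).
  have K1 : 0 < 4 * (K + 1) by rewrite mulr_gt0// ltr_wpDl.
  pose h := Num.min (Num.min (d0 / 2) (r / 2)) (eps / (4 * (K + 1))).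
  have h0 : 0 < h by rewrite !lt_min !divr_gt0.
  have [hd hr hK] : [/\ h <= d0 / 2, h <= r / 2 & h <= eps / (4 * (K + 1))].
    by rewrite /h !ge_min !lexx !orbT.
  have := bound h h0 (ltac:(lra)); have := Hd h h0 (ltac:(lra)) => H1 H2.
  have {H1 H2} : (h%:E * J <= h%:E * eps%:E)%E.
    apply: (le_trans H2); apply: (@le_trans _ _ (2%:E * (h * (eps / 4))%:E + (2 * h ^+ 2 * K)%:E)%E).
      by apply: leeD2r; apply: lee_wpmul2l => //; rewrite lee_fin.
    rewrite -!EFinM -EFinD lee_fin.
    have hK' : h * (4 * (K + 1)) <= eps by rewrite -ler_pdivlMr.
    have : h * (h * (4 * (K + 1))) <= h * eps by rewrite ler_wpM2l// ltW.
    by have := mulr_ge0 (ltW h0) (ltW h0); nra.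
  by rewrite lee_pmul2l.
have := ae_ge0_integral_eq0 measurableT (measurable_funX 2 mS) (fun x => sqr_ge0 (S x)) J_eq0.
apply: ae_impl => x Sx; apply/eqP; rewrite -subr_eq0 -sqrf_eq0; apply/eqP.
exact: Sx.
Qed.

End edge_trace.

(** * Slices of a Sobolev function on a graph *)

Lemma ae_and d (T : measurableType d) (R : realType) (m : {measure set T -> \bar R})
    (P Q : T -> Prop) : {ae m, forall x, P x} -> {ae m, forall x, Q x} ->
  {ae m, forall x, P x /\ Q x}.
Proof. by move=> mP mQ; apply: filterS2 mP mQ => x. Qed.

Section countable_families.
Context {R : realType} {E : countType}.
Local Notation cnt := (@counting nat R).

Lemma ae_forall_countable d (T : measurableType d) (m : {measure set T -> \bar R})
    (P : E -> T -> Prop) :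
  (forall e, {ae m, forall z, P e z}) -> {ae m, forall z, forall e, P e z}.
Proof.
move=> H; have H' n : {ae m, forall z, if @pickle_inv E n is Some e then P e z else True}.
  by case: pickle_inv => [e|]; [exact: H|exact: aeW].
by apply: ae_impl (ae_foralln H') => z Hz e; have := Hz (pickle e); rewrite pickleK_inv.
Qed.

Lemma ae_glue d (T : measurableType d) (m : {sigma_finite_measure set T -> \bar R})
    (P : E -> T -> Prop) :
  (forall e, {ae m, forall z, P e z}) ->
  {ae sf_product cnt m, forall p, forall e, @pickle_inv E p.1 = Some e -> P e p.2}.
Proof.
move=> /(_ _)/cid - /all_sig[A /all_and3[mA A0 PA]].
pose B : set (nat * T) := [set p | if @pickle_inv E p.1 is Some e then A e p.2 else False].
have mB : measurable B.
  have -> : B = \bigcup_n ([set n] `*` (if @pickle_inv E n is Some e then A e else set0)).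
    apply/seteqP; split => -[n t]; rewrite /B /=.
      by move=> Bt; exists n => //=; split => //=; case: pickle_inv Bt.
    by move=> [k _ [/= -> ]]; case: pickle_inv.
  apply: bigcup_measurable => n _; apply: measurableX => //.
  by case: pickle_inv.
exists B; split => //.
  have -> := @sf_product_glue R E _ _ m B mB; last by move=> n t; rewrite /B /=; case: pickle_inv.
  by apply: esum1 => e _; rewrite -[RHS](A0 e); congr (m _); apply/seteqP; split => t; rewrite /B /= pickleK_inv.
move=> [n t] /= Np; rewrite /B /=; case EQ : (pickle_inv n) => [e|].
  by apply: PA => Pt; apply: Np => e'; rewrite EQ => -[<-].
by apply: Np => e; rewrite EQ.
Qed.

Lemma integral_glue_param d1 d2 (T1 : measurableType d1) (T2 : measurableType d2)
    (m1 : {sigma_finite_measure set T1 -> \bar R})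
    (m2 : {sigma_finite_measure set T2 -> \bar R}) (f : E -> T1 * T2 -> R) :
  (forall e, measurable_fun setT (f e)) -> (forall e z, 0 <= f e z) ->
  (\int[m1]_x \int[sf_product cnt m2]_p (glue f p.1 (x, p.2))%:E =
   \esum_(e in [set: E]) \int[(m1 \x m2)%E]_z (f e z)%:E)%E.
Proof.
move=> mf f0.
have H x : (\int[sf_product cnt m2]_p (glue f p.1 (x, p.2))%:E =
    \sum_(n <oo) if @pickle_inv E n is Some e then \int[m2]_y (f e (x, y))%:E else 0)%E.
  rewrite -esum_pickle; last by move=> e; apply: integral_ge0 => y _; rewrite lee_fin.
  by rewrite -(@integral_glue R E _ _ m2 (fun e y => f e (x, y)))// => e; exact: (measurable_fun_pair2 x (mf e)).
under eq_integral do rewrite H.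
have mfE e : measurable_fun setT (EFin \o f e) by exact/measurable_EFinP.
have fE0 e z : (0 <= (EFin \o f e) z)%E by rewrite lee_fin.
rewrite integral_nneseries//; last 2 first.
- move=> n; case: pickle_inv => [e|]; last exact: measurable_cst.
  exact: (@measurable_fun_fubini_tonelli_F _ _ _ _ R m2 _ (mfE e) (fE0 e)).
- by move=> n x _; case: pickle_inv => // e; apply: integral_ge0 => y _; rewrite lee_fin.
rewrite esum_pickle; last by move=> e; apply: integral_ge0 => z _; exact: fE0.
apply: eq_eseriesr => n _; case: pickle_inv => [e|]; last exact: integral0.
by rewrite (fubini_tonelli1 _ (mfE e) (fE0 e)).
Qed.

End countable_families.

Lemma ae_eq_measure d (T : measurableType d) (R : realType) (m : {measure set T -> \bar R})
    (A B : set T) : measurable A -> measurable B ->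
  {ae m, forall z, A z <-> B z} -> m A = m B.
Proof.
move=> mA mB AB; rewrite -(setIT A) -(setIT B) -!integral_indic//.
apply: ae_eq_integral => //; try by apply/measurable_EFinP; exact: measurable_indic.
apply: ae_impl AB => z AB _; rewrite !indicE; congr (nat_of_bool _)%:R%:E.
by apply/idP/idP => /set_mem ?; apply/mem_set/AB.
Qed.

Lemma eq_rearr d (Y : measurableType d) (R : realType)
    (nu : {sigma_finite_measure set Y -> \bar R}) (f g : Y -> R) :
  (forall t, 0 <= t -> distr nu f t = distr nu g t) -> rearr nu f = rearr nu g.
Proof.
move=> fg; apply/funext => y; congr inf; apply/seteqP.
by split => t [t0]; rewrite ?fg// -?fg//; split.
Qed.

Lemma esumZl_countable (R : realType) (E : countType) (c : R) (a : E -> \bar R) :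
  0 <= c -> (forall e, (0 <= a e)%E) ->
  (\esum_(e in [set: E]) (c%:E * a e) = c%:E * \esum_(e in [set: E]) a e)%E.
Proof.
move=> c0 a0; rewrite !esum_pickle//; last by move=> e; rewrite mule_ge0// lee_fin.
rewrite -nneseriesZl; last by move=> n _; case: pickle_inv.
by apply: eq_eseriesr => n _; case: pickle_inv => //; rewrite mule0.
Qed.

Lemma lebesgue_rV_shift (R : realType) (N : nat) (w : 'rV[R]_N) (A : set 'rV[R]_N) :
  measurable A -> lebesgue_rV N ((fun x => x + w) @^-1` A) = lebesgue_rV N A.
Proof.
move=> mA.
have mA' : measurable ((fun x : 'rV[R]_N => x + w) @^-1` A).
  by rewrite -[X in measurable X]setTI; exact: measurable_rV_shift.
rewrite -[in RHS](setIT A) -integral_indic//.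
rewrite -(ge0_integral_rV_shift w); last 2 first.
- by apply/measurable_EFinP; exact: measurable_indic.
- by move=> z; rewrite lee_fin.
by rewrite -[X in lebesgue_rV N X]setIT -integral_indic.
Qed.

Lemma add_x_dir (R : realType) (N : nat) (i : 'I_N) (z : 'rV[R]_N * R) (s : R) :
  z + s *: x_dir i = (z.1 + s *: delta_mx ord0 i, z.2).
Proof. by case: z => x y; rewrite /x_dir; congr (_, _) => /=; rewrite scaler0 addr0. Qed.

Section graph_slices.
Context {R : realType} (G : metric_graph R) (N : nat).
Local Notation V := ('rV[R]_N * R)%type.
Local Notation mR := (measurableTypeR R).
Local Notation mV := ('rV[R]_N * measurableTypeR R)%type.
Local Notation mu := (@lebesgue_prod R N).
Local Notation leb := (@lebesgue_measure R).
Local Notation lamX := (@lebesgue_rV R N).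
Local Notation nu := (sf_product (@counting nat R) leb).
Local Notation l := (total_length G).
Variable u : edge G -> V -> R.
Hypothesis G_connected : graph_connected G.
Hypothesis u_H1 : H1_graph u.
Hypothesis u_ge0 : nonneg_ae u.
Local Notation F e := (u e \_ (cylinder e)).
Local Notation Gy e := (d_y (cylinder e) (u e) \_ (cylinder e)).
Local Notation Gx i e := (d_x (cylinder e) i (u e) \_ (cylinder e)).

(* The negative part, carried by a null set, is discarded so that the slices
   are nonnegative everywhere. *)
Definition graph_slice (x : 'rV[R]_N) (p : nat * R) : R :=
  glue (fun e z => Num.max (F e z) 0) p.1 (x, p.2).
Local Notation U := graph_slice.

Definition slice_rearr (z : V) : R := rearr nu (U z.1) z.2.

Let mcyl (e : edge G) : measurable (cylinder e : set mV).
Proof. exact: (@measurable_cyl R N (elen e)). Qed.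

Let H1e e : H1_on (cylinder e) (u e). Proof. by have [] := u_H1. Qed.

Let u2 e : L2_on mu (cylinder e) (u e). Proof. by have [] := H1e e. Qed.

Let F2 e : L2_on mu setT (F e). Proof. exact/(L2_patch _ _ (mcyl e)). Qed.

Let mF e : measurable_fun setT (F e : mV -> R). Proof. by have [] := F2 e. Qed.

Lemma weak_dy e : is_weak_derivative (cylinder e) y_dir (u e) (d_y (cylinder e) (u e)).
Proof. by apply: weak_derivativeP; have [] := H1e e. Qed.

Lemma weak_dx i e :
  is_weak_derivative (cylinder e) (x_dir i) (u e) (d_x (cylinder e) i (u e)).
Proof. by apply: weak_derivativeP; have [_ + _] := H1e e. Qed.

Let Gy2 e : L2_on mu setT (Gy e).
Proof. by have [/(L2_patch _ _ (mcyl e))] := weak_dy e. Qed.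

Let Gx2 i e : L2_on mu setT (Gx i e).
Proof. by have [/(L2_patch _ _ (mcyl e))] := weak_dx i e. Qed.

Let mmax e : measurable_fun setT ((fun z => Num.max (F e z) 0) : mV -> R).
Proof. by apply: measurable_maxr => //; exact: measurable_cst. Qed.

Let m_integrand e : measurable_fun (cylinder e : set mV)
  (fun z => (u e z ^+ 2 + normsq_grad_x (cylinder e) (u e) z + d_y (cylinder e) (u e) z ^+ 2)%:E).
Proof.
apply/measurable_EFinP; apply: measurable_funD; first apply: measurable_funD.
- by apply: measurable_funX; have [] := u2 e.
- apply: measurable_sum => i; apply: measurable_funX; by have [[]] := weak_dx i e.
- by apply: measurable_funX; have [[]] := weak_dy e.
Qed.

Let energy_lty (f : edge G -> V -> R) :
  (forall e, measurable_fun (cylinder e : set mV) (f e)) ->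
  (forall e z, f e z ^+ 2 <= u e z ^+ 2 + normsq_grad_x (cylinder e) (u e) z + d_y (cylinder e) (u e) z ^+ 2) ->
  (\esum_(e in [set: edge G]) \int[mu]_z ((f e \_ (cylinder e)) z ^+ 2)%:E < +oo)%E.
Proof.
move=> mf fle; have [_ + _] := u_H1; apply: le_lt_trans; apply: le_esum => e _.
rewrite -integral_sqr_patch; apply: ge0_le_integral => //.
- by move=> z _; rewrite lee_fin sqr_ge0.
- by apply/measurable_EFinP; exact: measurable_funX.
by move=> z _; rewrite lee_fin.
Qed.

Let grad_ge0 e z : 0 <= normsq_grad_x (cylinder e) (u e) z.
Proof. by apply: sumr_ge0 => i _; exact: sqr_ge0. Qed.

Lemma value_energy_lty :
  (\esum_(e in [set: edge G]) \int[mu]_z (F e z ^+ 2)%:E < +oo)%E.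
Proof.
apply: energy_lty => [e|e z]; first by have [] := u2 e.
by rewrite -addrA lerDl addr_ge0 ?sqr_ge0.
Qed.

Lemma dy_energy_lty :
  (\esum_(e in [set: edge G]) \int[mu]_z (Gy e z ^+ 2)%:E < +oo)%E.
Proof.
apply: energy_lty => [e|e z]; first by have [[]] := weak_dy e.
by rewrite lerDr addr_ge0 ?sqr_ge0.
Qed.

Lemma dx_energy_lty i :
  (\esum_(e in [set: edge G]) \int[mu]_z (Gx i e z ^+ 2)%:E < +oo)%E.
Proof.
apply: energy_lty => [e|e z]; first by have [[]] := weak_dx i e.
rewrite addrAC; apply: (@le_trans _ _ (normsq_grad_x (cylinder e) (u e) z)); last first.
  by rewrite lerDr addr_ge0 ?sqr_ge0.
by rewrite /normsq_grad_x (bigD1 i)//= lerDl sumr_ge0// => j _; exact: sqr_ge0.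
Qed.

Let mU : measurable_fun setT ((fun q => U q.1 q.2) : 'rV[R]_N * (nat * mR) -> R).
Proof.
have mphi : measurable_fun setT (fun q : 'rV[R]_N * (nat * mR) => (q.2.1, (q.1, q.2.2))).
  apply: measurable_fun_pair; first exact: (measurableT_comp measurable_fst measurable_snd).
  apply: measurable_fun_pair => //.
  exact: (measurableT_comp measurable_snd measurable_snd).
exact: (measurableT_comp (measurable_glue mmax) mphi).
Qed.

Lemma measurable_graph_slice x : measurable_fun setT (U x : (nat * mR)%type -> R).
Proof. exact: (measurable_fun_pair2 x mU). Qed.

Lemma graph_slice_ge0 x p : 0 <= U x p.
Proof. by rewrite /U /glue; case: pickle_inv => // e; rewrite le_max lexx orbT. Qed.

Lemma measurable_slice_rearr : measurable_fun setT (slice_rearr : mV -> R).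
Proof. exact: (@measurable_rearr_param _ _ R nu _ _ _ mU). Qed.

Let slice_gtP x e (t y : R) : 0 <= t ->
  t < Num.max (F e (x, y)) 0 <-> edge_interior e y /\ t < u e (x, y).
Proof.
move=> t0; rewrite lt_max [X in _ || X]ltNge t0 orbF patchE; case: ifPn => [/set_mem[_ ey]|].
  by split => // -[].
rewrite notin_setE => nc; split; first by rewrite ltNge t0.
by move=> [ey _]; exfalso; apply: nc.
Qed.

Let distrE x t : 0 <= t -> distr nu (U x) t =
  (\esum_(e in [set: edge G]) leb [set y | (t < Num.max (F e (x, y)) 0)%R])%E.
Proof.
move=> t0; pose A : set (nat * mR) := [set p | t < U x p].
have mA : measurable A by exact: measurable_gt (measurable_graph_slice x).
have -> : distr nu (U x) t = (\esum_(e in [set: edge G]) leb [set y | A (pickle e, y)])%E.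
  apply: (@sf_product_glue R (edge G) _ _ leb A mA) => n y.
  rewrite /A /= /U /glue; case: pickle_inv => //=.
  by rewrite ltNge t0.
by apply: eq_esum => e _; congr (leb _); apply/seteqP; split => y /=;
  rewrite /A /= /U /= glue_pickle.
Qed.

Lemma distr_graph_slice x t : 0 <= t ->
  distr nu (U x) t = distribution_fun (fun e y => u e (x, y)) t.
Proof.
move=> t0; rewrite distrE//.
apply: eq_esum => e _; congr (leb _); apply/seteqP.
by split => y /=; move/(slice_gtP _ _ _ t0).
Qed.

Lemma y_rearrangement_slice e : y_rearrangement u e = slice_rearr.
Proof.
apply/funext => z; rewrite /y_rearrangement /rearrangement /slice_rearr /rearr.
congr inf; apply/seteqP.
by split => t [t0 H]; split => //; move: H; rewrite distr_graph_slice.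
Qed.

Lemma distr_le_length x t : 0 <= t -> (distr nu (U x) t <= l)%E.
Proof.
move=> t0; rewrite distrE//; apply: le_esum => e _.
rewrite -lebesgue_edge_interior; apply: le_measure; rewrite ?inE.
- apply: (@measurable_gt _ mR R (fun y => Num.max (F e (x, y)) 0)).
  exact: (measurable_fun_pair2 x (mmax e)).
- exact: measurable_edge_interior.
- by move=> y /= /(slice_gtP _ _ _ t0)[].
Qed.

(** Integrals over [cyl l] may thus be taken over the half-space y > 0, where equimeasurability is
    stated. *)
Lemma slice_rearr_eq0 x (y : R) : (l <= y%:E)%E -> slice_rearr (x, y) = 0.
Proof.
move=> ly; apply/eqP; rewrite eq_le rearr_ge0 andbT; apply: ge_inf.
  by exists 0 => t [].
by split => //; apply: le_trans ly; exact: distr_le_length.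
Qed.

Let max_sqr (a : R) : Num.max a 0 ^+ 2 <= a ^+ 2.
Proof. by case: (leP 0 a) => // _; rewrite expr0n sqr_ge0. Qed.

Lemma slice_vanishing_L2 :
  {ae lamX, forall x, (\int[nu]_p (U x p ^+ 2)%:E < +oo)%E /\ vanishing nu (U x)}.
Proof.
have mU2 : measurable_fun setT (fun q : 'rV[R]_N * (nat * mR) => (U q.1 q.2 ^+ 2)%:E).
  by apply/measurable_EFinP; exact: (measurable_funX 2 mU).
have U20 (q : 'rV[R]_N * (nat * mR)) : (0 <= (U q.1 q.2 ^+ 2)%:E)%E by rewrite lee_fin sqr_ge0.
have Ifin : (\int[lamX]_x \int[nu]_p (U x p ^+ 2)%:E < +oo)%E.
  have mmax2 e : measurable_fun setT ((fun z => Num.max (F e z) 0 ^+ 2) : mV -> R).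
    exact: measurable_funX.
  have := @integral_glue_param R (edge G) _ _ _ _ lamX leb _ mmax2 (fun e z => sqr_ge0 _).
  have -> : (\int[lamX]_x \int[nu]_p (glue (fun e z => Num.max (F e z) 0 ^+ 2) p.1 (x, p.2))%:E =
      \int[lamX]_x \int[nu]_p (U x p ^+ 2)%:E)%E.
    apply: eq_integral => x _; apply: eq_integral => p _.
    by rewrite /U /glue; case: pickle_inv => //; rewrite expr0n.
  move=> ->; apply: le_lt_trans value_energy_lty; apply: le_esum => e _.
  apply: ge0_le_integral => //.
  - by move=> z _; rewrite lee_fin sqr_ge0.
  - by apply/measurable_EFinP; exact: mmax2.
  - by apply/measurable_EFinP; exact: measurable_funX.
  - by move=> z _; rewrite lee_fin.
have mI : measurable_fun setT (fun x => \int[nu]_p (U x p ^+ 2)%:E)%E.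
  exact: (@measurable_fun_fubini_tonelli_F _ _ _ _ R nu _ mU2 U20).
have iI : lamX.-integrable setT (fun x => \int[nu]_p (U x p ^+ 2)%:E)%E.
  apply/integrableP; split => //; apply: le_lt_trans Ifin.
  rewrite le_eqVlt; apply/orP; left; apply/eqP; apply: eq_integral => x _.
  by rewrite gee0_abs//; apply: integral_ge0 => p _; exact: (U20 (x, p)).
have := integrable_ae measurableT iI; apply: ae_impl => x /(_ Logic.I).
have I0 : (0 <= \int[nu]_p (U x p ^+ 2)%:E)%E.
  by apply: integral_ge0 => p _; exact: (U20 (x, p)).
rewrite ge0_fin_numE// => Ix; split => //.
apply: vanishing_L2 => //; first exact: measurable_graph_slice.
exact: graph_slice_ge0.
Qed.

Lemma integral_slice_rearr_powR (p : R) : 1 <= p ->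
  (\int[mu]_(z in cyl l) (`|slice_rearr z| `^ p)%:E =
   \esum_(e in [set: edge G]) \int[mu]_(z in cylinder e) (`|u e z| `^ p)%:E)%E.
Proof.
move=> p1; have p0 : p != 0 by rewrite gt_eqF//; lra.
have mS : measurable_fun setT (fun z : mV => (slice_rearr z `^ p)%:E).
  apply/measurable_EFinP; apply: (measurableT_comp (measurable_powR p)).
  exact: measurable_slice_rearr.
pose pos : set R := `]0, +oo[%classic.
have mpos : measurable (setT `*` pos : set mV).
  by apply: measurableX => //; exact: measurable_itv.
transitivity (\int[mu]_z (((fun z => (slice_rearr z `^ p)%:E) \_ (setT `*` pos)) z))%E.
  rewrite integral_mkcond; apply: eq_integral => -[x y] _; rewrite !patchE.
  have [/set_mem [_ [/= y0 yl]]|] := boolP ((x, y) \in cyl l).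
    by rewrite mem_set ?ger0_norm ?rearr_ge0//; split => //=; rewrite /pos /= in_itv /= y0.
  rewrite notin_setE => ncyl; case: ifPn => // /set_mem[_ /=]; rewrite /pos /= in_itv /= andbT => y0.
  rewrite slice_rearr_eq0 ?powR0// leNgt; apply/negP => yl.
  by apply: ncyl; split.
have mSp : measurable_fun setT ((fun z => (slice_rearr z `^ p)%:E) \_ (setT `*` pos) : mV -> \bar R).
  by apply: (measurable_restrictT _ mpos).1; exact: measurable_funTS.
have Sp0 z : (0 <= ((fun z => (slice_rearr z `^ p)%:E) \_ (setT `*` pos)) z)%E.
  by rewrite patchE; case: ifP => // _; rewrite lee_fin powR_ge0.
rewrite (fubini_tonelli1 _ mSp Sp0) /fubini_F.
have mUp : measurable_fun setT (fun q : 'rV[R]_N * (nat * mR) => (U q.1 q.2 `^ p)%:E).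
  by apply/measurable_EFinP; exact: (measurableT_comp (measurable_powR p) mU).
have Up0 (q : 'rV[R]_N * (nat * mR)) : (0 <= (U q.1 q.2 `^ p)%:E)%E by rewrite lee_fin powR_ge0.
transitivity (\int[lamX]_x \int[nu]_p' (U x p' `^ p)%:E)%E.
  apply: ae_eq_integral => //.
  - exact: (@measurable_fun_fubini_tonelli_F _ _ _ _ R leb _ mSp Sp0).
  - exact: (@measurable_fun_fubini_tonelli_F _ _ _ _ R nu _ mUp Up0).
  apply: ae_impl slice_vanishing_L2 => x [_ vx] _.
  rewrite -(rearr_Lp (measurable_graph_slice x) (graph_slice_ge0 x) vx p1).
  rewrite [RHS]integral_mkcond; apply: eq_integral => y _; rewrite !patchE.
  have -> : ((x, y) \in setT `*` pos) = (y \in pos).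
    by apply/idP/idP => [/set_mem[_]|/set_mem] H'; apply/mem_set.
  by [].
have mmaxp e : measurable_fun setT ((fun z => Num.max (F e z) 0 `^ p) : mV -> R).
  exact: (measurableT_comp (measurable_powR p)).
have := @integral_glue_param R (edge G) _ _ _ _ lamX leb _ mmaxp (fun e z => powR_ge0 _ _).
have -> : (\int[lamX]_x \int[nu]_q (glue (fun e z => Num.max (F e z) 0 `^ p) q.1 (x, q.2))%:E =
      \int[lamX]_x \int[nu]_p' (U x p' `^ p)%:E)%E.
  apply: eq_integral => x _; apply: eq_integral => q _.
  by rewrite /U /glue; case: pickle_inv => //; rewrite powR0.
move=> ->; apply: eq_esum => e _; rewrite [RHS]integral_mkcond.
apply: ae_eq_integral => //.
- by apply/measurable_EFinP; exact: mmaxp.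
- apply: (measurable_restrictT _ (mcyl e)).1; apply/measurable_EFinP.
  apply: (measurableT_comp (measurable_powR p)); apply: measurableT_comp => //.
  by have [] := u2 e.
apply: ae_impl (u_ge0 e) => z uz _; rewrite !patchE; case: ifPn => [/set_mem cz|_].
  by rewrite max_l ?uz// ger0_norm ?uz.
by rewrite maxxx powR0.
Qed.

Definition slice_slope (x : 'rV[R]_N) : nat * R -> R :=
  graph_slope (fun e s => Gy e (x, s)).

Let slice_slopeE x p : slice_slope x p = glue (fun e => Gy e) p.1 (x, p.2).
Proof.
rewrite /slice_slope /graph_slope /glue; case: pickle_inv => // e.
rewrite !patchE; case: ifPn => // ny; rewrite memNset// => -[_ /= ey].
by move: ny; rewrite notin_setE.
Qed.

Let mslope : measurable_fun setT ((fun q => slice_slope q.1 q.2) : 'rV[R]_N * (nat * mR) -> R).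
Proof.
have mphi : measurable_fun setT (fun q : 'rV[R]_N * (nat * mR) => (q.2.1, (q.1, q.2.2))).
  apply: measurable_fun_pair; first exact: (measurableT_comp measurable_fst measurable_snd).
  apply: measurable_fun_pair => //.
  exact: (measurableT_comp measurable_snd measurable_snd).
have mGy e : measurable_fun setT (Gy e : mV -> R) by have [] := Gy2 e.
have -> : (fun q : 'rV[R]_N * (nat * mR) => slice_slope q.1 q.2) =
    (fun q => glue (fun e => Gy e) q.2.1 (q.1, q.2.2)).
  by apply/funext => q; rewrite slice_slopeE.
exact: (measurableT_comp (measurable_glue mGy) mphi).
Qed.

Lemma measurable_slice_slope x : measurable_fun setT (slice_slope x : (nat * mR)%type -> R).
Proof. exact: (measurable_fun_pair2 x mslope). Qed.

Definition slope_energy (x : 'rV[R]_N) : \bar R := (\int[nu]_p (slice_slope x p ^+ 2)%:E)%E.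

Let mslope2 : measurable_fun setT (fun q : 'rV[R]_N * (nat * mR) => (slice_slope q.1 q.2 ^+ 2)%:E).
Proof. by apply/measurable_EFinP; exact: (measurable_funX 2 mslope). Qed.

Lemma slope_energy_ge0 x : (0 <= slope_energy x)%E.
Proof. by apply: integral_ge0 => p _; rewrite lee_fin sqr_ge0. Qed.

Lemma measurable_slope_energy : measurable_fun setT slope_energy.
Proof.
apply: (@measurable_fun_fubini_tonelli_F _ _ _ _ R nu _ mslope2) => q.
by rewrite lee_fin sqr_ge0.
Qed.

Lemma integral_slope_energy : (\int[lamX]_x slope_energy x =
  \esum_(e in [set: edge G]) \int[mu]_z (Gy e z ^+ 2)%:E)%E.
Proof.
have mGy e : measurable_fun setT ((fun z => Gy e z ^+ 2) : mV -> R).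
  by apply: measurable_funX; have [] := Gy2 e.
rewrite -(@integral_glue_param R (edge G) _ _ _ _ lamX leb _ mGy (fun e z => sqr_ge0 _)).
apply: eq_integral => x _; apply: eq_integral => p _; rewrite slice_slopeE /glue.
by case: pickle_inv => //; rewrite expr0n.
Qed.

Lemma is_trace_origin (e : edge G) (w : V -> R) (T : 'rV[R]_N -> R) : is_trace e false w T ->
  (fun h : R => h^-1%:E * \int[mu]_(z in setT `*` [set s : R | (0 < s < h)%R])
    ((w z - T z.1) ^+ 2)%:E)%E @ 0^'+ --> 0%E.
Proof.
rewrite /is_trace; set f1 := (X in X @ _ --> _) => H; set f2 := (X in X @ _ --> _).
suff -> : f2 = f1 by exact: H.
by apply/funext => h; congr (_ * _)%E; apply: eq_integral => -[x y].
Qed.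

(** One trace is chosen for each vertex, common to all the edge ends meeting there; the continuity
    of the slices at the vertices originates here. *)
Lemma vertex_traces : exists T : vertex G -> 'rV[R]_N -> R,
  (forall v, measurable_fun setT (T v)) /\
  forall v e b, edge_end e b = Some v -> is_trace e b (u e) (T v).
Proof.
have [_ _ H] := u_H1.
have H' v : exists T : 'rV[R]_N -> R,
    L2_on lamX setT T /\ forall e b, edge_end e b = Some v -> is_trace e b (u e) T.
  by have [T T2 HT] := H v; exists T.
have [T HT] := choice H'.
by exists T; split=> v; [have [[]] := HT v|have [_] := HT v].
Qed.

(* The profile is the representative of the slice that is absolutely continuous
   on the edges, and the equations at the termini say that it is continuous at
   the vertices. *)
Lemma slice_profile : {ae lamX, forall x, exists T : vertex G -> R,
  [/\ forall e, L2_on leb setT (fun s => Gy e (x, s)),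
      forall e w, terminus e = Some w ->
        edge_profile T (fun e s => Gy e (x, s)) e (fine (elen e)) = T w
    & {ae nu, forall p, U x p = graph_profile T (fun e s => Gy e (x, s)) p}]}.
Proof.
have [T [mT trT]] := vertex_traces.
have rep e : {ae mu, forall z, cylinder e z -> u e z = T (origin e) z.1 +
    primitive (fun s => Gy e (z.1, s)) z.2}.
  exact: (trace_representation (elen_gt0 e) (u2 e) (weak_dy e) (mT _) (is_trace_origin (trT _ e false erefl))).
have sec1 : {ae lamX, forall x, forall e, L2_on leb setT (fun s => Gy e (x, s))}.
  by apply: ae_forall_countable => e; exact: L2_slice.
have sec2 : {ae lamX, forall x, forall e, {ae leb, forall y, cylinder e (x, y) ->
    u e (x, y) = T (origin e) x + primitive (fun s => Gy e (x, s)) y}}.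
  by apply: ae_forall_countable => e; exact: (@ae_section R _ _ _ _ lamX leb _ (rep e)).
have sec3 : {ae lamX, forall x, forall e, {ae leb, forall y, cylinder e (x, y) -> 0 <= u e (x, y)}}.
  by apply: ae_forall_countable => e; exact: (@ae_section R _ _ _ _ lamX leb _ (u_ge0 e)).
have sec4 : {ae lamX, forall x, forall e w, terminus e = Some w ->
    T (origin e) x + primitive (fun s => Gy e (x, s)) (fine (elen e)) = T w x}.
  apply: ae_forall_countable => e; case E : (terminus e) => [w|]; last first.
    by apply: aeW.
  have efin : elen e \is a fin_num.
    rewrite ge0_fin_numE ?(ltW (elen_gt0 e))// lt_neqAle leey andbT.
    by rewrite -terminus_None E.
  have := @terminus_trace _ _ _ _ _ (elen_gt0 e) (u2 e) (weak_dy e) (fine (elen e)) _ (T w)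
    (esym (fineK efin)) (mT _) (mT _) (rep e) (trT w e true E).
  by apply: ae_impl => x H w' [<-].
have := ae_and (ae_and sec1 sec2) (ae_and sec3 sec4).
apply: ae_impl => x [[x1 x2] [x3 x4]]; exists (T ^~ x); split => //.
have := @ae_glue R (edge G) _ _ leb _ (fun e => ae_and (x2 e) (x3 e)).
apply: ae_impl => -[n y] H; rewrite /U /graph_profile /glue /=.
case EQ : (pickle_inv n) => [e|]//; have [/= H1 H2] := H e EQ.
rewrite !patchE; have [ey|ey] := boolP (y \in edge_interior e).
  have cy : cylinder e (x, y) by split => //=; exact/set_mem.
  by rewrite mem_set// max_l ?H2// H1.
rewrite memNset ?maxxx// => -[_ /= ey']; move: ey; rewrite notin_setE; exact.
Qed.

(** Distribution functions, hence rearrangements, do not see null sets, so the estimate for the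
    profile passes to the slice itself; the sets over which the slope is integrated also agree
    almost everywhere. *)
Lemma slice_modulus : {ae lamX, forall x, forall a b : R, 0 < a -> a < b -> (b%:E < l)%E ->
  (((rearr nu (U x) a - rearr nu (U x) b) ^+ 2)%:E <=
   (b - a)%:E * \int[nu]_(p in [set p |
      (rearr nu (U x) b < U x p < rearr nu (U x) a)%R]) (slice_slope x p ^+ 2)%:E)%E}.
Proof.
have := ae_and slice_profile slice_vanishing_L2.
apply: ae_impl => x [[T [g2 FT ae_profile]] [_ vU]] a b a0 ab bl.
set P := graph_profile T _ in ae_profile.
have mP : measurable_fun setT (P : (nat * mR)%type -> R) by exact: measurable_graph_profile.
have mUx := measurable_graph_slice x.
have dE t : distr nu (U x) t = distr nu P t.
  apply: ae_eq_measure; [exact: measurable_gt|exact: measurable_gt|].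
  by apply: ae_impl ae_profile => p /= ->.
have rE : rearr nu (U x) = rearr nu P by apply: eq_rearr => t _; exact: dE.
have vP : vanishing nu P.
  by move=> y y0; have [n Hn] := vU y y0; exists n; rewrite -dE.
rewrite rE; apply: le_trans (graph_profile_modulus G_connected g2 FT vP a0 ab bl) _.
rewrite -/P; apply: lee_wpmul2l; first by rewrite lee_fin subr_ge0 ltW.
rewrite le_eqVlt; apply/orP; left; apply/eqP.
have mset (f : nat * R -> R) : measurable_fun setT (f : (nat * mR)%type -> R) ->
    measurable ([set p | rearr nu P b < f p < rearr nu P a] : set (nat * mR)).
  move=> mf; apply: measurable_set_bool; apply: measurable_and; exact: measurable_fun_ltr.
have ms : measurable_fun setT (fun p : nat * mR => (slice_slope x p ^+ 2)%:E).
  exact: (measurable_fun_pair2 x mslope2).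
rewrite -/(slice_slope x) integral_mkcond [RHS]integral_mkcond.
apply: ae_eq_integral.
- exact: measurableT.
- by apply: (measurable_restrictT _ (mset _ mP)).1; exact: measurable_funTS.
- by apply: (measurable_restrictT _ (mset _ mUx)).1; exact: measurable_funTS.
apply: ae_impl ae_profile => p Up _; rewrite !patchE.
move: (rearr nu P b) (rearr nu P a) => s t.
have memE (f : nat * R -> R) : (p \in [set p | s < f p < t]) = (s < f p < t).
  by apply/idP/idP => [/set_mem|/mem_set].
by rewrite !memE Up.
Qed.

Lemma shift_diff_y h : 0 < h ->
  (\int[mu]_z (shift_diff (cyl l) y_dir slice_rearr h z ^+ 2)%:E <=
   (h ^+ 2)%:E * \esum_(e in [set: edge G]) \int[mu]_z (Gy e z ^+ 2)%:E)%E.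
Proof.
move=> h0; have mus := measurable_slice_rearr.
have msd : measurable_fun setT (fun z : mV => (shift_diff (cyl l) y_dir slice_rearr h z ^+ 2)%:E).
  apply/measurable_EFinP/measurable_funX.
  have mO := @measurable_cyl R N l.
  have mI : measurable (cyl l `&` [set z | cyl l (z + h *: y_dir)] : set mV).
    by apply: measurableI => //; exact: measurable_preimage_shift.
  apply: (measurable_restrictT _ mI).1; apply: measurable_funTS; apply: measurable_funB => //.
  by apply: (measurableT_comp mus); exact: measurable_shift.
have sd0 z : (0 <= (shift_diff (cyl l) y_dir slice_rearr h z ^+ 2)%:E)%E by rewrite lee_fin sqr_ge0.
rewrite (fubini_tonelli1 _ msd sd0) /fubini_F -integral_slope_energy.
rewrite -ge0_integralZl//; last 3 first.
- exact: measurable_slope_energy.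
- by move=> x _; exact: slope_energy_ge0.
- by rewrite lee_fin sqr_ge0.
apply: ae_ge0_le_integral => //.
- by move=> x _; apply: integral_ge0 => y _; exact: sd0.
- exact: (@measurable_fun_fubini_tonelli_F _ _ _ _ R leb _ msd sd0).
- by move=> x _; rewrite mule_ge0 ?slope_energy_ge0// lee_fin sqr_ge0.
- by apply: measurable_funeM; exact: measurable_slope_energy.
have := ae_and slice_modulus slice_vanishing_L2.
apply: ae_impl => x [modx [_ vx]] _.
have ms : measurable_fun setT (fun p : nat * mR => slice_slope x p ^+ 2).
  by apply: measurable_funX; exact: (measurable_fun_pair2 x mslope).
apply: le_trans (rearr_modulus (l := l) (measurable_graph_slice x) (graph_slice_ge0 x) vx
  ms (fun p => sqr_ge0 _) h0 (modx)).
rewrite [leRHS]integral_mkcond le_eqVlt; apply/orP; left; apply/eqP.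
apply: eq_integral => y _; rewrite /shift_diff !patchE.
have -> : ((x, y) \in cyl l `&` [set z | cyl l (z + h *: y_dir)]) =
    (y \in [set y : R | 0 < y /\ ((y + h)%:E < l)%E]).
  apply/idP/idP => /set_mem H; apply/mem_set.
    by case: H => -[_ [/= y0 _]]; rewrite add_y_dir => -[_ [_ /= yl]].
  case: H => y0 yl; split; first split => //=.
    by split => //; apply: lt_trans yl; rewrite lte_fin ltrDl.
  rewrite /= add_y_dir; split => //=; split => //; lra.
by case: ifP => _; rewrite ?add_y_dir// expr0n.
Qed.

Let max_contraction (a b : R) : (Num.max a 0 - Num.max b 0) ^+ 2 <= (a - b) ^+ 2.
Proof.
have key (c d : R) : c <= 0 -> 0 <= d -> d ^+ 2 <= (c - d) ^+ 2.
  by move=> c0 d0; have := mulr_ge0 (_ : 0 <= - c) d0; rewrite oppr_ge0 => /(_ c0); have := sqr_ge0 c; nra.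
case: (leP a 0) => a0; case: (leP b 0) => b0 //.
- by rewrite subrr expr0n sqr_ge0.
- by rewrite sub0r sqrrN key// ltW.
- by rewrite subr0 -[leRHS]sqrrN opprB key// ltW.
Qed.

(** Directions of R^N preserve the cylinder, so the increment formula holds on all of it, and off it
    both values are 0. Taking the positive part only decreases increments. *)
Let edge_shift_x i h e : 0 < h ->
  (\int[mu]_z ((Num.max (F e (z + h *: x_dir i)) 0 - Num.max (F e z) 0) ^+ 2)%:E <=
   (h ^+ 2)%:E * \int[mu]_z (Gx i e z ^+ 2)%:E)%E.
Proof.
move=> h0.
have OP (z : V) s : cyl (elen e) z -> 0 <= s <= h -> cylinder e (z + s *: x_dir i).
  by rewrite add_x_dir => -[_ H] _; split.
have := @weak_derivative_increment _ _ h h0 _ _ _ _ _ (mcyl e) (weak_dx i e) (u2 e) OP _ erefl.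
have [A2 Ab] := line_average_bound h0 (x_dir i) (Gx2 i e).
move=> inc; apply: le_trans Ab; have [mA _] := A2.
have mFs : measurable_fun setT ((fun z => F e (z + h *: x_dir i)) : mV -> R).
  by apply: (measurableT_comp (mF e)); exact: measurable_shift.
apply: ae_ge0_le_integral => //.
- by move=> z _; rewrite lee_fin sqr_ge0.
- apply/measurable_EFinP/measurable_funX/measurable_funB; last exact: mmax.
  by apply: measurable_maxr => //; exact: measurable_cst.
- by move=> z _; rewrite lee_fin sqr_ge0.
- by apply/measurable_EFinP; exact: measurable_funX.
apply: ae_impl inc => z Hz _; rewrite lee_fin; apply: le_trans (max_contraction _ _) _.
have [cz|ncz] := pselect (cylinder e z); first by rewrite Hz.
rewrite !patchE memNset; last by rewrite add_x_dir => -[_ H]; apply: ncz; split.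
by rewrite memNset// subrr expr0n sqr_ge0.
Qed.

Lemma shift_diff_x i h : 0 < h ->
  (\int[mu]_z (shift_diff (cyl l) (x_dir i) slice_rearr h z ^+ 2)%:E <=
   (h ^+ 2)%:E * \esum_(e in [set: edge G]) \int[mu]_z (Gx i e z ^+ 2)%:E)%E.
Proof.
move=> h0; have mus := measurable_slice_rearr.
have msd : measurable_fun setT (fun z : mV => (shift_diff (cyl l) (x_dir i) slice_rearr h z ^+ 2)%:E).
  apply/measurable_EFinP/measurable_funX.
  have mO := @measurable_cyl R N l.
  have mI : measurable (cyl l `&` [set z | cyl l (z + h *: x_dir i)] : set mV).
    by apply: measurableI => //; exact: measurable_preimage_shift.
  apply: (measurable_restrictT _ mI).1; apply: measurable_funTS; apply: measurable_funB => //.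
  by apply: (measurableT_comp mus); exact: measurable_shift.
have sd0 z : (0 <= (shift_diff (cyl l) (x_dir i) slice_rearr h z ^+ 2)%:E)%E by rewrite lee_fin sqr_ge0.
rewrite (fubini_tonelli1 _ msd sd0) /fubini_F.
pose f e z := (Num.max (F e (z + h *: x_dir i)) 0 - Num.max (F e z) 0) ^+ 2.
have mf e : measurable_fun setT (f e : mV -> R).
  apply/measurable_funX/measurable_funB; last exact: mmax.
  apply: measurable_maxr; last exact: measurable_cst.
  by apply: (measurableT_comp (mF e)); exact: measurable_shift.
apply: (@le_trans _ _ (\esum_(e in [set: edge G]) \int[mu]_z (f e z)%:E)%E); last first.
  rewrite -esumZl_countable ?sqr_ge0//; last by move=> e; apply: integral_ge0 => z _; rewrite lee_fin sqr_ge0.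
  by apply: le_esum => e _; exact: edge_shift_x.
rewrite -(@integral_glue_param R (edge G) _ _ _ _ lamX leb _ mf (fun e z => sqr_ge0 _)).
pose w : 'rV[R]_N := h *: delta_mx ord0 i.
have mUw : measurable_fun setT (fun q : 'rV[R]_N * (nat * mR) => (U (q.1 + w) q.2 - U q.1 q.2) ^+ 2).
  apply: measurable_funX; apply: measurable_funB; last exact: mU.
  have mphi : measurable_fun setT (fun q : 'rV[R]_N * (nat * mR) => (q.1 + w, q.2)).
    apply: measurable_fun_pair => //.
    exact: (measurableT_comp (measurable_rV_shift w) measurable_fst).
  exact: (measurableT_comp mU mphi).
have glueE x p : glue f p.1 (x, p.2) = (U (x + w) p - U x p) ^+ 2.
  rewrite /U /glue /f; case: pickle_inv => [e|]; last by rewrite subrr expr0n.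
  by rewrite add_x_dir.
have E : (\int[lamX]_x \int[nu]_p (glue f p.1 (x, p.2))%:E =
    \int[lamX]_x \int[nu]_p ((U (x + w) p - U x p) ^+ 2)%:E)%E.
  by apply: eq_integral => x _; apply: eq_integral => p _; rewrite glueE.
rewrite E; have mUwE : measurable_fun setT (fun q : 'rV[R]_N * (nat * mR) => ((U (q.1 + w) q.2 - U q.1 q.2) ^+ 2)%:E).
  exact/measurable_EFinP.
have Uw0 (q : 'rV[R]_N * (nat * mR)) : (0 <= ((U (q.1 + w) q.2 - U q.1 q.2) ^+ 2)%:E)%E.
  by rewrite lee_fin sqr_ge0.
apply: ae_ge0_le_integral => //.
- by move=> x _; apply: integral_ge0 => y _; exact: sd0.
- exact: (@measurable_fun_fubini_tonelli_F _ _ _ _ R leb _ msd sd0).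
- by move=> x _; apply: integral_ge0 => p _; exact: (Uw0 (x, p)).
- exact: (@measurable_fun_fubini_tonelli_F _ _ _ _ R nu _ mUwE Uw0).
(* The contraction compares the slices at x and at x + w, and both have to be vanishing;
   translations preserve null sets of R^N. *)
have := ae_and slice_vanishing_L2
  (ae_preimage (lebesgue_rV_shift w) (measurable_rV_shift w) slice_vanishing_L2).
apply: ae_impl => x [[_ vx] [_ vxw]] _.
apply: le_trans (rearr_contraction (measurable_graph_slice _) (measurable_graph_slice _)
  (graph_slice_ge0 _) (graph_slice_ge0 _) vxw vx).
rewrite [leRHS]integral_mkcond; apply: ge0_le_integral => //.
- exact: (measurable_fun_pair2 x msd).
- have mpos : measurable (`]0, +oo[%classic : set mR) by exact: measurable_itv.
  apply: (measurable_restrictT _ mpos).1; apply: measurable_funTS.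
  apply/measurable_EFinP/measurable_funX/measurable_funB; exact: measurable_rearr (measurable_graph_slice _).
move=> y _; rewrite /shift_diff !patchE; case: ifPn => [/set_mem[[_ [/= y0 _]] _]|_].
  by rewrite mem_set ?add_x_dir//= in_itv /= y0.
by rewrite expr0n /=; case: ifP => _ //; rewrite lee_fin sqr_ge0.
Qed.

End graph_slices.

(** * The rearranged function *)

Section rearrangement_sobolev.
Context {R : realType} (G : metric_graph R) (N : nat).
Local Notation V := ('rV[R]_N * R)%type.
Local Notation mR := (measurableTypeR R).
Local Notation mV := ('rV[R]_N * measurableTypeR R)%type.
Local Notation mu := (@lebesgue_prod R N).
Local Notation leb := (@lebesgue_measure R).
Local Notation lamX := (@lebesgue_rV R N).
Local Notation nu := (sf_product (@counting nat R) leb).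
Local Notation l := (total_length G).
Variable u : edge G -> V -> R.
Hypothesis G_connected : graph_connected G.
Hypothesis u_H1 : H1_graph u.
Hypothesis u_ge0 : nonneg_ae u.
Local Notation us := (slice_rearr u).

Let mcyl (e : edge G) : measurable (cylinder e : set mV).
Proof. exact: (@measurable_cyl R N (elen e)). Qed.

Let mO : measurable (cyl l : set mV). Proof. exact: measurable_cyl. Qed.

Let mus : measurable_fun setT (us : mV -> R). Proof. exact: measurable_slice_rearr. Qed.

Lemma slice_rearr_L2 : L2_on mu (cyl l) us.
Proof.
split; first exact: measurable_funTS.
have p2 (a : R) : a ^+ 2 = `|a| `^ 2%:R by rewrite powR_mulrn// real_normK ?num_real.
under eq_integral do rewrite p2.
rewrite integral_slice_rearr_powR// ?ler1n//.
apply: le_lt_trans (value_energy_lty u_H1); apply: le_esum => e _.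
rewrite -integral_sqr_patch le_eqVlt; apply/orP; left; apply/eqP.
by apply: eq_integral => z _; rewrite -p2.
Qed.

Let weak_of_shift v (C : \bar R) : (0 <= C)%E -> (C < +oo)%E ->
  (forall h, 0 < h -> (\int[mu]_z (shift_diff (cyl l) v us h z ^+ 2)%:E <= (h ^+ 2)%:E * C)%E) ->
  (exists g, is_weak_derivative (cyl l) v us g) /\
  (\int[mu]_(z in cyl l) (weak_derivative (cyl l) v us z ^+ 2)%:E <= C)%E.
Proof.
case: C => [C| |]// C0 _ H; rewrite lee_fin in C0.
apply: weak_derivative_bound => //; first exact: slice_rearr_L2.
apply: shift_diff_criterion => //; [exact: cyl_open|exact: slice_rearr_L2|].
by move=> h h0; apply: le_trans (H h h0) _; rewrite -EFinM mulrC.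
Qed.

Lemma slice_rearr_dy : (exists g, is_weak_derivative (cyl l) y_dir us g) /\
  (\int[mu]_(z in cyl l) (d_y (cyl l) us z ^+ 2)%:E <= d_y_normsq u)%E.
Proof.
have -> : d_y_normsq u = (\esum_(e in [set: edge G])
    \int[mu]_z ((d_y (cylinder e) (u e) \_ (cylinder e)) z ^+ 2)%:E)%E.
  by apply: eq_esum => e _; rewrite integral_sqr_patch.
apply: weak_of_shift; last by move=> h h0; exact: shift_diff_y.
  by apply: esum_ge0 => e _; apply: integral_ge0 => z _; rewrite lee_fin sqr_ge0.
exact: dy_energy_lty.
Qed.

Let dx_energy i : \bar R := (\esum_(e in [set: edge G])
  \int[mu]_(z in cylinder e) (d_x (cylinder e) i (u e) z ^+ 2)%:E)%E.

Let dx_energyE i : dx_energy i = (\esum_(e in [set: edge G])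
    \int[mu]_z ((d_x (cylinder e) i (u e) \_ (cylinder e)) z ^+ 2)%:E)%E.
Proof. by apply: eq_esum => e _; rewrite integral_sqr_patch. Qed.

Lemma slice_rearr_dx i : (exists g, is_weak_derivative (cyl l) (x_dir i) us g) /\
  (\int[mu]_(z in cyl l) (d_x (cyl l) i us z ^+ 2)%:E <= dx_energy i)%E.
Proof.
rewrite dx_energyE; apply: weak_of_shift; last by move=> h h0; exact: shift_diff_x.
  by apply: esum_ge0 => e _; apply: integral_ge0 => z _; rewrite lee_fin sqr_ge0.
exact: dx_energy_lty.
Qed.

(** Enlarging the level set to the whole graph gives a Hölder bound of exponent 1/2 whose constant
    does not depend on a and b, hence remains valid up to the ends of the interval. *)
Lemma slice_rearr_lipschitz : {ae lamX, forall x, forall a b : R, 0 < a -> a < b ->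
  (b%:E < l)%E ->
  (((us (x, a) - us (x, b)) ^+ 2)%:E <= (b - a)%:E * slope_energy u x)%E}.
Proof.
have := slice_modulus G_connected u_H1 u_ge0; apply: ae_impl => x H a b a0 ab bl.
apply: le_trans (H a b a0 ab bl) _; apply: lee_wpmul2l; first by rewrite lee_fin subr_ge0 ltW.
have mUx := measurable_graph_slice u_H1 x.
apply: ge0_subset_integral => //.
- by apply: measurable_set_bool; apply: measurable_and; exact: measurable_fun_ltr.
- by apply/measurable_EFinP/measurable_funTS/measurable_funX; exact: measurable_slice_slope.
- by move=> p _; rewrite lee_fin sqr_ge0.
Qed.

Section end_trace.
Variable b : bool.
Hypothesis b_end : b -> l != +oo%E.

(** When the length is infinite only the end 0 exists and only points near it matter; 1 is then an
    arbitrary width. *)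
Let r : R := if l is r'%:E%E then r' else 1.

Let r0 : 0 < r.
Proof. by have := total_length_gt0 G; rewrite /r; case: (total_length G). Qed.

Let rl : (r%:E <= l)%E.
Proof. by have := total_length_gt0 G; rewrite /r; case: (total_length G) => // _; rewrite leey. Qed.

Let zeta (s : R) : R := edge_point (tt : edge (star_graph G)) b s.

Let zetaE s : zeta s = if b then r - s else s.
Proof.
rewrite /zeta /edge_point /=; case: (b) b_end => // /(_ isT).
by have := total_length_gt0 G; rewrite /r; case: (total_length G).
Qed.

Let zeta_in s : 0 < s -> s < r -> 0 < zeta s /\ ((zeta s)%:E < l)%E.
Proof.
move=> s0 sr; rewrite zetaE; case: ifP => _; split.
- by rewrite subr_gt0.
- by apply: lt_le_trans rl; rewrite lte_fin gtrBl.
- exact: s0.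
- by apply: lt_le_trans rl; rewrite lte_fin.
Qed.

Let w (z : V) : R := us (z.1, zeta z.2).

Let measurable_zeta : measurable_fun setT ((fun z : V => (z.1, zeta z.2)) : mV -> mV).
Proof.
apply: measurable_fun_pair => //.
have -> : (fun z : mV => zeta z.2) = (fun z : mV => if b then r - z.2 else z.2).
  by apply/funext => z; rewrite zetaE.
case: (b) => /=; last exact: measurable_snd.
by apply: measurable_funB; [exact: measurable_cst|exact: measurable_snd].
Qed.

Let mw : measurable_fun setT (w : mV -> R).
Proof. exact: (measurableT_comp mus measurable_zeta). Qed.

Let energy : \bar R := (\int[lamX]_x slope_energy u x)%E.

Let energy_fin : exists2 C : R, 0 <= C & energy = C%:E.
Proof.
have E0 : (0 <= energy)%E by apply: integral_ge0 => x _; exact: slope_energy_ge0.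
have : (energy < +oo)%E by rewrite /energy (integral_slope_energy u_H1); exact: dy_energy_lty.
by case: energy E0 => [C| |]// C0 _; exists C.
Qed.

Let mslope_energy : measurable_fun setT (slope_energy u : 'rV[R]_N -> \bar R).
Proof. exact: measurable_slope_energy. Qed.

Let w_lipschitz : {ae lamX, forall x, slope_energy u x \is a fin_num /\
  forall s t, 0 < s < r -> 0 < t < r ->
    (w (x, s) - w (x, t)) ^+ 2 <= `|s - t| * fine (slope_energy u x)}.
Proof.
have iE : lamX.-integrable setT (slope_energy u).
  apply/integrableP; split => //; have [C _ EC] := energy_fin.
  apply: (@le_lt_trans _ _ energy); last by rewrite EC ltry.
  rewrite le_eqVlt; apply/orP; left; apply/eqP; apply: eq_integral => x _.
  by rewrite gee0_abs// slope_energy_ge0.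
have := ae_and (integrable_ae measurableT iE) slice_rearr_lipschitz.
apply: ae_impl => x [/(_ Logic.I) xfin H]; split => //.
have key c d : 0 < c -> c < d -> (d%:E < l)%E ->
    (us (x, c) - us (x, d)) ^+ 2 <= (d - c) * fine (slope_energy u x).
  by move=> c0 cd dl; have := H c d c0 cd dl; rewrite -{1}(fineK xfin) -EFinM lee_fin.
move=> s t /andP[s0 sr] /andP[t0 tr]; rewrite /w /=.
have [zs0 zsl] := zeta_in s0 sr; have [zt0 ztl] := zeta_in t0 tr.
have -> : `|s - t| = `|zeta s - zeta t|.
  rewrite !zetaE; case: (b) => //.
  by rewrite (_ : r - s - (r - t) = t - s); [exact: distrC|ring].
have [lt|lt|->] := ltgtP (zeta s) (zeta t).
- by rewrite distrC gtr0_norm ?subr_gt0//; exact: key.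
- by rewrite gtr0_norm ?subr_gt0// -sqrrN opprB; exact: key.
- by rewrite !subrr normr0 mul0r expr0n.
Qed.

(** Points tending to the end at rate 4^-n: by the Hölder bound, the squared increments of w along
    them, multiplied by 4^n, stay bounded, which is the hypothesis of [cvg_of_scaled_increments].
    The factor 2 keeps the first point strictly below r. *)
Let s_ (n : nat) : R := r / (2 * 4 ^+ n).

Let s_gt0 n : 0 < s_ n. Proof. by rewrite divr_gt0// mulr_gt0// exprn_gt0. Qed.

Let s_ltr n : s_ n < r.
Proof.
have p1 : (1 : R) <= 4 ^+ n by rewrite exprn_ege1// ler1n.
by rewrite /s_ ltr_pdivrMr ?mulr_gt0 ?exprn_gt0// ltr_pMr//; lra.
Qed.

Let s_S n : s_ n - s_ n.+1 = 3 / 4 * s_ n.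
Proof. by rewrite /s_ exprS; field; rewrite gt_eqF// exprn_gt0. Qed.

Let s_small (s : R) : 0 < s -> exists n0 : nat, forall n, (n0 <= n)%N -> s_ n <= s.
Proof.
move=> s0; exists (Num.truncn (r / s)).+1 => n n0n; rewrite /s_.
rewrite ler_pdivrMr ?mulr_gt0 ?exprn_gt0// mulrC -ler_pdivrMr//.
apply/ltW; apply: (@lt_le_trans _ _ (Num.truncn (r / s)).+1%:R); first exact: truncnS_gt.
apply: (@le_trans _ _ n%:R); first by rewrite ler_nat.
apply: (@le_trans _ _ (4 ^+ n)); last by rewrite ler_peMl ?exprn_ge0// ler1n.
by rewrite -natrX ler_nat ltnW// ltn_expl.
Qed.

(** An upper limit along a fixed sequence is measurable in x; on almost every slice it is the true
    limit at the end. *)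
Let T (x : 'rV[R]_N) : R := fine (limn_esup (fun n => (w (x, s_ n))%:E)).

Let mT : measurable_fun setT T.
Proof.
by apply: limn_esup_fin_measurable => n; exact: (measurable_fun_pair1 (s_ n) mw).
Qed.

Let T_bound : {ae lamX, forall x, slope_energy u x \is a fin_num /\
  forall s, 0 < s < r -> (w (x, s) - T x) ^+ 2 <= s * fine (slope_energy u x)}.
Proof.
apply: ae_impl w_lipschitz => x [xfin H]; split => // s /andP[s0 sr].
set k := fine _ in H *; have k0 : 0 <= k by rewrite fine_ge0// slope_energy_ge0.
have cw : (fun n => w (x, s_ n)) @ \oo --> T x.
  apply: fine_limn_esup_cvg; apply: (@cvg_of_scaled_increments _ _ (r * k)) => n.
  have := H (s_ n.+1) (s_ n); rewrite !s_gt0 !s_ltr => /(_ isT isT) H1.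
  have d0 : `|s_ n.+1 - s_ n| = 3 / 4 * s_ n.
    by rewrite distrC s_S ger0_norm// mulr_ge0// ltW.
  rewrite d0 in H1.
  have p0 : (0 : R) < 4 ^+ n by rewrite exprn_gt0.
  apply: (@le_trans _ _ (4 ^+ n * (3 / 4 * s_ n * k))); first by rewrite ler_wpM2l// ltW.
  have -> : 4 ^+ n * (3 / 4 * s_ n * k) = 3 / 8 * (r * k).
    by rewrite /s_; field; rewrite gt_eqF.
  by rewrite ler_piMl ?mulr_ge0// ?ltW//; lra.
have cd : (fun n => (w (x, s) - w (x, s_ n)) ^+ 2) @ \oo --> (w (x, s) - T x) ^+ 2.
  rewrite expr2; under eq_fun do rewrite expr2.
  by apply: cvgM; apply: cvgB => //; exact: cvg_cst.
apply: (cvgr_to_le cd); have [n0 Hn0] := s_small s0.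
exists n0 => // n /= n0n; have sn := Hn0 n n0n.
apply: le_trans (H s (s_ n) _ _) _; rewrite ?s0 ?sr ?s_gt0 ?s_ltr//.
rewrite ler_wpM2r// ger0_norm ?subr_ge0//.
by rewrite lerBlDr lerDl ltW.
Qed.

Let slab h : set R := [set s : R | 0 < s < h].

Let mslab h : measurable (slab h : set mR).
Proof. by apply: measurable_set_bool; apply: measurable_and; exact: measurable_fun_ltr. Qed.

Let mXslab h : measurable (setT `*` slab h : set mV). Proof. exact: measurableX. Qed.

Let leb_slab h : 0 < h -> leb (slab h) = h%:E.
Proof.
move=> h0; have -> : slab h = `]0, h[%classic by apply/seteqP; split => y; rewrite /= in_itv.
by rewrite lebesgue_itvoo subr0 max_l// ltW.
Qed.

Let mTw : measurable_fun setT (fun z : mV => ((w z - T z.1) ^+ 2)%:E).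
Proof.
apply/measurable_EFinP/measurable_funX.
exact: (measurable_funB mw (measurableT_comp mT measurable_fst)).
Qed.

(** One factor h is the Hölder bound at distance at most h from the end, the other the width of the
    slab; after division by h the mean is O(h). *)
Let mean_bound C h : energy = C%:E -> 0 < h -> h < r ->
  (\int[mu]_(z in setT `*` slab h) ((w z - T z.1) ^+ 2)%:E <= (h ^+ 2 * C)%:E)%E.
Proof.
move=> EC h0 hr.
apply: (@le_trans _ _ (\int[mu]_(z in setT `*` slab h) (h%:E * slope_energy u z.1))%E).
  apply: ae_ge0_le_integral => //.
  - by move=> z _; rewrite lee_fin sqr_ge0.
  - exact: measurable_funTS.
  - by move=> z _; rewrite mule_ge0 ?slope_energy_ge0// lee_fin ltW.
  - apply/measurable_funTS/measurable_funeM; exact: (measurableT_comp mslope_energy measurable_fst).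
  apply: ae_impl (@ae_fst _ _ _ _ _ lamX leb _ T_bound) => -[x s] [/= xfin H] [_ /= /andP[s0 sh]].
  rewrite -(fineK xfin) -EFinM lee_fin; apply: le_trans (H s _) _.
    by rewrite s0 (lt_trans sh).
  by rewrite ler_wpM2r ?fine_ge0 ?slope_energy_ge0// ltW.
rewrite (@integral_fst_slab _ N (fun x => h%:E * slope_energy u x)%E (slab h))//; last 2 first.
- exact: measurable_funeM.
- by move=> x; rewrite mule_ge0 ?slope_energy_ge0// lee_fin ltW.
rewrite ge0_integralZl//; last 2 first.
- by move=> x _; exact: slope_energy_ge0.
- by rewrite lee_fin ltW.
by rewrite leb_slab// -/energy EC -!EFinM expr2 mulrA.
Qed.

Let w_L2 h : 0 < h -> h < r ->
  (\int[mu]_(z in setT `*` slab h) (w z ^+ 2)%:E < +oo)%E.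
Proof.
move=> h0 hr; have [_] := slice_rearr_L2; apply: le_lt_trans.
pose k (z : V) : \bar R := (((us \_ (cyl l)) z) ^+ 2)%:E.
have mk : measurable_fun setT (k : mV -> \bar R).
  apply/measurable_EFinP/measurable_funX.
  by apply: (measurable_restrictT _ mO).1; exact: measurable_funTS.
have k0 z : (0 <= k z)%E by rewrite lee_fin sqr_ge0.
have -> : (\int[mu]_(z in cyl l) (us z ^+ 2)%:E = \int[mu]_z k (z.1, zeta z.2))%E.
  rewrite integral_sqr_patch.
  have zE (z : V) : (z.1, zeta z.2) = if b then reflect_y r z else z.
    by rewrite zetaE; case: (b) => //; case: z.
  under [RHS]eq_integral do rewrite zE.
  case: (b); [exact/esym/ge0_integral_reflect_y|by []].
rewrite integral_mkcond; apply: ge0_le_integral => //.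
- by move=> z _; rewrite patchE; case: ifP => // _; rewrite lee_fin sqr_ge0.
- apply: (measurable_restrictT _ (mXslab h)).1; apply: measurable_funTS.
  by apply/measurable_EFinP; exact: measurable_funX.
- exact: (measurableT_comp mk measurable_zeta).
move=> z _; rewrite patchE; case: ifPn => [/set_mem[_ /andP[s0 sh]]|_]; last exact: k0.
rewrite /k patchE mem_set//; have [z0 zl] := zeta_in s0 (lt_trans sh hr).
by split.
Qed.

Lemma slice_rearr_trace : exists2 T : 'rV[R]_N -> R, L2_on lamX setT T &
  is_trace (tt : edge (star_graph G)) b us T.
Proof.
have [C C0 EC] := energy_fin; exists T.
  split=> //; have h0 : 0 < r / 2 by rewrite divr_gt0.
  have hr : r / 2 < r by lra.
  (* T does not depend on y, so its squared norm times r / 2 is an integral over a slab, where T^2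
     <= 2 w^2 + 2 (w - T)^2. *)
  suff : ((r / 2)%:E * \int[lamX]_x (T x ^+ 2)%:E < +oo)%E.
    by rewrite !ltey; apply: contra_neq => ->; rewrite gt0_muley// lte_fin.
  have mT2 : measurable_fun setT (fun x => (T x ^+ 2)%:E) by apply/measurable_EFinP/measurable_funX.
  have := @integral_fst_slab _ N (fun x => (T x ^+ 2)%:E) (slab (r / 2)) mT2.
  rewrite leb_slab// => <- //; last by move=> x; rewrite lee_fin sqr_ge0.
  apply: (@le_lt_trans _ _ (\int[mu]_(z in setT `*` slab (r / 2)%R)
      (2%:E * (w z ^+ 2)%:E + 2%:E * ((w z - T z.1) ^+ 2)%:E))%E).
    apply: ge0_le_integral => //.
    - by move=> z _; rewrite lee_fin sqr_ge0.
    - apply: measurable_funTS; exact: (measurableT_comp mT2 measurable_fst).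
    - apply: measurable_funTS; apply: emeasurable_funD; apply: measurable_funeM => //.
      by apply/measurable_EFinP; exact: measurable_funX.
    move=> z _; rewrite -!EFinM -EFinD lee_fin.
    by have := sqr_ge0 (2 * w z - T z.1); nra.
  rewrite ge0_integralD//; last 4 first.
  - by move=> z _; rewrite -EFinM lee_fin mulr_ge0// sqr_ge0.
  - apply: measurable_funTS; apply: measurable_funeM.
    by apply/measurable_EFinP; exact: measurable_funX.
  - by move=> z _; rewrite -EFinM lee_fin mulr_ge0// sqr_ge0.
  - by apply: measurable_funTS; exact: measurable_funeM.
  rewrite !ge0_integralZl//; last 4 first.
  - exact: measurable_funTS.
  - by move=> z _; rewrite lee_fin sqr_ge0.
  - by apply: measurable_funTS; apply/measurable_EFinP; exact: measurable_funX.
  - by move=> z _; rewrite lee_fin sqr_ge0.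
  apply: lte_add_pinfty; apply: lte_mul_pinfty; rewrite ?lee_fin//; first exact: w_L2.
  by apply: le_lt_trans (mean_bound EC h0 hr) _; rewrite ltry.
rewrite /is_trace.
apply: (@squeeze_cvge _ _ _ _ (cst 0%E) _ (fun h => (h * C)%:E)).
- near=> h.
  have h0 : 0 < h by near: h; exact: nbhs_right_gt.
  have hr : h < r by near: h; exact: nbhs_right_lt.
  apply/andP; split.
    by rewrite mule_ge0 ?lee_fin ?invr_ge0 ?(ltW h0)//; apply: integral_ge0 => z _; rewrite lee_fin sqr_ge0.
  apply: (@le_trans _ _ (h^-1%:E * (h ^+ 2 * C)%:E)%E).
    by apply: lee_wpmul2l; [rewrite lee_fin invr_ge0 ltW|exact: mean_bound].
  by rewrite -EFinM lee_fin le_eqVlt; apply/orP; left; apply/eqP; field; rewrite gt_eqF.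
- exact: cvg_cst.
- apply: cvg_EFin; first exact: nearW.
  rewrite -[X in _ --> X](mul0r C); apply: cvgM; last exact: cvg_cst.
  exact: cvg_at_right_filter.
Unshelve. all: by end_near. Qed.

End end_trace.

End rearrangement_sobolev.

(** A vertex of the interval graph is reached from one edge end only, so the trace of u^{*y} at it
    has nothing to be matched with. *)
Lemma interval_edge_end (R : realType) (G : metric_graph R) (e : edge (star_graph G)) b v :
  edge_end e b = Some v -> b = val v.
Proof.
case: b => /=; last by case=> <-; rewrite SubK.
by case: insubP => //= w _ E [<-]; rewrite E.
Qed.

Lemma integral_normsq_grad_x {R : realType} N (D : set ('rV[R]_N * R)) f :
  measurable (D : set ('rV[R]_N * measurableTypeR R)) ->
  (forall i, exists g, is_weak_derivative D (x_dir i) f g) ->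
  (\int[lebesgue_prod]_(z in D) (normsq_grad_x D f z)%:E =
   \sum_(i < N) \int[lebesgue_prod]_(z in D) (d_x D i f z ^+ 2)%:E)%E.
Proof.
move=> mD Hx; under eq_integral do rewrite /normsq_grad_x -sumEFin.
rewrite ge0_integral_sum// => i => [|z _]; last by rewrite lee_fin sqr_ge0.
have [[m _] _] := weak_derivativeP (Hx i).
by apply/measurable_EFinP/measurable_funX.
Qed.

Theorem proposition3p7 (R : realType) (G : metric_graph R) (N : nat)
    (u : edge G -> 'rV[R]_N * R -> R)
    (G_connected : graph_connected G) (N_ge1 : (1 <= N)%N)
    (u_H1 : H1_graph u) (u_ge0 : nonneg_ae u) :
  [/\ H1_graph (y_rearrangement u),
      forall p : R, 1 <= p -> Lp_normp p (y_rearrangement u) = Lp_normp p u,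
      (d_y_normsq (y_rearrangement u) <= d_y_normsq u)%E
    & (grad_x_normsq (y_rearrangement u) <= grad_x_normsq u)%E].
Proof.
pose l := total_length G; pose us := slice_rearr u.
have -> : y_rearrangement u = fun=> us by apply/funext => e; exact: y_rearrangement_slice.
have mO : measurable (cyl l : set ('rV[R]_N * measurableTypeR R)) by exact: measurable_cyl.
have esum_unit (a : unit -> \bar R) : (0 <= a tt)%E -> (\esum_(e in [set: unit]) a e = a tt)%E.
  by move=> a0; rewrite (_ : [set: unit] = [set tt]) ?esum_set1//; apply/seteqP; split => -[].
have int0 (f : 'rV[R]_N * R -> R) : (forall z, 0 <= f z) ->
    (0 <= \int[lebesgue_prod]_(z in cyl l) (f z)%:E)%E.
  by move=> f0; apply: integral_ge0 => z _; rewrite lee_fin.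
have grad0 (D : set ('rV[R]_N * R)) f z : 0 <= normsq_grad_x D f z.
  by apply: sumr_ge0 => i _; exact: sqr_ge0.
have sus := slice_rearr_L2 u_H1 u_ge0.
have [wdy dy_le] := slice_rearr_dy G_connected u_H1 u_ge0.
have wdx i := (slice_rearr_dx u_H1 u_ge0 i).1.
have dx_le i := (slice_rearr_dx u_H1 u_ge0 i).2.
have Hdx i := weak_derivativeP (wdx i).
have Hdy := weak_derivativeP wdy.
(* The contraction holds one direction at a time, so the sum over directions is moved outside the
   sum over edges. *)
have grad_xE : grad_x_normsq u = (\sum_(i < N) \esum_(e in [set: edge G])
    \int[lebesgue_prod]_(z in cylinder e) (d_x (cylinder e) i (u e) z ^+ 2)%:E)%E.
  rewrite -esum_sum; last first.
    by move=> e i _ _; apply: integral_ge0 => z _; rewrite lee_fin sqr_ge0.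
  apply: eq_esum => e _; rewrite integral_normsq_grad_x//; first exact: (@measurable_cyl R N (elen e)).
  by have [/(_ e)[]] := u_H1.
have grad_le : (\int[lebesgue_prod]_(z in cyl l) (normsq_grad_x (cyl l) us z)%:E <= grad_x_normsq u)%E.
  rewrite integral_normsq_grad_x// grad_xE.
  by apply: lee_sum => i _; exact: dx_le.
have patch_energy e (f : 'rV[R]_N * R -> R) : (\int[lebesgue_prod]_(z in cylinder e) (f z ^+ 2)%:E =
    \int[lebesgue_prod]_z ((f \_ (cylinder e)) z ^+ 2)%:E)%E by exact: integral_sqr_patch.
have grad_fin : (grad_x_normsq u < +oo)%E.
  rewrite grad_xE; apply: lte_sum_pinfty => i _; under eq_esum do rewrite patch_energy.
  exact: dx_energy_lty.
have dy_fin : (d_y_normsq u < +oo)%E.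
  rewrite /d_y_normsq; under eq_esum do rewrite patch_energy; exact: dy_energy_lty.
split.
- split.
  + by move=> e; split.
  + rewrite esum_unit; last by apply: int0 => z; rewrite !addr_ge0// sqr_ge0.
    rewrite /H1_normsq; under eq_integral do rewrite !EFinD.
    rewrite ge0_integralD//; last 4 first.
    * by move=> z _; rewrite lee_fin addr_ge0// sqr_ge0.
    * apply/measurable_EFinP/measurable_funD; first by apply: measurable_funX; exact: sus.1.
      by apply: measurable_sum => i; apply: measurable_funX; exact: (Hdx i).1.1.
    * by move=> z _; rewrite lee_fin sqr_ge0.
    * by apply/measurable_EFinP/measurable_funX; exact: Hdy.1.1.
    rewrite ge0_integralD//; last 4 first.
    * by move=> z _; rewrite lee_fin sqr_ge0.
    * by apply/measurable_EFinP/measurable_funX; exact: sus.1.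
    * by move=> z _; rewrite lee_fin.
    * apply/measurable_EFinP.
      by apply: measurable_sum => i; apply: measurable_funX; exact: (Hdx i).1.1.
    apply: lte_add_pinfty; last exact: le_lt_trans dy_le dy_fin.
    by apply: lte_add_pinfty; [exact: sus.2|exact: le_lt_trans grad_le grad_fin].
  (* The vertex [true] exists only when the length is finite, as the trace at that end requires. *)
  + move=> v; have bv : val v -> l != +oo%E by move=> bt; have := valP v; rewrite bt.
    have [T T2 HT] := slice_rearr_trace G_connected u_H1 u_ge0 bv.
    exists T; first exact: T2.
    move=> e b /interval_edge_end ->; exact: HT.
- move=> p p1; rewrite /Lp_normp esum_unit ?integral_slice_rearr_powR//.
  by apply: esum_ge0 => e _; apply: integral_ge0 => z _; rewrite lee_fin powR_ge0.
- by rewrite [leLHS]esum_unit//; apply: int0 => z; exact: sqr_ge0.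
- by rewrite [leLHS]esum_unit//; exact: int0.
Qed.
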